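(* Let $N\ge1$ be an integer, let $\kappa$ be an even positive integer, and let $f(\tau)=\sum_{n\ge1}a(n)e^{2\pi i n\tau}$ be a holomorphic cusp form of weight $\kappa$ with respect to the Hecke congruence subgroup $\Gamma_0(N)$. For any non-negative integer $l$, the hyperplane $\{(s_1,s_2)\in\mathbb{C}^2: s_2=-l\}$ is a zero-divisor of $L_2(s_1,s_2;f)$; that is, the meromorphic function $L_2(s_1,s_2;f)$ vanishes along this hyperplane (outside the singular locus of $L_2$, which does not contain the hyperplane).
   Context: Write $\sigma_j=\Re s_j$. The function $L_2(s_1,s_2;f)$ is the meromorphic continuation to $\mathbb{C}^2$ of the double series $$L_2(s_1,s_2;f)=\sum_{m,n\ge1}\frac{a(n)}{m^{s_1}(m+n)^{s_2}},$$ which is absolutely convergent for $\sigma_2>\frac{\kappa+1}{2}$, $\sigma_1+\sigma_2>\frac{\kappa+3}{2}$. *)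

(* Defs.v *)
From Stdlib Require Import Reals ZArith.
From Coquelicot Require Import Coquelicot.
Open Scope R_scope.

Definition Cexp (z : C) : C :=
  (exp (Re z) * cos (Im z), exp (Re z) * sin (Im z)).

(* k^s with the real logarithm; meaningful for k >= 1. *)
Definition nat_cpow (k : nat) (s : C) : C :=
  Cexp (s * RtoC (ln (INR k)))%C.

(* Like [Series], this is total, and meaningful only when the series
   converges. *)
Definition CSeries (u : nat -> C) : C :=
  (Series (fun n => Re (u n)), Series (fun n => Im (u n))).

Definition upper_half_plane (tau : C) : Prop := 0 < Im tau.

Record SL2Z : Type := mkSL2Z {
  ma : Z; mb : Z; mc : Z; md : Z;
  SL2Z_det : (ma * md - mb * mc = 1)%Z }.

Definition Gamma0 (N : nat) (g : SL2Z) : Prop := (Z.of_nat N | mc g)%Z.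

Definition ZtoC (z : Z) : C := RtoC (IZR z).

Definition slash (kappa : nat) (g : SL2Z) (f : C -> C) (tau : C) : C :=
  (f ((ZtoC (ma g) * tau + ZtoC (mb g)) / (ZtoC (mc g) * tau + ZtoC (md g)))
   / (ZtoC (mc g) * tau + ZtoC (md g)) ^ kappa)%C.

(* f(tau) = sum_{n >= 1} a(n) e^{2 pi i n tau / w} on the upper half-plane;
   the value a 0 plays no role. *)
Definition cuspidal_expansion (w : nat) (a : nat -> C) (f : C -> C) : Prop :=
  forall tau : C, upper_half_plane tau ->
    is_series
      (fun n => (a (S n) *
         Cexp (RtoC (2 * PI * INR (S n) / INR w) * Ci * tau))%C)
      (f tau).

(* For every g in SL2(Z), f|g is invariant under translation by N, because
   Gamma(N) is contained in Gamma_0(N); vanishing at the cusps means that the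
   Fourier expansion of each f|g in powers of e^{2 pi i tau / N} has only
   terms of index n >= 1. *)
Definition cusp_form (N kappa : nat) (f : C -> C) : Prop :=
  (forall tau : C, upper_half_plane tau -> ex_derive f tau) /\
  (forall g : SL2Z, Gamma0 N g ->
     forall tau : C, upper_half_plane tau -> slash kappa g f tau = f tau) /\
  (forall g : SL2Z, exists b : nat -> C,
     cuspidal_expansion N b (slash kappa g f)).

Definition C2 : NormedModule C_AbsRing :=
  prod_NormedModule C_AbsRing C_NormedModule C_NormedModule.

(* Complex (Frechet) differentiability on a neighbourhood of p. *)
Definition holomorphic_at (F : C2 -> C) (p : C2) : Prop :=
  locally p (fun q : C2 => ex_filterdiff F (locally q)).

(* A meromorphic function is represented by a total function which is, near
   every point, a quotient g / h with h not the zero germ.  The values of F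
   where h vanishes are not constrained; see [value_at]. *)
Definition meromorphic (F : C2 -> C) : Prop :=
  forall p : C2, exists g h : C2 -> C,
    holomorphic_at g p /\ holomorphic_at h p /\
    ~ locally p (fun q : C2 => h q = RtoC 0) /\
    locally p (fun q : C2 => h q <> RtoC 0 -> F q = (g q / h q)%C).

(* The meromorphic function F is holomorphic near p, with value v at p.  The
   points where the representative F is itself holomorphic form a dense open
   set when F is meromorphic, so v is unique; F p may differ from v only by an
   arbitrary choice of F at a removable point. *)
Definition value_at (F : C2 -> C) (p : C2) (v : C) : Prop :=
  exists G : C2 -> C,
    holomorphic_at G p /\ G p = v /\
    locally p (fun q : C2 => holomorphic_at F q -> F q = G q).

Definition singular_locus (F : C2 -> C) (p : C2) : Prop :=
  ~ exists v : C, value_at F p v.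

(* The sum over m, n >= 1, written as an iterated sum; in the region used
   below the double series converges absolutely, so the order of summation is
   immaterial. *)
Definition L2_series (a : nat -> C) (s1 s2 : C) : C :=
  CSeries (fun m => CSeries (fun n =>
    (a (S n) / (nat_cpow (S m) s1 * nat_cpow (S m + S n) s2))%C)).

Definition L2_continuation (kappa : nat) (a : nat -> C) (L2 : C2 -> C) : Prop :=
  meromorphic L2 /\
  forall s1 s2 : C,
    Re s2 > (INR kappa + 1) / 2 ->
    Re s1 + Re s2 > (INR kappa + 3) / 2 ->
    L2 (s1, s2) = L2_series a s1 s2.

(* Main.v *)
Require Import Defs.
From Stdlib Require Import Reals ZArith Lra Lia Psatz Classical.
From Coquelicot Require Import Coquelicot.
Open Scope R_scope.

(** The double series continues to an entire function divided by [Gamma(s2)],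
    and [1 / Gamma] vanishes at the non-positive integers.

    For large real parts, the Euler integral for [Gamma(s2) (m + n)^(-s2)] gives
<<
  Gamma(s2) L2(s1, s2)
    = sum_m m^(-s1) int_0^oo t^(s2 - 1) e^(-m t) f(i t / 2 pi) dt.
>>
    The right-hand side converges for all [(s1, s2)]: the expansion of [f] at
    the cusp 0 makes [f(i t / 2 pi)] smaller than every power of [t] as [t] tends
    to 0 ([cusp_form_rapid_decay]), so the [m]-th integral decays faster than
    every power of [m].  It is therefore entire ([mellin_series_holomorphic]).
    The exchange of sum and integral ([mellin_series_eq]) needs a polynomial
    bound for [a(n)]; Hecke's argument provides it from a bound
    [|f(tau)| <= M (Im tau)^(-kappa)], which follows from moving [tau] high up by
    the modular group, only finitely many forms [f|g] being involved.

    Only [Gamma] to the right of 0 is used: by the functional equation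
    ([euler_int_shift]),
<<
  L2(s1, s2) Gamma(s2 + p) = s2 (s2 + 1) ... (s2 + p - 1) E(s1, s2)
>>
    with [E] entire, first in the region of convergence.  The identity extends
    to the half-space [Re s2 > -l - 1] ([meromorphic_identity]), where for large
    [p] the factor [Gamma(s2 + p)] is holomorphic; it is positive at [s2 = -l],
    where the product vanishes.  So near every point of the hyperplane [L2]
    coincides with a holomorphic quotient that is 0 there.

    The integrals are taken over the unit interval in the variable
    [u = e^(-t)]; the integrands tend to 0 at both ends, so that they are
    integrals of continuous functions on a compact segment.

    The identity theorem rests on one consequence of Goursat's theorem: a
    holomorphic function that vanishes on an arc of a circle vanishes at the
    centre ([zero_on_arc]).  The mean value property shows this when the arc is
    the whole circle, and a product of rotated copies reduces an arc to that
    case.  Restricted to complex lines, this propagates zeros inside a box of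
    [C^2]; a connectedness argument along a segment does the rest, the
    denominators of the local quotients being cleared. *)

(** * Complex numbers and the complex exponential *)

Lemma C_ext (z w : C) : Re z = Re w -> Im z = Im w -> z = w.
Proof. destruct z, w; unfold Re, Im; simpl; now intros -> ->. Qed.

Lemma exp_mono (x y : R) : x <= y -> exp x <= exp y.
Proof. intros [H | ->]; [now apply Rlt_le, exp_increasing | apply Rle_refl]. Qed.

Lemma Cexp_plus (z w : C) : Cexp (z + w) = (Cexp z * Cexp w)%C.
Proof.
  unfold Cexp; rewrite re_plus, im_plus, exp_plus, cos_plus, sin_plus.
  apply C_ext; simpl; ring.
Qed.

Lemma Cexp_0 : Cexp 0 = RtoC 1.
Proof. unfold Cexp; simpl; rewrite exp_0, cos_0, sin_0; apply C_ext; simpl; ring. Qed.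

Lemma Cmod_Cexp (z : C) : Cmod (Cexp z) = exp (Re z).
Proof.
  unfold Cmod, Cexp; simpl.
  replace (_ + _) with (Rsqr (exp (Re z)) * (Rsqr (sin (Im z)) + Rsqr (cos (Im z))))
    by (unfold Rsqr; ring).
  rewrite sin2_cos2, Rmult_1_r, sqrt_Rsqr; [easy | apply Rlt_le, exp_pos].
Qed.

Lemma Cexp_neq_0 (z : C) : Cexp z <> RtoC 0.
Proof. intros H; apply (Rlt_irrefl 0); rewrite <- Cmod_0 at 2; rewrite <- H, Cmod_Cexp; apply exp_pos. Qed.

Lemma Cexp_opp (z : C) : Cexp (- z) = (/ Cexp z)%C.
Proof.
  assert (H : (Cexp (- z) * Cexp z)%C = RtoC 1).
  { rewrite <- Cexp_plus, <- Cexp_0; f_equal; ring. }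
  rewrite <- (Cmult_1_l (/ Cexp z)), <- H; field; apply Cexp_neq_0.
Qed.

Lemma Cexp_RtoC (x : R) : Cexp (RtoC x) = RtoC (exp x).
Proof. unfold Cexp; simpl; rewrite cos_0, sin_0; apply C_ext; simpl; ring. Qed.

Lemma im_le_Cmod (z : C) : Rabs (Im z) <= Cmod z.
Proof. apply Rle_trans with (2 := Rmax_Cmod z), Rmax_r. Qed.

Lemma Cmod_le_Re_Im (z : C) : Cmod z <= Rabs (Re z) + Rabs (Im z).
Proof.
  assert (H := Rabs_pos (Re z)); assert (H' := Rabs_pos (Im z)).
  unfold Cmod; apply Rsqr_incr_0_var; [|lra].
  rewrite Rsqr_sqrt by nra; fold (Re z) (Im z).
  rewrite <- (pow2_abs (Re z)), <- (pow2_abs (Im z)); unfold Rsqr; nra.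
Qed.

Lemma Re_near (z w : C) (r : R) : Cmod (z - w) < r -> Re w - r < Re z < Re w + r.
Proof.
  intros H. assert (T := Rle_lt_trans _ _ _ (re_le_Cmod (z - w)) H). apply Rabs_def2 in T.
  change (Re (z - w)) with (Re z - Re w) in T. lra.
Qed.

Lemma Cmod_minus_sym (z w : C) : Cmod (z - w) = Cmod (w - z).
Proof. rewrite <- Cmod_opp; f_equal; ring. Qed.

Lemma Cmod_triangle_minus (z w : C) : Cmod (z - w) <= Cmod z + Cmod w.
Proof. unfold Cminus; rewrite <- (Cmod_opp w); apply Cmod_triangle. Qed.

(** Differentiability of a complex valued function of a real variable, read
    on the components so that the real theory applies. *)
Definition cis_derive (f : R -> C) (x : R) (l : C) : Prop :=
  is_derive (fun y => Re (f y)) x (Re l) /\ is_derive (fun y => Im (f y)) x (Im l).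

Lemma cis_derive_ext (f g : R -> C) x l :
  (forall y, f y = g y) -> cis_derive f x l -> cis_derive g x l.
Proof.
  intros H [H1 H2]; split.
  - apply (is_derive_ext (fun y => Re (f y))); [intros t; now rewrite H | easy].
  - apply (is_derive_ext (fun y => Im (f y))); [intros t; now rewrite H | easy].
Qed.

Lemma cis_derive_val (f : R -> C) x l m : cis_derive f x l -> l = m -> cis_derive f x m.
Proof. now intros H <-. Qed.

Lemma cis_derive_const (c : C) x : cis_derive (fun _ => c) x (RtoC 0).
Proof. split; apply (is_derive_const (K := R_AbsRing) (V := R_NormedModule)). Qed.

Lemma cis_derive_plus (f g : R -> C) x l m :
  cis_derive f x l -> cis_derive g x m -> cis_derive (fun y => f y + g y)%C x (l + m)%C.
Proof.
  intros [H1 H2] [H3 H4]; split.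
  - exact (is_derive_plus _ _ _ _ _ H1 H3).
  - exact (is_derive_plus _ _ _ _ _ H2 H4).
Qed.

Lemma cis_derive_minus (f g : R -> C) x l m :
  cis_derive f x l -> cis_derive g x m -> cis_derive (fun y => f y - g y)%C x (l - m)%C.
Proof.
  intros [H1 H2] [H3 H4]; split.
  - exact (is_derive_minus _ _ _ _ _ H1 H3).
  - exact (is_derive_minus _ _ _ _ _ H2 H4).
Qed.

Lemma cis_derive_mult (f g : R -> C) x l m :
  cis_derive f x l -> cis_derive g x m ->
  cis_derive (fun y => f y * g y)%C x (l * g x + f x * m)%C.
Proof.
  intros [H1 H2] [H3 H4]; split.
  - replace (Re _) with (((Re l * Re (g x) + Re (f x) * Re m)) - (Im l * Im (g x) + Im (f x) * Im m))
      by (simpl; unfold Re, Im; ring).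
    apply (is_derive_minus (fun y => Re (f y) * Re (g y)) (fun y => Im (f y) * Im (g y))).
    + apply (is_derive_mult (K := R_AbsRing)); try easy. intros; apply Rmult_comm.
    + apply (is_derive_mult (K := R_AbsRing)); try easy. intros; apply Rmult_comm.
  - replace (Im _) with (((Re l * Im (g x) + Re (f x) * Im m)) + (Im l * Re (g x) + Im (f x) * Re m))
      by (simpl; unfold Re, Im; ring).
    apply (is_derive_plus (fun y => Re (f y) * Im (g y)) (fun y => Im (f y) * Re (g y))).
    + apply (is_derive_mult (K := R_AbsRing)); try easy. intros; apply Rmult_comm.
    + apply (is_derive_mult (K := R_AbsRing)); try easy. intros; apply Rmult_comm.
Qed.

Lemma cis_derive_RtoC (g : R -> R) x l :
  is_derive g x l -> cis_derive (fun y => RtoC (g y)) x (RtoC l).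
Proof. intros H; split; [exact H | exact (is_derive_const (K := R_AbsRing) (V := R_NormedModule) 0 x)]. Qed.

Lemma cis_derive_lin (d : C) x : cis_derive (fun y => RtoC y * d)%C x d.
Proof.
  split.
  - apply is_derive_ext with (fun y => y * Re d); [intros t; now rewrite re_scal_l|].
    auto_derive; [easy | ring].
  - apply is_derive_ext with (fun y => y * Im d); [intros t; now rewrite im_scal_l|].
    auto_derive; [easy | ring].
Qed.

Lemma cis_derive_Cexp (f : R -> C) x l :
  cis_derive f x l -> cis_derive (fun y => Cexp (f y)) x (l * Cexp (f x))%C.
Proof.
  intros [H1 H2]; split; unfold Cexp; simpl.
  - eapply is_derive_ext; [intros t; reflexivity|].
    assert (D1 := is_derive_comp exp _ x _ _ (is_derive_exp (Re (f x))) H1).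
    assert (D2 := is_derive_comp cos _ x _ _ (is_derive_cos (Im (f x))) H2).
    assert (D := is_derive_mult _ _ _ _ _ D1 D2 Rmult_comm).
    eapply is_derive_ext in D.
    2: intros t; reflexivity.
    evar_last; [exact D |]. unfold plus, mult, scal; simpl; unfold mult, Re, Im; simpl; ring.
  - assert (D1 := is_derive_comp exp _ x _ _ (is_derive_exp (Re (f x))) H1).
    assert (D2 := is_derive_comp sin _ x _ _ (is_derive_sin (Im (f x))) H2).
    assert (D := is_derive_mult _ _ _ _ _ D1 D2 Rmult_comm).
    evar_last; [exact D |]. unfold plus, mult, scal; simpl; unfold mult, Re, Im; simpl; ring.
Qed.

(** The mean value inequality reduces to the real mean value theorem for the
    component of [f] in the direction of the increment. *)
Lemma mean_value_ineq (f df : R -> C) (M : R) :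
  (forall x, 0 <= x <= 1 -> cis_derive f x (df x)) ->
  (forall x, 0 <= x <= 1 -> Cmod (df x) <= M) ->
  Cmod (f 1 - f 0) <= M.
Proof.
  intros Hd HM.
  set (w := (f 1 - f 0)%C).
  set (g := fun x => Re w * Re (f x) + Im w * Im (f x)).
  assert (Hg : forall x, 0 <= x <= 1 ->
     is_derive g x (Re w * Re (df x) + Im w * Im (df x))).
  { intros x Hx; destruct (Hd x Hx) as [H1 H2].
    apply (is_derive_plus (fun x => Re w * Re (f x)) (fun x => Im w * Im (f x)));
      now apply is_derive_scal. }
  destruct (MVT_gen g 0 1 (fun x => Re w * Re (df x) + Im w * Im (df x))) as [c [Hc E]].
  - rewrite Rmin_left, Rmax_right by lra; intros x Hx; apply Hg; lra.
  - rewrite Rmin_left, Rmax_right by lra; intros x Hx.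
    apply continuity_pt_filterlim, (ex_derive_continuous g). eexists; now apply Hg.
  - rewrite Rmin_left, Rmax_right in Hc by lra.
    assert (Hw : Cmod w ^ 2 = Re w * Re (df c) + Im w * Im (df c)).
    { rewrite Cmod2_alt. replace (Re w * Re (df c) + Im w * Im (df c)) with (g 1 - g 0) by (rewrite E; ring).
      unfold g, w; simpl; unfold Re, Im; ring. }
    assert (Hle : Re w * Re (df c) + Im w * Im (df c) <= Cmod w * Cmod (df c)).
    { replace (Re w * Re (df c) + Im w * Im (df c)) with (Re (w * Cconj (df c)))
        by (simpl; unfold Re, Im; ring).
      rewrite <- (Cmod_conj (df c)), <- Cmod_mult.
      eapply Rle_trans; [apply Rle_abs | apply re_le_Cmod]. }
    specialize (HM c Hc).
    destruct (Req_dec (Cmod w) 0) as [->|H0].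
    + eapply Rle_trans; [apply Cmod_ge_0 | exact HM].
    + assert (Hp := Cmod_ge_0 w). nra.
Qed.

(** The mean value inequality along the segment from 0 to [d]. *)
Lemma Cexp_minus_1_le (d : C) : Cmod (Cexp d - 1) <= Cmod d * exp (Cmod d).
Proof.
  replace (Cexp d - 1)%C with (Cexp (RtoC 1 * d) - Cexp (RtoC 0 * d))%C
    by (rewrite Cmult_1_l, Cmult_0_l, Cexp_0; easy).
  apply (mean_value_ineq (fun x => Cexp (RtoC x * d)) (fun x => d * Cexp (RtoC x * d))%C).
  - intros x Hx. apply (cis_derive_Cexp (fun x => (RtoC x * d)%C)).
    apply cis_derive_lin.
  - intros x Hx. rewrite Cmod_mult, Cmod_Cexp.
    apply Rmult_le_compat_l; [apply Cmod_ge_0|]. apply exp_mono.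
    rewrite re_scal_l. assert (H := re_le_Cmod d). assert (H' := Rle_abs (Re d)).
    assert (H2 := Cmod_ge_0 d). nra.
Qed.

Lemma Cexp_taylor_le (d : C) : Cmod (Cexp d - 1 - d) <= Cmod d ^ 2 * exp (Cmod d).
Proof.
  replace (Cexp d - 1 - d)%C with
    ((Cexp (RtoC 1 * d) - RtoC 1 * d) - (Cexp (RtoC 0 * d) - RtoC 0 * d))%C
    by (rewrite Cmult_1_l, Cmult_0_l, Cexp_0; ring).
  apply (mean_value_ineq (fun x => Cexp (RtoC x * d) - RtoC x * d)%C (fun x => d * Cexp (RtoC x * d) - d)%C).
  - intros x Hx.
    assert (H := cis_derive_lin d x).
    apply cis_derive_minus; [apply (cis_derive_Cexp (fun x => (RtoC x * d)%C))|]; exact H.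
  - intros x Hx. replace (d * Cexp (RtoC x * d) - d)%C with (d * (Cexp (RtoC x * d) - 1))%C by ring.
    rewrite Cmod_mult. simpl. rewrite Rmult_1_r, Rmult_assoc.
    apply Rmult_le_compat_l; [apply Cmod_ge_0|].
    eapply Rle_trans; [apply Cexp_minus_1_le|].
    rewrite Cmod_mult, Cmod_R, Rabs_pos_eq by lra.
    assert (H2 := Cmod_ge_0 d).
    assert (exp (x * Cmod d) <= exp (Cmod d)) by (apply exp_mono; nra).
    assert (0 < exp (x * Cmod d)) by apply exp_pos.
    apply Rmult_le_compat; nra.
Qed.

(** * Continuity and complex differentiability with explicit bounds *)

Lemma ball_C_Cmod (x y : C) (e : R) : Cmod (y - x) < e -> ball x e y.
Proof. intros H; apply C_NormedModule_mixin_compat1; exact H. Qed.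

Lemma Cmod_ball_C (x y : C) (e : posreal) : ball x e y -> Cmod (y - x) < 2 * e.
Proof.
  intros H; apply (C_NormedModule_mixin_compat2 x y e) in H.
  eapply Rlt_le_trans; [exact H|].
  apply Rmult_le_compat_r; [apply Rlt_le, cond_pos|].
  apply Rsqr_incr_0_var; [|lra]. rewrite Rsqr_sqrt by lra; unfold Rsqr; lra.
Qed.

Lemma continuous_eps (f : R -> C) (x : R) :
  continuous f x <->
  forall e, 0 < e -> exists d, 0 < d /\ forall y, Rabs (y - x) < d -> Cmod (f y - f x) < e.
Proof.
  split.
  - intros H e He.
    assert (He2 : 0 < e / 2) by lra.
    destruct (H (fun z => ball (f x) (mkposreal _ He2) z)) as [d Hd].
    { now exists (mkposreal _ He2). }
    exists d; split; [apply cond_pos|]. intros y Hy.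
    specialize (Hd y Hy). apply (Cmod_ball_C (f x) (f y) (mkposreal _ He2)) in Hd; simpl in Hd; lra.
  - intros H P [e HP].
    destruct (H e (cond_pos e)) as [d [Hd H1]].
    exists (mkposreal d Hd). intros y Hy. apply HP, ball_C_Cmod, H1, Hy.
Qed.

Lemma locally_C2 (p : C2) (P : C2 -> Prop) :
  locally p P <->
  exists d, 0 < d /\ forall q : C2, Cmod (fst q - fst p) < d -> Cmod (snd q - snd p) < d -> P q.
Proof.
  split.
  - intros [d Hd]; exists d; split; [apply cond_pos|].
    intros q H1 H2; apply Hd; split; apply ball_C_Cmod; assumption.
  - intros [d [Hd H]]. assert (Hd2 : 0 < d / 2) by lra.
    exists (mkposreal _ Hd2). intros q [H1 H2].
    apply (Cmod_ball_C _ _ (mkposreal _ Hd2)) in H1.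
    apply (Cmod_ball_C _ _ (mkposreal _ Hd2)) in H2. simpl in *.
    apply H; lra.
Qed.

(** Complex differentiability with an explicit gradient [(A, B)]; increments are
    measured by the sum of the moduli, which is equivalent to the product norm
    and keeps square roots out of the estimates. *)
Definition cdiff2 (F : C2 -> C) (p : C2) : Prop :=
  exists A B : C, forall e, 0 < e -> exists d, 0 < d /\ forall h1 h2 : C,
    Cmod h1 < d -> Cmod h2 < d ->
    Cmod (F ((fst p + h1)%C, (snd p + h2)%C) - F p - (A * h1 + B * h2))
      <= e * (Cmod h1 + Cmod h2).

Lemma sum_le_prod_norm (x y : R) : 0 <= x -> 0 <= y ->
  sqrt (x ^ 2 + y ^ 2) <= x + y /\ x + y <= 2 * sqrt (x ^ 2 + y ^ 2).
Proof.
  intros Hx Hy; split.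
  - apply Rsqr_incr_0_var; [|lra]. rewrite Rsqr_sqrt by nra; unfold Rsqr; nra.
  - assert (H := sqrt_pos (x ^ 2 + y ^ 2)).
    apply Rsqr_incr_0_var; [|lra]. rewrite Rsqr_mult, Rsqr_sqrt by nra; unfold Rsqr; nra.
Qed.

Lemma ex_filterdiff_C2 (F : C2 -> C) (p : C2) :
  ex_filterdiff F (locally p) <-> cdiff2 F p.
Proof.
  destruct p as [p1 p2].
  split.
  - intros [l [Hl H]].
    exists (l (RtoC 1, RtoC 0)), (l (RtoC 0, RtoC 1)). intros e He.
    specialize (H (p1, p2) (fun P HP => HP) (mkposreal e He)).
    apply locally_C2 in H. destruct H as [d [Hd H]].
    exists d; split; [exact Hd|]. intros h1 h2 H1 H2.
    specialize (H ((p1 + h1)%C, (p2 + h2)%C)). simpl in H.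
    replace (p1 + h1 - p1)%C with h1 in H by ring.
    replace (p2 + h2 - p2)%C with h2 in H by ring.
    specialize (H H1 H2).
    assert (E : minus (((p1 + h1)%C, (p2 + h2)%C) : C2) (p1, p2) = (h1, h2)).
    { apply injective_projections; simpl; unfold plus, opp; simpl; ring. }
    assert (H3 : Cmod (F ((p1 + h1)%C, (p2 + h2)%C) - F (p1, p2) - l (h1, h2))
       <= e * sqrt (Cmod h1 ^ 2 + Cmod h2 ^ 2)).
    { replace (sqrt (Cmod h1 ^ 2 + Cmod h2 ^ 2)) with (norm (minus (((p1 + h1)%C, (p2 + h2)%C) : C2) (p1, p2)))
        by (rewrite E; reflexivity).
      rewrite <- E; exact H. }
    assert (E2 : l (h1, h2) = (l (RtoC 1, RtoC 0) * h1 + l (RtoC 0, RtoC 1) * h2)%C).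
    { transitivity (l (plus (scal h1 ((RtoC 1, RtoC 0) : C2)) (scal h2 ((RtoC 0, RtoC 1) : C2)))).
      - f_equal. apply injective_projections; simpl; unfold plus, scal; simpl; unfold mult; simpl; ring.
      - rewrite (linear_plus _ Hl), !(linear_scal _ Hl).
        unfold plus, scal; simpl; unfold mult; simpl; ring. }
    rewrite E2 in H3.
    eapply Rle_trans; [exact H3|]. apply Rmult_le_compat_l; [lra|].
    destruct (sum_le_prod_norm (Cmod h1) (Cmod h2)) as [H4 _]; try apply Cmod_ge_0. exact H4.
  - intros [A [B H]].
    exists (fun h : C2 => (A * fst h + B * snd h)%C). split.
    + apply Build_is_linear.
      * intros [x1 x2] [y1 y2].
        assert (X : forall a b c d : C, (A * (a + b) + B * (c + d))%C = ((A * a + B * c) + (A * b + B * d))%C)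
          by (intros; ring). apply X.
      * intros k [x1 x2].
        assert (X : forall c a b : C, (A * (c * a) + B * (c * b))%C = (c * (A * a + B * b))%C)
          by (intros; ring). apply X.
      * exists (Cmod A + Cmod B + 1). assert (HA := Cmod_ge_0 A). assert (HB := Cmod_ge_0 B).
        split; [lra|]. intros x.
        assert (HX := Cmod_ge_0 (fst x)). assert (HY := Cmod_ge_0 (snd x)).
        apply Rle_trans with (Cmod A * Cmod (fst x) + Cmod B * Cmod (snd x)).
        { rewrite <- !Cmod_mult. apply Cmod_triangle. }
        change (norm x) with (sqrt (Cmod (fst x) ^ 2 + Cmod (snd x) ^ 2)).
        assert (H1 : Cmod (fst x) <= sqrt (Cmod (fst x) ^ 2 + Cmod (snd x) ^ 2)).
        { apply Rsqr_incr_0_var; [|apply sqrt_pos]. rewrite Rsqr_sqrt by nra; unfold Rsqr; nra. }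
        assert (H2 : Cmod (snd x) <= sqrt (Cmod (fst x) ^ 2 + Cmod (snd x) ^ 2)).
        { apply Rsqr_incr_0_var; [|apply sqrt_pos]. rewrite Rsqr_sqrt by nra; unfold Rsqr; nra. }
        nra.
    + intros x Hx. apply is_filter_lim_locally_unique in Hx. subst x. simpl in H.
      intros e. assert (He2 : 0 < e / 2) by (assert (H0 := cond_pos e); lra).
      destruct (H _ He2) as [d [Hd H1]].
      apply locally_C2. exists d; split; [exact Hd|]. intros [q1 q2] Hq1 Hq2. simpl in Hq1, Hq2.
      assert (X : forall a b : C, (a + (b - a))%C = b) by (intros; ring).
      specialize (H1 _ _ Hq1 Hq2). rewrite (X p1 q1), (X p2 q2) in H1.
      eapply Rle_trans; [exact H1|].
      change (norm (minus _ (p1, p2))) with (sqrt (Cmod (q1 - p1) ^ 2 + Cmod (q2 - p2) ^ 2)).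
      destruct (sum_le_prod_norm (Cmod (q1 - p1)) (Cmod (q2 - p2))) as [_ H3]; try apply Cmod_ge_0.
      eapply Rle_trans; [apply Rmult_le_compat_l; [lra | exact H3]|]. right; simpl; field.
Qed.

Definition cdiff (f : C -> C) (z : C) : Prop :=
  exists A : C, forall e, 0 < e -> exists d, 0 < d /\ forall h,
    Cmod h < d -> Cmod (f (z + h)%C - f z - A * h) <= e * Cmod h.

Lemma cdiff_cont (f : C -> C) (z : C) :
  cdiff f z -> forall e, 0 < e -> exists d, 0 < d /\ forall w, Cmod (w - z) < d -> Cmod (f w - f z) < e.
Proof.
  intros [A H] e He. destruct (H 1 Rlt_0_1) as [d [Hd H1]].
  assert (HA := Cmod_ge_0 A).
  assert (H2 : 0 < e / (Cmod A + 2)) by (apply Rdiv_lt_0_compat; lra).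
  exists (Rmin d (e / (Cmod A + 2))). split; [now apply Rmin_glb_lt|].
  intros w Hw.
  assert (Hw1 := Rlt_le_trans _ _ _ Hw (Rmin_l _ _)).
  assert (Hw2 := Rlt_le_trans _ _ _ Hw (Rmin_r _ _)).
  specialize (H1 _ Hw1). replace (z + (w - z))%C with w in H1 by ring.
  replace (f w - f z)%C with ((f w - f z - A * (w - z)) + A * (w - z))%C by ring.
  eapply Rle_lt_trans; [apply Cmod_triangle|]. rewrite Cmod_mult.
  apply (Rmult_lt_compat_l (Cmod A + 2)) in Hw2; [|lra].
  replace ((Cmod A + 2) * (e / (Cmod A + 2))) with e in Hw2 by (field; lra).
  assert (Hp := Cmod_ge_0 (w - z)). nra.
Qed.

Lemma cdiff2_cont (F : C2 -> C) (p : C2) :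
  cdiff2 F p -> forall e, 0 < e -> exists d, 0 < d /\ forall h1 h2,
    Cmod h1 < d -> Cmod h2 < d -> Cmod (F ((fst p + h1)%C, (snd p + h2)%C) - F p) < e.
Proof.
  intros [A [B H]] e He. destruct (H 1 Rlt_0_1) as [d [Hd H1]].
  assert (HA := Cmod_ge_0 A). assert (HB := Cmod_ge_0 B).
  set (M := Cmod A + Cmod B + 2). assert (HM : 0 < M) by (unfold M; lra).
  assert (H2 : 0 < e / (2 * M)) by (apply Rdiv_lt_0_compat; lra).
  exists (Rmin d (e / (2 * M))). split; [now apply Rmin_glb_lt|].
  intros h1 h2 Hh1 Hh2.
  assert (Q1 := Rlt_le_trans _ _ _ Hh1 (Rmin_r _ _)). assert (Q2 := Rlt_le_trans _ _ _ Hh2 (Rmin_r _ _)).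
  specialize (H1 h1 h2 (Rlt_le_trans _ _ _ Hh1 (Rmin_l _ _)) (Rlt_le_trans _ _ _ Hh2 (Rmin_l _ _))).
  set (u := F ((fst p + h1)%C, (snd p + h2)%C)) in *.
  replace (u - F p)%C with ((u - F p - (A * h1 + B * h2)) + (A * h1 + B * h2))%C by ring.
  eapply Rle_lt_trans; [apply Cmod_triangle|].
  assert (T := Cmod_triangle (A * h1) (B * h2)). rewrite !Cmod_mult in T.
  assert (P1 := Cmod_ge_0 h1). assert (P2 := Cmod_ge_0 h2).
  assert (Q : 2 * M * (e / (2 * M)) = e) by (field; lra).
  assert (M * Cmod h1 < M * (e / (2 * M))) by (apply Rmult_lt_compat_l; lra).
  assert (M * Cmod h2 < M * (e / (2 * M))) by (apply Rmult_lt_compat_l; lra).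
  unfold M in *. nra.
Qed.

(** Products: both factors are replaced by their linear approximations, and
    the two mixed terms are of second order. *)
Lemma cdiff2_mult (F G : C2 -> C) (p : C2) :
  cdiff2 F p -> cdiff2 G p -> cdiff2 (fun q => F q * G q)%C p.
Proof.
  intros Hf Hg. assert (Cg := cdiff2_cont _ _ Hg).
  destruct Hf as [A1 [A2 HA]], Hg as [B1 [B2 HB]].
  exists (A1 * G p + F p * B1)%C, (A2 * G p + F p * B2)%C. intros e He.
  set (M := Cmod A1 + Cmod A2).
  set (K := M + Cmod (F p) + Cmod (G p) + 2).
  assert (HA1 := Cmod_ge_0 A1). assert (HA2 := Cmod_ge_0 A2).
  assert (Hfp := Cmod_ge_0 (F p)). assert (Hgp := Cmod_ge_0 (G p)).
  assert (HK : 0 < K) by (unfold K, M; lra).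
  set (e' := Rmin 1 (e / K)).
  assert (He' : 0 < e') by (apply Rmin_glb_lt; [lra | now apply Rdiv_lt_0_compat]).
  assert (He'1 : e' <= 1) by apply Rmin_l.
  assert (HeK : e' * K <= e).
  { assert (H := Rmin_r 1 (e / K)). fold e' in H. apply (Rmult_le_compat_r K) in H; [|lra].
    replace (e / K * K) with e in H by (field; lra). exact H. }
  destruct (HA _ He') as [d1 [Hd1 H1]]. destruct (HB _ He') as [d2 [Hd2 H2]].
  destruct (Cg _ He') as [d3 [Hd3 H3]].
  exists (Rmin d1 (Rmin d2 d3)). split; [repeat apply Rmin_glb_lt; assumption|].
  intros h1 h2 Hh1 Hh2.
  assert (R1 := Rmin_l d1 (Rmin d2 d3)). assert (R2 := Rmin_r d1 (Rmin d2 d3)).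
  assert (R3 := Rmin_l d2 d3). assert (R4 := Rmin_r d2 d3).
  specialize (H1 h1 h2 ltac:(lra) ltac:(lra)). specialize (H2 h1 h2 ltac:(lra) ltac:(lra)).
  specialize (H3 h1 h2 ltac:(lra) ltac:(lra)).
  set (q := ((fst p + h1)%C, (snd p + h2)%C) : C2) in *.
  set (s := Cmod h1 + Cmod h2) in *.
  assert (P1 := Cmod_ge_0 h1). assert (P2 := Cmod_ge_0 h2). assert (Hs : 0 <= s) by (unfold s; lra).
  set (l := (A1 * h1 + A2 * h2)%C) in *.
  assert (Hl : Cmod l <= M * s).
  { unfold l. eapply Rle_trans; [apply Cmod_triangle|]. rewrite !Cmod_mult. unfold M, s. nra. }
  replace (F q * G q - F p * G p - ((A1 * G p + F p * B1) * h1 + (A2 * G p + F p * B2) * h2))%C with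
    ((F q - F p - l) * G p + (F q - F p - l) * (G q - G p)
     + l * (G q - G p)
     + F p * (G q - G p - (B1 * h1 + B2 * h2)))%C by (unfold l; ring).
  set (u := (F q - F p - l)%C) in *. set (v := (G q - G p)%C) in *.
  set (r := (v - (B1 * h1 + B2 * h2))%C) in *.
  eapply Rle_trans; [apply Cmod_triangle|].
  eapply Rle_trans; [apply Rplus_le_compat_r, Cmod_triangle|].
  eapply Rle_trans; [apply Rplus_le_compat_r, Rplus_le_compat_r, Cmod_triangle|].
  rewrite !Cmod_mult.
  assert (Hu := Cmod_ge_0 u). assert (Hv := Cmod_ge_0 v). assert (Hr := Cmod_ge_0 r). assert (Hl0 := Cmod_ge_0 l).
  assert (Q1 : Cmod u * Cmod (G p) <= e' * s * Cmod (G p)) by (apply Rmult_le_compat_r; lra).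
  assert (Q2 : Cmod u * Cmod v <= e' * s * 1) by (apply Rmult_le_compat; lra).
  assert (Q3 : Cmod l * Cmod v <= M * s * e') by (apply Rmult_le_compat; lra).
  assert (Q4 : Cmod (F p) * Cmod r <= Cmod (F p) * (e' * s)) by (apply Rmult_le_compat_l; lra).
  apply Rle_trans with (e' * (K - 1) * s); [unfold K; lra|].
  apply Rmult_le_compat_r; nra.
Qed.

Lemma cdiff2_plus (F G : C2 -> C) (p : C2) :
  cdiff2 F p -> cdiff2 G p -> cdiff2 (fun q => F q + G q)%C p.
Proof.
  intros [A1 [A2 HA]] [B1 [B2 HB]]. exists (A1 + B1)%C, (A2 + B2)%C. intros e He.
  destruct (HA (e / 2) ltac:(lra)) as [d1 [Hd1 H1]]. destruct (HB (e / 2) ltac:(lra)) as [d2 [Hd2 H2]].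
  exists (Rmin d1 d2). split; [now apply Rmin_glb_lt|]. intros h1 h2 Hh1 Hh2.
  assert (R1 := Rmin_l d1 d2). assert (R2 := Rmin_r d1 d2).
  specialize (H1 h1 h2 ltac:(lra) ltac:(lra)). specialize (H2 h1 h2 ltac:(lra) ltac:(lra)).
  set (q := ((fst p + h1)%C, (snd p + h2)%C) : C2) in *.
  replace (F q + G q - (F p + G p) - ((A1 + B1) * h1 + (A2 + B2) * h2))%C with
   ((F q - F p - (A1 * h1 + A2 * h2)) + (G q - G p - (B1 * h1 + B2 * h2)))%C by ring.
  eapply Rle_trans; [apply Cmod_triangle|]. lra.
Qed.

Lemma cdiff2_affine (A B c : C) (p : C2) : cdiff2 (fun q => A * fst q + B * snd q + c)%C p.
Proof.
  exists A, B. intros e He. exists 1; split; [lra|]. intros h1 h2 _ _. simpl.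
  replace (_ - _)%C with (RtoC 0) by ring. rewrite Cmod_0.
  assert (P1 := Cmod_ge_0 h1). assert (P2 := Cmod_ge_0 h2). nra.
Qed.

Lemma cdiff2_ext (F G : C2 -> C) (p : C2) : (forall q, F q = G q) -> cdiff2 F p -> cdiff2 G p.
Proof.
  intros E [A [B H]]. exists A, B. intros e He. destruct (H e He) as [d [Hd H1]].
  exists d; split; [exact Hd|]. intros h1 h2 Hh1 Hh2. rewrite <- !E. now apply H1.
Qed.

Lemma cdiff2_const (c : C) (p : C2) : cdiff2 (fun _ => c) p.
Proof. apply cdiff2_ext with (2 := cdiff2_affine 0 0 c p). intros q; ring. Qed.

Lemma cdiff2_minus (F G : C2 -> C) (p : C2) :
  cdiff2 F p -> cdiff2 G p -> cdiff2 (fun q => F q - G q)%C p.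
Proof.
  intros HF HG. apply cdiff2_ext with (fun q => F q + RtoC (-1) * G q)%C.
  - intros q. replace (RtoC (-1)) with (- RtoC 1)%C by (apply C_ext; simpl; ring). ring.
  - apply cdiff2_plus; [exact HF|]. apply cdiff2_mult; [apply cdiff2_const | exact HG].
Qed.

(** [1/k - 1/h + l/h^2 = (l (k - h) - (k - h - l) h) / (h^2 k)], where [l] is
    the linear part of the increment from [h] to [k]. *)
Lemma cdiff2_inv (F : C2 -> C) (p : C2) :
  cdiff2 F p -> F p <> RtoC 0 -> cdiff2 (fun q => / F q)%C p.
Proof.
  intros Hf Hn. assert (Cf := cdiff2_cont _ _ Hf). destruct Hf as [A [B HA]].
  set (a := Cmod (F p)). assert (Ha : 0 < a) by now apply Cmod_gt_0.
  exists (- (A / (F p * F p)))%C, (- (B / (F p * F p)))%C. intros e He.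
  set (M := Cmod A + Cmod B + a + 1).
  assert (HA1 := Cmod_ge_0 A). assert (HA2 := Cmod_ge_0 B). assert (HM : 0 < M) by (unfold M; lra).
  assert (Ha3 : 0 < a ^ 3) by (apply pow_lt; lra).
  set (e' := e * a ^ 3 / (2 * M)).
  assert (He' : 0 < e') by (apply Rdiv_lt_0_compat; [|lra]; now apply Rmult_lt_0_compat).
  destruct (HA e' He') as [d1 [Hd1 H1]].
  destruct (Cf (Rmin (a / 2) e')) as [d2 [Hd2 H2]]; [apply Rmin_glb_lt; lra|].
  exists (Rmin d1 d2). split; [now apply Rmin_glb_lt|]. intros h1 h2 Hh1 Hh2.
  assert (R1 := Rmin_l d1 d2). assert (R2 := Rmin_r d1 d2).
  specialize (H1 h1 h2 ltac:(lra) ltac:(lra)). specialize (H2 h1 h2 ltac:(lra) ltac:(lra)).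
  assert (R3 := Rmin_l (a / 2) e'). assert (R4 := Rmin_r (a / 2) e').
  set (q := ((fst p + h1)%C, (snd p + h2)%C) : C2) in *.
  set (s := Cmod h1 + Cmod h2) in *.
  assert (P1 := Cmod_ge_0 h1). assert (P2 := Cmod_ge_0 h2). assert (Hs : 0 <= s) by (unfold s; lra).
  set (l := (A * h1 + B * h2)%C) in *.
  assert (Hl : Cmod l <= (Cmod A + Cmod B) * s).
  { unfold l. eapply Rle_trans; [apply Cmod_triangle|]. rewrite !Cmod_mult. unfold s. nra. }
  assert (Hk : a / 2 <= Cmod (F q)).
  { assert (T := Cmod_triangle_minus (F q) (F q - F p)). replace (F q - (F q - F p))%C with (F p) in T by ring.
    fold a in T. lra. }
  assert (Hkn : F q <> RtoC 0) by (apply Cmod_gt_0; lra).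
  replace (/ F q - / F p - (- (A / (F p * F p)) * h1 + - (B / (F p * F p)) * h2))%C with
    ((l * (F q - F p) - (F q - F p - l) * F p) / (F p * F p * F q))%C
    by (unfold l; field; split; assumption).
  rewrite Cmod_div by (repeat apply Cmult_neq_0; assumption).
  rewrite !Cmod_mult. fold a.
  assert (Num : Cmod (l * (F q - F p) - (F q - F p - l) * F p) <= e' * M * s).
  { eapply Rle_trans; [apply Cmod_triangle_minus|]. rewrite !Cmod_mult. fold a.
    assert (Q0 := Cmod_ge_0 l). assert (Q0' := Cmod_ge_0 (F q - F p)).
    assert (Q3 : Cmod l * Cmod (F q - F p) <= (Cmod A + Cmod B) * s * e') by (apply Rmult_le_compat; lra).
    assert (Q4 : Cmod (F q - F p - l) * a <= e' * s * a) by (apply Rmult_le_compat_r; lra).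
    assert (0 <= e' * s) by (apply Rmult_le_pos; lra).
    unfold M. nra. }
  apply Rmult_le_reg_r with (a * a * Cmod (F q)); [apply Rmult_lt_0_compat; nra|].
  unfold Rdiv. rewrite Rmult_assoc, Rinv_l, Rmult_1_r by (apply Rgt_not_eq, Rmult_lt_0_compat; nra).
  eapply Rle_trans; [exact Num|].
  apply Rle_trans with (e * s * (a * a * (a / 2))).
  - unfold e'. right; field; lra.
  - apply Rmult_le_compat_l; [apply Rmult_le_pos; lra|]. apply Rmult_le_compat_l; nra.
Qed.

Lemma cdiff2_eq_near (F G : C2 -> C) (p : C2) :
  locally p (fun q => F q = G q) -> cdiff2 F p -> cdiff2 G p.
Proof.
  intros Hl [A [B H]]. apply locally_C2 in Hl. destruct Hl as [d0 [Hd0 Hl]].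
  exists A, B. intros e He. destruct (H e He) as [d [Hd H1]].
  exists (Rmin d d0); split; [now apply Rmin_glb_lt|]. intros h1 h2 Hh1 Hh2.
  assert (R1 := Rmin_l d d0). assert (R2 := Rmin_r d d0).
  assert (X : forall a b : C, (a + b - a)%C = b) by (intros; ring).
  rewrite <- (Hl ((fst p + h1)%C, (snd p + h2)%C)), <- (Hl p).
  - apply H1; lra.
  - refine (Rle_lt_trans _ 0 _ (Req_le _ _ _) Hd0). rewrite <- Cmod_0. f_equal. apply Cplus_opp_r.
  - refine (Rle_lt_trans _ 0 _ (Req_le _ _ _) Hd0). rewrite <- Cmod_0. f_equal. apply Cplus_opp_r.
  - refine (Rle_lt_trans _ (Cmod h1) _ (Req_le _ _ _) _); [|lra]. f_equal. apply X.
  - refine (Rle_lt_trans _ (Cmod h2) _ (Req_le _ _ _) _); [|lra]. f_equal. apply X.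
Qed.

Lemma cdiff2_line (F : C2 -> C) (p v1 v2 z : C) (p' : C) :
  cdiff2 F ((p + z * v1)%C, (p' + z * v2)%C) ->
  cdiff (fun w => F ((p + w * v1)%C, (p' + w * v2)%C)) z.
Proof.
  intros [A [B H]]. exists (A * v1 + B * v2)%C. intros e He.
  assert (Hv1 := Cmod_ge_0 v1). assert (Hv2 := Cmod_ge_0 v2).
  set (K := Cmod v1 + Cmod v2 + 1). assert (HK : 0 < K) by (unfold K; lra).
  destruct (H (e / K)) as [d [Hd H1]]; [now apply Rdiv_lt_0_compat|].
  exists (d / K). split; [now apply Rdiv_lt_0_compat|].
  intros h Hh. assert (Hp := Cmod_ge_0 h).
  apply (Rmult_lt_compat_r K) in Hh; [|lra].
  replace (d / K * K) with d in Hh by (field; lra).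
  specialize (H1 (h * v1)%C (h * v2)%C). simpl in H1.
  rewrite !Cmod_mult in H1.
  replace ((p + (z + h) * v1)%C) with ((p + z * v1 + h * v1)%C) by ring.
  replace ((p' + (z + h) * v2)%C) with ((p' + z * v2 + h * v2)%C) by ring.
  replace ((A * v1 + B * v2) * h)%C with (A * (h * v1) + B * (h * v2))%C by ring.
  eapply Rle_trans; [apply H1; unfold K in *; nra|].
  replace (e / K * (Cmod h * Cmod v1 + Cmod h * Cmod v2)) with (e / K * (Cmod v1 + Cmod v2) * Cmod h) by ring.
  apply Rmult_le_compat_r; [exact Hp|].
  apply Rle_trans with (e / K * K); [|right; field; lra].
  apply Rmult_le_compat_l; [|unfold K; lra]. apply Rlt_le, Rdiv_lt_0_compat; lra.
Qed.

(** A function of one variable is a function of two variables restricted to a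
    line, which reduces the product rule to the one already proved. *)
Lemma cdiff_mult (f g : C -> C) (z : C) : cdiff f z -> cdiff g z -> cdiff (fun w => f w * g w)%C z.
Proof.
  assert (X : forall f, cdiff f z -> cdiff2 (fun q => f (fst q)) (z, RtoC 0)).
  { intros k [A H]. exists A, (RtoC 0). intros e He. destruct (H e He) as [d [Hd H1]].
    exists d; split; [exact Hd|]. intros h1 h2 Hh1 _. simpl.
    replace (A * h1 + 0 * h2)%C with (A * h1)%C by ring.
    eapply Rle_trans; [now apply H1|]. assert (P := Cmod_ge_0 h2). nra. }
  intros Hf Hg. assert (H := cdiff2_mult _ _ _ (X f Hf) (X g Hg)).
  assert (E : forall w, (RtoC 0 + w * RtoC 1)%C = w) by (intros; ring).
  assert (L := cdiff2_line (fun q => f (fst q) * g (fst q))%C 0 1 0 z 0). simpl in L.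
  rewrite E in L. replace (RtoC 0 + z * RtoC 0)%C with (RtoC 0) in L by ring.
  destruct (L H) as [A HA]. exists A. intros e He. destruct (HA e He) as [d [Hd H1]].
  exists d; split; [exact Hd|]. intros h Hh. specialize (H1 h Hh). now rewrite !E in H1.
Qed.

Lemma cdiff_rot (f : C -> C) (w z : C) : Cmod w = 1 -> cdiff f (w * z)%C -> cdiff (fun x => f (w * x)%C) z.
Proof.
  intros Hw [A H]. exists (A * w)%C. intros e He. destruct (H e He) as [d [Hd H1]].
  exists d; split; [exact Hd|]. intros h Hh.
  specialize (H1 (w * h)%C). rewrite Cmod_mult, Hw, Rmult_1_l in H1.
  replace (w * (z + h))%C with (w * z + w * h)%C by ring.
  replace (A * w * h)%C with (A * (w * h))%C by ring. now apply H1.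
Qed.

(** Composition with the exponential, the form in which a disc becomes a
    half-plane and circles become vertical segments. *)
Lemma cdiff_Cexp (f : C -> C) (z : C) : cdiff f (Cexp z) -> cdiff (fun w => f (Cexp w)) z.
Proof.
  intros [A H]. set (E := Cexp z). fold E in H. exists (A * E)%C. intros e He.
  assert (HE : 0 < Cmod E) by (unfold E; rewrite Cmod_Cexp; apply exp_pos).
  assert (HA := Cmod_ge_0 A).
  assert (He1 : exp 1 < 4) by (assert (H1 := exp_le_3); lra).
  set (e1 := e / (8 * Cmod E)). assert (Hep : 0 < e1) by (apply Rdiv_lt_0_compat; lra).
  destruct (H e1 Hep) as [d [Hd H1]].
  set (d1 := d / (4 * Cmod E)). assert (Hdp : 0 < d1) by (apply Rdiv_lt_0_compat; lra).
  set (d2 := e / (8 * (Cmod A + 1) * Cmod E)).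
  assert (Hd2p : 0 < d2) by (apply Rdiv_lt_0_compat; [lra|]; nra).
  exists (Rmin 1 (Rmin d1 d2)). split; [repeat apply Rmin_glb_lt; lra|]. intros h Hh.
  assert (Hh1 := Rlt_le_trans _ _ _ Hh (Rmin_l _ _)).
  assert (Hh' := Rlt_le_trans _ _ _ Hh (Rmin_r _ _)).
  assert (Hh2 := Rlt_le_trans _ _ _ Hh' (Rmin_l _ _)).
  assert (Hh3 := Rlt_le_trans _ _ _ Hh' (Rmin_r _ _)).
  assert (Hp := Cmod_ge_0 h).
  assert (Eh : exp (Cmod h) <= 4) by (assert (exp (Cmod h) <= exp 1) by (apply exp_mono; lra); lra).
  assert (Eh0 := exp_pos (Cmod h)).
  set (k := (Cexp h - 1)%C).
  assert (Hk : Cmod k <= 4 * Cmod h).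
  { eapply Rle_trans; [apply Cexp_minus_1_le|]. nra. }
  assert (Hk2 : Cmod (k - h) <= 4 * Cmod h ^ 2).
  { eapply Rle_trans; [apply Cexp_taylor_le|]. rewrite (Rmult_comm 4). apply Rmult_le_compat_l; [apply pow2_ge_0 | lra]. }
  assert (HEk : Cmod (E * k) < d).
  { rewrite Cmod_mult. apply Rle_lt_trans with (Cmod E * (4 * Cmod h)); [nra|].
    apply (Rmult_lt_compat_l (4 * Cmod E)) in Hh2; [|lra].
    unfold d1 in Hh2. replace (4 * Cmod E * (d / (4 * Cmod E))) with d in Hh2 by (field; lra). lra. }
  specialize (H1 _ HEk). rewrite Cexp_plus. fold E.
  replace (E * Cexp h)%C with (E + E * k)%C by (unfold k; ring).
  replace (f (E + E * k) - f E - A * E * h)%C with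
    ((f (E + E * k)%C - f E - A * (E * k)) + A * E * (k - h))%C by ring.
  eapply Rle_trans; [apply Cmod_triangle|]. rewrite (Cmod_mult (A * E)), (Cmod_mult A).
  assert (Q1 : e1 * Cmod (E * k) <= e / 2 * Cmod h).
  { rewrite Cmod_mult. apply Rle_trans with (e1 * (Cmod E * (4 * Cmod h))).
    - apply Rmult_le_compat_l; nra.
    - unfold e1; right; field; lra. }
  assert (Q2 : Cmod A * Cmod E * Cmod (k - h) <= e / 2 * Cmod h).
  { apply Rle_trans with ((Cmod A + 1) * Cmod E * (4 * Cmod h ^ 2)).
    - apply Rmult_le_compat; [nra | apply Cmod_ge_0 | nra | exact Hk2].
    - apply Rle_trans with (4 * (Cmod A + 1) * Cmod E * d2 * Cmod h).
      + replace ((Cmod A + 1) * Cmod E * (4 * Cmod h ^ 2)) with (4 * (Cmod A + 1) * Cmod E * Cmod h * Cmod h) by ring.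
        apply Rmult_le_compat_r; [lra|]. apply Rmult_le_compat_l; [nra | lra].
      + unfold d2; right; field; lra. }
  lra.
Qed.

(** * Integrals of continuous complex functions on a segment *)

Definition cint (f : R -> C) (a b : R) : C := @RInt C_R_CompleteNormedModule f a b.

Definition cont_on (f : R -> C) (a b : R) : Prop :=
  forall x, a <= x <= b -> continuous f x.

Lemma cont_on_is_RInt (f : R -> C) a b : a <= b -> cont_on f a b ->
  @is_RInt C_R_NormedModule f a b (cint f a b).
Proof.
  intros Hab H. apply (@RInt_correct C_R_CompleteNormedModule).
  apply (@ex_RInt_continuous C_R_CompleteNormedModule).
  rewrite Rmin_left, Rmax_right by lra. exact H.
Qed.

Lemma cint_unique (f : R -> C) a b l : @is_RInt C_R_NormedModule f a b l -> cint f a b = l.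
Proof. apply (@is_RInt_unique C_R_CompleteNormedModule). Qed.

Lemma is_RInt_Re_Im (f : R -> C) a b (l : C) :
  @is_RInt C_R_NormedModule f a b l <->
  is_RInt (fun x => Re (f x)) a b (Re l) /\ is_RInt (fun x => Im (f x)) a b (Im l).
Proof.
  split.
  - intros H; split.
    + exact (is_RInt_fct_extend_fst (U := R_NormedModule) (V := R_NormedModule) f a b l H).
    + exact (is_RInt_fct_extend_snd (U := R_NormedModule) (V := R_NormedModule) f a b l H).
  - intros [H1 H2]. destruct l as [l1 l2].
    exact (is_RInt_fct_extend_pair (U := R_NormedModule) (V := R_NormedModule) f a b l1 l2 H1 H2).
Qed.

Lemma cint_ext (f g : R -> C) a b : a <= b -> (forall x, a < x < b -> f x = g x) -> cint f a b = cint g a b.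
Proof.
  intros Hab H. apply (@RInt_ext C_R_CompleteNormedModule).
  rewrite Rmin_left, Rmax_right by lra. exact H.
Qed.

Lemma cint_plus (f g : R -> C) a b : a <= b -> cont_on f a b -> cont_on g a b ->
  cint (fun x => f x + g x)%C a b = (cint f a b + cint g a b)%C.
Proof.
  intros Hab Hf Hg. apply cint_unique.
  apply (@is_RInt_plus C_R_NormedModule); now apply cont_on_is_RInt.
Qed.

Lemma cint_minus (f g : R -> C) a b : a <= b -> cont_on f a b -> cont_on g a b ->
  cint (fun x => f x - g x)%C a b = (cint f a b - cint g a b)%C.
Proof.
  intros Hab Hf Hg. apply cint_unique.
  apply (@is_RInt_minus C_R_NormedModule); now apply cont_on_is_RInt.
Qed.

Lemma cint_Cmult (f : R -> C) (c : C) a b : a <= b -> cont_on f a b ->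
  cint (fun x => c * f x)%C a b = (c * cint f a b)%C.
Proof.
  intros Hab Hf. apply cint_unique.
  assert (H := cont_on_is_RInt f a b Hab Hf). apply is_RInt_Re_Im in H. destruct H as [H1 H2].
  apply is_RInt_Re_Im; split.
  - exact (is_RInt_minus _ _ _ _ _ _ (is_RInt_scal _ a b (Re c) _ H1) (is_RInt_scal _ a b (Im c) _ H2)).
  - exact (is_RInt_plus _ _ _ _ _ _ (is_RInt_scal _ a b (Re c) _ H2) (is_RInt_scal _ a b (Im c) _ H1)).
Qed.

Lemma cint_Chasles (f : R -> C) a b c : a <= b -> b <= c -> cont_on f a c ->
  cint f a c = (cint f a b + cint f b c)%C.
Proof.
  intros Hab Hbc H. apply cint_unique.
  apply (@is_RInt_Chasles C_R_NormedModule) with b;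
    apply cont_on_is_RInt; try lra; intros x Hx; apply H; lra.
Qed.

Lemma Cmod_norm_R (z : C) : @norm R_AbsRing C_R_NormedModule z = Cmod z.
Proof.
  change (sqrt (Rabs (fst z) ^ 2 + Rabs (snd z) ^ 2) = sqrt (fst z ^ 2 + snd z ^ 2)).
  now rewrite !pow2_abs.
Qed.

Lemma cint_bound (f : R -> C) a b M : a <= b -> cont_on f a b ->
  (forall x, a <= x <= b -> Cmod (f x) <= M) -> Cmod (cint f a b) <= M * (b - a).
Proof.
  intros Hab Hf HM. rewrite <- Cmod_norm_R.
  apply (@norm_RInt_le C_R_NormedModule f (fun _ => M) a b _ _ Hab).
  - intros x Hx. rewrite Cmod_norm_R. now apply HM.
  - now apply cont_on_is_RInt.
  - assert (H := is_RInt_const (V := R_NormedModule) a b M).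
    replace (M * (b - a)) with (scal (b - a) M) by (unfold scal; simpl; unfold mult; simpl; ring).
    exact H.
Qed.

Lemma continuous_Re_Im (f : R -> C) x :
  continuous (fun y => Re (f y)) x -> continuous (fun y => Im (f y)) x -> continuous f x.
Proof.
  intros C1 C2 P [e HP].
  destruct (C1 _ (locally_ball _ e)) as [d1 Hd1].
  destruct (C2 _ (locally_ball _ e)) as [d2 Hd2].
  exists (mkposreal _ (Rmin_stable_in_posreal d1 d2)). intros y Hy.
  apply HP; split.
  - apply Hd1. apply (ball_le x (Rmin d1 d2)); [apply Rmin_l | exact Hy].
  - apply Hd2. apply (ball_le x (Rmin d1 d2)); [apply Rmin_r | exact Hy].
Qed.

Lemma cis_derive_cont (f : R -> C) x l : cis_derive f x l -> continuous f x.
Proof.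
  intros [H1 H2]. apply continuous_Re_Im.
  - apply (ex_derive_continuous (fun y => Re (f y))). eexists; exact H1.
  - apply (ex_derive_continuous (fun y => Im (f y))). eexists; exact H2.
Qed.

Lemma continuous_Re (f : R -> C) x : continuous f x -> continuous (fun y => Re (f y)) x.
Proof.
  intros H P [e HP]. destruct (H _ (locally_ball _ e)) as [d Hd].
  exists d. intros y Hy. apply HP. exact (proj1 (Hd y Hy)).
Qed.

Lemma continuous_Im (f : R -> C) x : continuous f x -> continuous (fun y => Im (f y)) x.
Proof.
  intros H P [e HP]. destruct (H _ (locally_ball _ e)) as [d Hd].
  exists d. intros y Hy. apply HP. exact (proj2 (Hd y Hy)).
Qed.

Lemma continuous_Cmult (f g : R -> C) x : continuous f x -> continuous g x -> continuous (fun t => f t * g t)%C x.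
Proof.
  intros Hf Hg.
  assert (H1 := continuous_Re f x Hf). assert (H2 := continuous_Im f x Hf).
  assert (H3 := continuous_Re g x Hg). assert (H4 := continuous_Im g x Hg).
  apply continuous_Re_Im.
  - apply (continuous_minus (V := R_NormedModule) (fun t => Re (f t) * Re (g t)) (fun t => Im (f t) * Im (g t)));
      now apply (continuous_mult (K := R_AbsRing)).
  - apply (continuous_plus (V := R_NormedModule) (fun t => Re (f t) * Im (g t)) (fun t => Im (f t) * Re (g t)));
      now apply (continuous_mult (K := R_AbsRing)).
Qed.

Lemma cint_derive (f df : R -> C) a b : a <= b ->
  (forall x, a <= x <= b -> cis_derive f x (df x)) -> cont_on df a b ->
  cint df a b = (f b - f a)%C.
Proof.
  intros Hab Hd Hc. apply cint_unique, is_RInt_Re_Im. split.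
  - apply (is_RInt_derive (V := R_CompleteNormedModule) (fun x => Re (f x)) (fun x => Re (df x)));
      rewrite Rmin_left, Rmax_right by lra; intros x Hx; [apply Hd, Hx | apply continuous_Re, Hc, Hx].
  - apply (is_RInt_derive (V := R_CompleteNormedModule) (fun x => Im (f x)) (fun x => Im (df x)));
      rewrite Rmin_left, Rmax_right by lra; intros x Hx; [apply Hd, Hx | apply continuous_Im, Hc, Hx].
Qed.

Lemma cis_derive_affine (p q : C) x : cis_derive (fun y => p + RtoC y * q)%C x q.
Proof.
  eapply cis_derive_val.
  - apply (cis_derive_plus (fun _ => p)); [apply cis_derive_const | apply cis_derive_lin].
  - ring.
Qed.

Lemma cint_affine (p q : C) a b : a <= b ->
  cint (fun x => p + RtoC x * q)%C a b = (RtoC (b - a) * p + RtoC ((b ^ 2 - a ^ 2) / 2) * q)%C.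
Proof.
  intros Hab.
  rewrite (cint_derive (fun x => RtoC x * p + RtoC (x ^ 2 / 2) * q)%C); [| exact Hab | |].
  - apply C_ext; simpl; field.
  - intros x _. apply cis_derive_plus; [apply cis_derive_lin|].
    eapply cis_derive_val.
    + apply cis_derive_mult with (g := fun _ => q); [|apply cis_derive_const].
      apply (cis_derive_RtoC (fun y => y ^ 2 / 2) x x). auto_derive; [easy | field].
    + simpl; ring.
  - intros x _. eapply cis_derive_cont, cis_derive_affine.
Qed.

(** * Goursat's theorem for rectangles *)

Definition rect_int (f : C -> C) (a b c d : R) : C :=
  (cint (fun x => f (x, c)) a b - cint (fun x => f (x, d)) a b
   + Ci * (cint (fun y => f (b, y)) c d - cint (fun y => f (a, y)) c d))%C.

Lemma cdiff_cont_hor (f : C -> C) x y : cdiff f (x, y) -> continuous (fun t => f (t, y)) x.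
Proof.
  intros H. apply continuous_eps. intros e He. destruct (cdiff_cont _ _ H e He) as [d [Hd H1]].
  exists d; split; [exact Hd|]. intros t Ht. apply H1.
  refine (Rle_lt_trans _ (Rabs (t - x)) _ (Req_le _ _ _) Ht).
  rewrite <- Cmod_R. apply f_equal, C_ext; simpl; ring.
Qed.

Lemma cdiff_cont_ver (f : C -> C) x y : cdiff f (x, y) -> continuous (fun t => f (x, t)) y.
Proof.
  intros H. apply continuous_eps. intros e He. destruct (cdiff_cont _ _ H e He) as [d [Hd H1]].
  exists d; split; [exact Hd|]. intros t Ht. apply H1.
  refine (Rle_lt_trans _ (Rabs (t - y)) _ (Req_le _ _ _) Ht).
  transitivity (Cmod (Ci * RtoC (t - y))).
  - apply f_equal, C_ext; simpl; ring.
  - rewrite Cmod_mult, Cmod_Ci, Cmod_R; apply Rmult_1_l.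
Qed.

Lemma pair_eq (x y : R) : ((x, y) : C) = (RtoC x + RtoC y * Ci)%C.
Proof. apply C_ext; simpl; ring. Qed.

Lemma rect_int_split (f : C -> C) a m b c n d :
  a <= m -> m <= b -> c <= n -> n <= d ->
  (forall x y, a <= x <= b -> c <= y <= d -> cdiff f (x, y)) ->
  rect_int f a b c d =
  (rect_int f a m c n + rect_int f m b c n + rect_int f a m n d + rect_int f m b n d)%C.
Proof.
  intros H1 H2 H3 H4 H. unfold rect_int.
  assert (Hx : forall y, c <= y <= d -> cint (fun x => f (x, y)) a b = (cint (fun x => f (x, y)) a m + cint (fun x => f (x, y)) m b)%C).
  { intros y Hy. apply cint_Chasles; try lra. intros x Hx; apply cdiff_cont_hor, H; lra. }
  assert (Hy : forall x, a <= x <= b -> cint (fun y => f (x, y)) c d = (cint (fun y => f (x, y)) c n + cint (fun y => f (x, y)) n d)%C).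
  { intros x Hx'. apply cint_Chasles; try lra. intros y Hy; apply cdiff_cont_ver, H; lra. }
  rewrite (Hx c), (Hx d), (Hy a), (Hy b) by lra. ring.
Qed.

(** The integral of an affine function round a rectangle vanishes, so only the
    error term of the differential contributes, which is small compared with
    the square of the side lengths. *)
Lemma rect_int_small (f : C -> C) (x0 y0 : R) (e : R) :
  0 < e -> cdiff f (x0, y0) ->
  exists delta, 0 < delta /\ forall a b c d,
    a <= x0 <= b -> c <= y0 <= d -> (b - a) + (d - c) < delta ->
    (forall x y, a <= x <= b -> c <= y <= d -> cdiff f (x, y)) ->
    Cmod (rect_int f a b c d) <= 2 * e * ((b - a) + (d - c)) ^ 2.
Proof.
  intros He [A HA]. destruct (HA e He) as [delta [Hd H1]].
  exists delta; split; [exact Hd|]. intros a b c d Hx0 Hy0 Hs Hf.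
  set (s := (b - a) + (d - c)) in *.
  set (z0 := (x0, y0) : C) in *.
  set (g := fun z : C => (f z0 + A * (z - z0))%C).
  set (r := fun z : C => (f z - g z)%C).
  assert (Hr : forall x y, a <= x <= b -> c <= y <= d -> Cmod (r (x, y)) <= e * s).
  { assert (G : forall z, Cmod (z - z0) <= s -> Cmod (r z) <= e * s).
    { intros z Hz. unfold r, g. specialize (H1 (z - z0)%C (Rle_lt_trans _ _ _ Hz Hs)).
      replace (z0 + (z - z0))%C with z in H1 by ring.
      replace (f z - (f z0 + A * (z - z0)))%C with (f z - f z0 - A * (z - z0))%C by ring.
      eapply Rle_trans; [exact H1|]. apply Rmult_le_compat_l; lra. }
    intros x y Hx Hy. apply G.
    eapply Rle_trans; [apply Cmod_le_Re_Im|]. unfold z0, s; simpl.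
    assert (Rabs (x + - x0) <= b - a) by (apply Rabs_le; lra).
    assert (Rabs (y + - y0) <= d - c) by (apply Rabs_le; lra). lra. }
  assert (Hgx : forall y, forall x, g (x, y) = ((f z0 + A * (RtoC y * Ci - z0)) + RtoC x * A)%C).
  { intros y x. unfold g. rewrite (pair_eq x y). ring. }
  assert (Hgy : forall x, forall y, g (x, y) = ((f z0 + A * (RtoC x - z0)) + RtoC y * (A * Ci))%C).
  { intros y x. unfold g. rewrite (pair_eq y x). ring. }
  assert (Cgx : forall y, cont_on (fun x => g (x, y)) a b).
  { intros y x _. apply (continuous_ext (fun x => ((f z0 + A * (RtoC y * Ci - z0)) + RtoC x * A)%C)).
    - intros t; now rewrite Hgx.
    - eapply cis_derive_cont, cis_derive_affine. }
  assert (Cgy : forall x, cont_on (fun y => g (x, y)) c d).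
  { intros x y _. apply (continuous_ext (fun y => ((f z0 + A * (RtoC x - z0)) + RtoC y * (A * Ci))%C)).
    - intros t; now rewrite Hgy.
    - eapply cis_derive_cont, cis_derive_affine. }
  assert (Cfx : forall y, c <= y <= d -> cont_on (fun x => f (x, y)) a b).
  { intros y Hy x Hx. apply cdiff_cont_hor. now apply Hf. }
  assert (Cfy : forall x, a <= x <= b -> cont_on (fun y => f (x, y)) c d).
  { intros x Hx y Hy. apply cdiff_cont_ver. now apply Hf. }
  assert (Crx : forall y, c <= y <= d -> cont_on (fun x => r (x, y)) a b).
  { intros y Hy x Hx. apply (@continuous_minus R_UniformSpace R_AbsRing C_R_NormedModule (fun x => f (x, y)) (fun x => g (x, y)));
     [now apply Cfx | now apply Cgx]. }
  assert (Cry : forall x, a <= x <= b -> cont_on (fun y => r (x, y)) c d).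
  { intros x Hx y Hy. apply (@continuous_minus R_UniformSpace R_AbsRing C_R_NormedModule (fun y => f (x, y)) (fun y => g (x, y)));
     [now apply Cfy | now apply Cgy]. }
  assert (E : rect_int f a b c d = rect_int r a b c d).
  { unfold rect_int.
    assert (Ex : forall y, c <= y <= d -> cint (fun x => r (x, y)) a b
       = (cint (fun x => f (x, y)) a b - cint (fun x => g (x, y)) a b)%C).
    { intros y Hy. apply (cint_minus (fun x => f (x, y)) (fun x => g (x, y))); [lra | now apply Cfx | apply Cgx]. }
    assert (Ey : forall x, a <= x <= b -> cint (fun y => r (x, y)) c d
       = (cint (fun y => f (x, y)) c d - cint (fun y => g (x, y)) c d)%C).
    { intros x Hx. apply (cint_minus (fun y => f (x, y)) (fun y => g (x, y))); [lra | now apply Cfy | apply Cgy]. }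
    rewrite (Ex c), (Ex d), (Ey a), (Ey b) by lra.
    rewrite (cint_ext (fun x => g (x, c)) _ a b (ltac:(lra)) (fun x _ => Hgx c x)).
    rewrite (cint_ext (fun x => g (x, d)) _ a b (ltac:(lra)) (fun x _ => Hgx d x)).
    rewrite (cint_ext (fun y => g (a, y)) _ c d (ltac:(lra)) (fun y _ => Hgy a y)).
    rewrite (cint_ext (fun y => g (b, y)) _ c d (ltac:(lra)) (fun y _ => Hgy b y)).
    rewrite !cint_affine by lra.
    match goal with |- _ = ?R => set (RHS := R) end.
    replace RHS with (RHS - 0)%C by ring. unfold RHS.
    rewrite !RtoC_minus.
    ring_simplify.
    replace (Ci ^ 2)%C with (RtoC (-1)) by (apply C_ext; simpl; ring). 
    ring. }
  rewrite E. unfold rect_int.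
  assert (B1 := cint_bound _ a b (e * s) (ltac:(lra)) (Crx c ltac:(lra)) (fun x Hx => Hr x c Hx ltac:(lra))).
  assert (B2 := cint_bound _ a b (e * s) (ltac:(lra)) (Crx d ltac:(lra)) (fun x Hx => Hr x d Hx ltac:(lra))).
  assert (B3 := cint_bound _ c d (e * s) (ltac:(lra)) (Cry b ltac:(lra)) (fun y Hy => Hr b y ltac:(lra) Hy)).
  assert (B4 := cint_bound _ c d (e * s) (ltac:(lra)) (Cry a ltac:(lra)) (fun y Hy => Hr a y ltac:(lra) Hy)).
  eapply Rle_trans; [apply Cmod_triangle|]. rewrite Cmod_mult, Cmod_Ci, Rmult_1_l.
  eapply Rle_trans; [apply Rplus_le_compat; apply Cmod_triangle_minus|].
  unfold s in *. nra.
Qed.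

(** Nested intervals, given by their left ends and their lengths [h / 2^n]. *)
Lemma nested_point (a : nat -> R) (h : R) :
  (forall n, a n <= a (S n) /\ a (S n) + h / 2 ^ (S n) <= a n + h / 2 ^ n) ->
  0 <= h ->
  exists x, forall n, a n <= x <= a n + h / 2 ^ n.
Proof.
  intros H Hh.
  assert (Hp : forall n, 0 <= h / 2 ^ n).
  { intros n. apply Rdiv_le_0_compat; [lra | apply pow_lt; lra]. }
  assert (Hm : forall n k, a n <= a (n + k)%nat /\ a (n + k)%nat + h / 2 ^ (n + k) <= a n + h / 2 ^ n).
  { intros n k; induction k as [|k IH].
    - rewrite Nat.add_0_r; lra.
    - rewrite Nat.add_succ_r. specialize (H (n + k)%nat). lra. }
  assert (Hc : forall n m, a m <= a n + h / 2 ^ n).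
  { intros n m. destruct (le_lt_dec n m) as [L|L].
    - replace m with (n + (m - n))%nat by lia. destruct (Hm n (m - n)%nat). specialize (Hp (n + (m - n))%nat). lra.
    - replace n with (m + (n - m))%nat by lia. destruct (Hm m (n - m)%nat). specialize (Hp (m + (n - m))%nat). lra. }
  destruct (completeness (fun x => exists n, x = a n)) as [x [Hu Hl]].
  - exists (a O + h / 2 ^ 0). intros y [n ->]. apply Hc.
  - exists (a O), O; easy.
  - exists x. intros n; split.
    + apply Hu. now exists n.
    + apply Hl. intros y [m ->]. apply Hc.
Qed.

(** Repeated quartering, keeping each time a quarter whose integral is at least a
    fourth of the previous one.  The quarters shrink to a point, where
    differentiability bounds the integral over the [n]-th one, for large [n],
    by an arbitrarily small multiple of [(h + k)^2 / 4^n]. *)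
Theorem Goursat_rectangle (f : C -> C) (a0 c0 h k : R) :
  0 <= h -> 0 <= k ->
  (forall x y, a0 <= x <= a0 + h -> c0 <= y <= c0 + k -> cdiff f (x, y)) ->
  rect_int f a0 (a0 + h) c0 (c0 + k) = RtoC 0.
Proof.
  intros Hh Hk Hf.
  set (H n := h / 2 ^ n). set (K n := k / 2 ^ n).
  assert (HS : forall n, H n = H (S n) + H (S n)) by (intros n; unfold H; simpl; field; apply pow_nonzero; lra).
  assert (KS : forall n, K n = K (S n) + K (S n)) by (intros n; unfold K; simpl; field; apply pow_nonzero; lra).
  assert (Hp : forall n, 0 <= H n) by (intros n; apply Rdiv_le_0_compat; [lra | apply pow_lt; lra]).
  assert (Kp : forall n, 0 <= K n) by (intros n; apply Rdiv_le_0_compat; [lra | apply pow_lt; lra]).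
  set (J n (p : R * R) := rect_int f (fst p) (fst p + H n) (snd p) (snd p + K n)).
  set (next n (p : R * R) :=
    if Rle_dec (Cmod (J n p) / 4) (Cmod (J (S n) p)) then p
    else if Rle_dec (Cmod (J n p) / 4) (Cmod (J (S n) (fst p + H (S n), snd p))) then (fst p + H (S n), snd p)
    else if Rle_dec (Cmod (J n p) / 4) (Cmod (J (S n) (fst p, snd p + K (S n)))) then (fst p, snd p + K (S n))
    else (fst p + H (S n), snd p + K (S n))).
  set (P := fix P n := match n with O => (a0, c0) | S m => next m (P m) end).
  assert (Hstep : forall n, (fst (P n) <= fst (P (S n)) /\ fst (P (S n)) + H (S n) <= fst (P n) + H n)
                         /\ (snd (P n) <= snd (P (S n)) /\ snd (P (S n)) + K (S n) <= snd (P n) + K n)).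
  { intros n. specialize (HS n). specialize (KS n). assert (A1 := Hp (S n)). assert (A2 := Kp (S n)).
    change (P (S n)) with (next n (P n)). unfold next.
    repeat destruct Rle_dec; simpl; lra. }
  assert (Hin : forall n, a0 <= fst (P n) /\ fst (P n) + H n <= a0 + h /\ c0 <= snd (P n) /\ snd (P n) + K n <= c0 + k).
  { induction n as [|n IH].
    - unfold H, K; simpl; lra.
    - specialize (Hstep n). lra. }
  assert (Hbig : forall n, Cmod (J n (P n)) <= 4 * Cmod (J (S n) (P (S n)))).
  { intros n. change (P (S n)) with (next n (P n)). unfold next.
    destruct Rle_dec as [L1|L1]; [lra|].
    destruct Rle_dec as [L2|L2]; [lra|].
    destruct Rle_dec as [L3|L3]; [lra|].
    apply Rnot_le_lt in L1, L2, L3.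
    assert (E : J n (P n) = (J (S n) (P n) + J (S n) ((fst (P n) + H (S n))%R, snd (P n))
       + J (S n) (fst (P n), (snd (P n) + K (S n))%R) + J (S n) ((fst (P n) + H (S n))%R, (snd (P n) + K (S n))%R))%C).
    { unfold J; simpl. specialize (HS n). specialize (KS n). assert (A1 := Hp (S n)). assert (A2 := Kp (S n)).
      rewrite HS, KS, <- !Rplus_assoc. apply rect_int_split; try lra.
      intros x y Hx Hy. specialize (Hin n). apply Hf; lra. }
    assert (T : Cmod (J n (P n)) <= Cmod (J (S n) (P n)) + Cmod (J (S n) (fst (P n) + H (S n), snd (P n)))
       + Cmod (J (S n) (fst (P n), snd (P n) + K (S n))) + Cmod (J (S n) (fst (P n) + H (S n), snd (P n) + K (S n)))).
    { rewrite E. eapply Rle_trans; [apply Cmod_triangle|]. apply Rplus_le_compat_r.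
      eapply Rle_trans; [apply Cmod_triangle|]. apply Rplus_le_compat_r. apply Cmod_triangle. }
    lra. }
  assert (Hpow : forall n, Cmod (J O (P O)) <= 4 ^ n * Cmod (J n (P n))).
  { induction n as [|n IH]; [simpl; lra|].
    eapply Rle_trans; [exact IH|]. specialize (Hbig n).
    replace (4 ^ S n * Cmod (J (S n) (P (S n)))) with (4 ^ n * (4 * Cmod (J (S n) (P (S n))))) by (rewrite <- (tech_pow_Rmult 4 n); ring).
    apply Rmult_le_compat_l; [apply pow_le; lra | exact Hbig]. }
  destruct (nested_point (fun n => fst (P n)) h) as [x0 Hx0]; [intros n; apply Hstep | exact Hh |].
  destruct (nested_point (fun n => snd (P n)) k) as [y0 Hy0]; [intros n; apply Hstep | exact Hk |].
  assert (Hd0 : cdiff f (x0, y0)).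
  { apply Hf; [specialize (Hx0 O) | specialize (Hy0 O)]; simpl in *; lra. }
  assert (Key : forall e, 0 < e -> Cmod (J O (P O)) <= 2 * e * (h + k) ^ 2).
  { intros e He. destruct (rect_int_small f x0 y0 e He Hd0) as [delta [Hdelta Hs]].
    assert (Hn : exists n, (h + k) / 2 ^ n < delta).
    { destruct (Rle_lt_or_eq_dec 0 (h + k)) as [Hpos|Hz]; [lra| |].
      - destruct (pow_lt_1_zero (/2) ltac:(rewrite Rabs_pos_eq; lra) (delta / (h + k)) ltac:(now apply Rdiv_lt_0_compat)) as [n Hn].
        exists n. specialize (Hn n (Nat.le_refl n)). rewrite Rabs_pos_eq in Hn by (apply pow_le; lra).
        rewrite pow_inv in Hn. apply (Rmult_lt_compat_l (h + k)) in Hn; [|lra].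
        replace ((h + k) * (delta / (h + k))) with delta in Hn by (field; lra). exact Hn.
      - exists O. rewrite <- Hz. simpl. lra. }
    destruct Hn as [n Hn].
    assert (Hn2 : H n + K n = (h + k) / 2 ^ n) by (unfold H, K; field; apply pow_nonzero; lra).
    specialize (Hs (fst (P n)) (fst (P n) + H n) (snd (P n)) (snd (P n) + K n) (Hx0 n) (Hy0 n)).
    replace (fst (P n) + H n - fst (P n) + (snd (P n) + K n - snd (P n))) with ((h + k) / 2 ^ n) in Hs by (rewrite <- Hn2; ring).
    specialize (Hs Hn). 
    assert (Hs' : Cmod (J n (P n)) <= 2 * e * ((h + k) / 2 ^ n) ^ 2).
    { apply Hs. intros x y Hx Hy. specialize (Hin n). apply Hf; lra. }
    eapply Rle_trans; [apply (Hpow n)|].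
    apply Rle_trans with (4 ^ n * (2 * e * ((h + k) / 2 ^ n) ^ 2)).
    - apply Rmult_le_compat_l; [apply pow_le; lra | exact Hs'].
    - right. replace (4 ^ n) with (2 ^ n * 2 ^ n) by (rewrite <- Rpow_mult_distr; f_equal; lra).
      field. apply pow_nonzero; lra. }
  assert (Z : Cmod (J O (P O)) = 0).
  { apply Rle_antisym; [|apply Cmod_ge_0]. apply Rle_trans with (2 * 0 * (h + k) ^ 2); [|lra].
    apply Rnot_lt_le. intros HJ.
    set (j := Cmod (J O (P O))) in *. set (q := 2 * (h + k) ^ 2).
    assert (Hq : 0 <= q) by (unfold q; apply Rmult_le_pos; [lra | apply pow2_ge_0]).
    assert (HJ' : 0 < j) by lra.
    assert (He : 0 < j / (q + 1) / 2) by (apply Rdiv_lt_0_compat; [apply Rdiv_lt_0_compat|]; lra).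
    specialize (Key _ He).
    replace (2 * (j / (q + 1) / 2) * (h + k) ^ 2) with (j / 2 * (q / (q + 1))) in Key by (unfold q; field; unfold q in Hq; lra).
    assert (q / (q + 1) <= 1) by (apply Rmult_le_reg_r with (q + 1); [lra|]; unfold Rdiv; rewrite Rmult_assoc, Rinv_l; lra).
    nra. }
  apply Cmod_eq_0 in Z. unfold J, H, K in Z. simpl in Z. rewrite !Rdiv_1_r in Z. exact Z.
Qed.

(** * The identity theorem on a box *)

Lemma Cexp_pair (x y : R) : Cexp (x, y) = (RtoC (exp x) * Cexp (Ci * RtoC y))%C.
Proof. rewrite <- Cexp_RtoC, <- Cexp_plus. f_equal. apply C_ext; simpl; ring. Qed.

Lemma Cexp_Ci (y : R) : Cexp (Ci * RtoC y) = (cos y, sin y).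
Proof.
  unfold Cexp. replace (Re (Ci * RtoC y)) with 0 by (simpl; ring).
  replace (Im (Ci * RtoC y)) with y by (simpl; ring).
  rewrite exp_0. apply C_ext; simpl; ring.
Qed.

Lemma Cexp_2PI (y : R) : Cexp (Ci * RtoC (y + 2 * PI)) = Cexp (Ci * RtoC y).
Proof.
  rewrite !Cexp_Ci, cos_plus, sin_plus, cos_2PI, sin_2PI. apply C_ext; simpl; ring.
Qed.

(** The mean value property in disguise: in the coordinate [w] with
    [z = e^w], Goursat's theorem on a period strip says that the integral
    over a circle does not depend on its radius, and for small radii it is
    close to [2 pi Phi 0]. *)
Lemma zero_on_circle (Phi : C -> C) :
  (forall z, Cmod z <= 1 -> cdiff Phi z) ->
  (forall y, 0 <= y <= 2 * PI -> Phi (Cexp (Ci * RtoC y)) = RtoC 0) ->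
  Phi (RtoC 0) = RtoC 0.
Proof.
  intros Hd Hz. assert (HPI := PI_RGT_0).
  set (psi := fun w => Phi (Cexp w)).
  assert (Hpsi : forall x y, x <= 0 -> cdiff psi (x, y)).
  { intros x y Hx. apply cdiff_Cexp, Hd. rewrite Cmod_Cexp. simpl.
    rewrite <- exp_0. now apply exp_mono. }
  assert (Cver : forall x, x <= 0 -> cont_on (fun y => psi (x, y)) 0 (2 * PI)).
  { intros x Hx y _. now apply cdiff_cont_ver, Hpsi. }
  assert (V : forall X, X <= 0 -> cint (fun y => psi (X, y)) 0 (2 * PI) = RtoC 0).
  { intros X HX.
    assert (G := Goursat_rectangle psi X 0 (- X) (2 * PI) ltac:(lra) ltac:(lra) ltac:(intros; apply Hpsi; lra)).
    replace (X + - X) with 0 in G by ring. rewrite Rplus_0_l in G. unfold rect_int in G.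
    assert (E1 : cint (fun x => psi (x, 0)) X 0 = cint (fun x => psi (x, 2 * PI)) X 0).
    { apply cint_ext; [lra|]. intros x _. unfold psi. rewrite !Cexp_pair.
      do 2 f_equal. replace (2 * PI) with (0 + 2 * PI) by ring. now rewrite Cexp_2PI. }
    assert (E2 : cint (fun y => psi (0, y)) 0 (2 * PI) = RtoC 0).
    { apply Cmod_eq_0, Rle_antisym; [|apply Cmod_ge_0].
      apply Rle_trans with (0 * (2 * PI - 0)); [|lra].
      apply cint_bound; [lra | apply Cver; lra |]. intros y Hy. unfold psi.
      rewrite Cexp_pair, exp_0, Cmult_1_l, Hz by lra. rewrite Cmod_0; lra. }
    rewrite E1, E2 in G.
    set (I := cint (fun y => psi (X, y)) 0 (2 * PI)) in *.
    set (K := cint (fun x => psi (x, 2 * PI)) X 0) in *.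
    transitivity (Ci * (K - K + Ci * (RtoC 0 - I)))%C; [apply C_ext; simpl; ring|].
    rewrite G; ring. }
  apply Cmod_eq_0, Rle_antisym; [|apply Cmod_ge_0].
  apply Rnot_lt_le. intros Hpos.
  destruct (cdiff_cont Phi (RtoC 0) (Hd _ ltac:(rewrite Cmod_0; lra)) (Cmod (Phi (RtoC 0)) / 2) ltac:(lra)) as [d [Hdp H]].
  set (X := ln (Rmin 1 (d / 2))).
  assert (HR : 0 < Rmin 1 (d / 2)) by (apply Rmin_glb_lt; lra).
  assert (HX : X <= 0).
  { unfold X. rewrite <- ln_1. destruct (Rmin_l 1 (d / 2)) as [L|E].
    - now apply Rlt_le, ln_increasing.
    - rewrite E; lra. }
  assert (HeX : exp X < d).
  { unfold X. rewrite exp_ln by exact HR. assert (Q := Rmin_r 1 (d / 2)). lra. }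
  set (c := Phi (RtoC 0)) in *.
  assert (B : Cmod (cint (fun y => psi (X, y) - c)%C 0 (2 * PI)) <= Cmod c / 2 * (2 * PI - 0)).
  { apply cint_bound; [lra | |].
    - intros y Hy. apply (@continuous_minus R_UniformSpace R_AbsRing C_R_NormedModule (fun y => psi (X, y)) (fun _ => c)).
      + now apply Cver.
      + apply continuous_const.
    - intros y _. apply Rlt_le, H. 
      replace (Cexp (X, y) - RtoC 0)%C with (Cexp (X, y)) by ring. rewrite Cmod_Cexp. exact HeX. }
  rewrite (cint_minus (fun y => psi (X, y)) (fun _ => c)), (V X HX) in B.
  - assert (E : cint (fun _ => c) 0 (2 * PI) = (RtoC (2 * PI) * c)%C).
    { rewrite <- (cint_ext (fun x => c + RtoC x * 0)%C) by (try lra; intros; ring).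
      rewrite cint_affine by lra. rewrite Rminus_0_r. ring. }
    rewrite E in B.
    replace (RtoC 0 - RtoC (2 * PI) * c)%C with (- (RtoC (2 * PI) * c))%C in B by ring.
    rewrite Cmod_opp, Cmod_mult, Cmod_R, Rabs_pos_eq in B by lra. nra.
  - lra.
  - now apply Cver.
  - intros y _. apply continuous_const.
Qed.

(** The product of rotated copies of [f] vanishes on the whole circle as soon
    as [f] vanishes on an arc. *)
Fixpoint rot_prod (f : C -> C) (eta : R) (n : nat) (z : C) : C :=
  match n with
  | O => f (Cexp (Ci * RtoC (eta * INR 0)) * z)%C
  | S m => (rot_prod f eta m z * f (Cexp (Ci * RtoC (eta * INR (S m))) * z))%C
  end.

Lemma Cmod_Cexp_Ci (y : R) : Cmod (Cexp (Ci * RtoC y)) = 1.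
Proof. rewrite Cmod_Cexp. replace (Re (Ci * RtoC y)) with 0 by (simpl; ring). apply exp_0. Qed.

Lemma rot_prod_cdiff f eta n z :
  (forall w, Cmod w <= 1 -> cdiff f w) -> Cmod z <= 1 -> cdiff (rot_prod f eta n) z.
Proof.
  intros Hf Hz.
  assert (H : forall y, cdiff (fun z => f (Cexp (Ci * RtoC y) * z)%C) z).
  { intros y. apply cdiff_rot; [apply Cmod_Cexp_Ci|]. apply Hf.
    rewrite Cmod_mult, Cmod_Cexp_Ci; lra. }
  induction n as [|n IH]; [apply H|].
  apply (cdiff_mult (rot_prod f eta n)); [exact IH | apply H].
Qed.

Lemma rot_prod_zero f eta n k z : (k <= n)%nat ->
  f (Cexp (Ci * RtoC (eta * INR k)) * z)%C = RtoC 0 -> rot_prod f eta n z = RtoC 0.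
Proof.
  intros Hk Hf. induction n as [|n IH].
  - replace k with O in Hf by lia. exact Hf.
  - destruct (Nat.eq_dec k (S n)) as [->|Hne].
    + change (rot_prod f eta n z * f (Cexp (Ci * RtoC (eta * INR (S n))) * z) = 0)%C. rewrite Hf; ring.
    + change (rot_prod f eta n z * f (Cexp (Ci * RtoC (eta * INR (S n))) * z) = 0)%C.
      rewrite IH by lia. ring.
Qed.

Lemma Cmult_integral (z w : C) : (z * w)%C = RtoC 0 -> z = RtoC 0 \/ w = RtoC 0.
Proof.
  intros H. destruct (Ceq_dec z 0) as [|Hz]; [now left|]. destruct (Ceq_dec w 0) as [|Hw]; [now right|].
  now elim (Cmult_neq_0 z w Hz Hw).
Qed.

Lemma rot_prod_at_0 f eta n : rot_prod f eta n (RtoC 0) = RtoC 0 -> f (RtoC 0) = RtoC 0.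
Proof.
  induction n as [|n IH]; simpl; intros H.
  - now rewrite Cmult_0_r in H.
  - apply Cmult_integral in H. destruct H as [H|H]; [now apply IH|].
    now rewrite Cmult_0_r in H.
Qed.

(** Zeros on an arc propagate to the centre: the rotations by multiples of
    [delta] up to [2 pi] carry the arc over the whole circle, and at the centre
    all rotated copies of [f] take the value [f 0]. *)
Lemma zero_on_arc (f : C -> C) (delta : R) :
  (forall z, Cmod z <= 1 -> cdiff f z) -> 0 < delta ->
  (forall y, 0 <= y < delta -> f (Cexp (Ci * RtoC y)) = RtoC 0) ->
  f (RtoC 0) = RtoC 0.
Proof.
  intros Hf Hd Hz. assert (HPI := PI_RGT_0).
  destruct (INR_unbounded (2 * PI / delta)) as [M HM].
  assert (HM' : 2 * PI <= delta * INR M).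
  { apply Rlt_le. apply (Rmult_lt_compat_l delta) in HM; [|exact Hd].
    replace (delta * (2 * PI / delta)) with (2 * PI) in HM by (field; lra). exact HM. }
  apply (rot_prod_at_0 f delta M), zero_on_circle.
  - intros z Hzz. now apply rot_prod_cdiff.
  - intros y Hy.
    assert (Hk : forall m, 2 * PI <= y + delta * INR m ->
       exists k, (k <= m)%nat /\ 2 * PI <= y + delta * INR k < 2 * PI + delta).
    { induction m as [|m IH]; intros Hm.
      - exists O; split; [lia|]. simpl in *. lra.
      - destruct (Rle_lt_dec (2 * PI) (y + delta * INR m)) as [L|L].
        + destruct (IH L) as [k [H1 H2]]. exists k; split; [lia | exact H2].
        + exists (S m); split; [lia|]. rewrite S_INR in *. lra. }
    destruct (Hk M ltac:(lra)) as [k [Hkm Hk2]].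
    apply (rot_prod_zero f delta M k _ Hkm).
    rewrite <- Cexp_plus.
    replace (Ci * RtoC (delta * INR k) + Ci * RtoC y)%C with (Ci * RtoC ((y + delta * INR k - 2 * PI) + 2 * PI))%C
      by (apply C_ext; simpl; ring).
    rewrite Cexp_2PI. apply Hz. lra.
Qed.

Definition in_box (p : C2) (r : R) (q : C2) : Prop :=
  Cmod (fst q - fst p) < r /\ Cmod (snd q - snd p) < r.

(** A function that vanishes near [q] vanishes on an arc of the circle through
    [q] with centre [p'] in the complex line through both points. *)
Lemma identity_on_box (F : C2 -> C) (p q p' : C2) (r : R) :
  (forall x, in_box p r x -> cdiff2 F x) ->
  in_box p (r / 3) q -> in_box p (r / 3) p' ->
  locally q (fun x => F x = RtoC 0) -> F p' = RtoC 0.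
Proof.
  destruct p as [p1 p2], q as [q1 q2], p' as [a1 a2]. unfold in_box; simpl.
  intros HF [Hq1 Hq2] [Ha1 Ha2] Hl. apply locally_C2 in Hl. destruct Hl as [d [Hd Hl]]. simpl in Hl.
  assert (Hv : forall a p q : C, Cmod (a - p) < r / 3 -> Cmod (q - p) < r / 3 -> Cmod (q - a) < 2 * r / 3).
  { intros a p q H1 H2. replace (q - a)%C with ((q - p) - (a - p))%C by ring.
    eapply Rle_lt_trans; [apply Cmod_triangle_minus|]. lra. }
  assert (Hv1 := Hv _ _ _ Ha1 Hq1). assert (Hv2 := Hv _ _ _ Ha2 Hq2). clear Hv.
  assert (Hr : 0 < r) by (assert (H := Cmod_ge_0 (q1 - p1)); lra).
  set (f := fun z => F ((a1 + z * (q1 - a1))%C, (a2 + z * (q2 - a2))%C)).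
  assert (E0 : f (RtoC 0) = F (a1, a2)) by (unfold f; now rewrite !Cmult_0_l, !Cplus_0_r).
  refine (eq_trans (eq_sym E0) _).
  assert (Hdelta : 0 < Rmin 1 (d / (4 * r))).
  { apply Rmin_glb_lt; [lra|]. apply Rdiv_lt_0_compat; lra. }
  apply zero_on_arc with (2 := Hdelta).
  - intros z Hz. apply cdiff2_line. apply HF. simpl.
    assert (G : forall a p q : C, Cmod (a - p) < r / 3 -> Cmod (q - a) < 2 * r / 3 -> Cmod (a + z * (q - a) - p) < r).
    { intros a p q H1 H2. replace (a + z * (q - a) - p)%C with ((a - p) + z * (q - a))%C by ring.
      eapply Rle_lt_trans; [apply Cmod_triangle|]. rewrite Cmod_mult.
      assert (H3 := Cmod_ge_0 z). assert (H4 := Cmod_ge_0 (q - a)). nra. }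
    split; now apply G.
  - intros y Hy. unfold f.
    assert (Hy1 := Rlt_le_trans _ _ _ (proj2 Hy) (Rmin_l _ _)).
    assert (Hy2 := Rlt_le_trans _ _ _ (proj2 Hy) (Rmin_r _ _)).
    assert (Hc : Cmod (Cexp (Ci * RtoC y) - 1) <= 4 * y).
    { eapply Rle_trans; [apply Cexp_minus_1_le|].
      rewrite Cmod_mult, Cmod_Ci, Cmod_R, Rabs_pos_eq, Rmult_1_l by lra.
      assert (exp y <= exp 1) by (apply exp_mono; lra). assert (H1 := exp_le_3). nra. }
    assert (Hyr : 4 * y * r < d).
    { apply (Rmult_lt_compat_l (4 * r)) in Hy2; [|lra].
      replace (4 * r * (d / (4 * r))) with d in Hy2 by (field; lra). lra. }
    assert (G : forall a q : C, Cmod (q - a) < 2 * r / 3 -> Cmod (a + Cexp (Ci * RtoC y) * (q - a) - q) < d).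
    { intros a q H. replace (a + Cexp (Ci * RtoC y) * (q - a) - q)%C with ((Cexp (Ci * RtoC y) - 1) * (q - a))%C by ring.
      rewrite Cmod_mult. eapply Rle_lt_trans; [|exact Hyr].
      apply Rmult_le_compat; try apply Cmod_ge_0; lra. }
    apply Hl; simpl; now apply G.
Qed.

(** * The identity theorem for meromorphic functions *)

Lemma holomorphic_at_box (F : C2 -> C) (p : C2) :
  holomorphic_at F p <-> exists r, 0 < r /\ forall q, in_box p r q -> cdiff2 F q.
Proof.
  unfold holomorphic_at. rewrite locally_C2. split; intros [r [Hr H]]; exists r; split; try exact Hr.
  - intros q [H1 H2]. now apply ex_filterdiff_C2, H.
  - intros q H1 H2. now apply ex_filterdiff_C2, H.
Qed.

Lemma locally_box (p : C2) (P : C2 -> Prop) :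
  locally p P <-> exists r, 0 < r /\ forall q, in_box p r q -> P q.
Proof.
  rewrite locally_C2. split; intros [r [Hr H]]; exists r; split; try exact Hr.
  - intros q [H1 H2]. now apply H.
  - intros q H1 H2. now apply H.
Qed.

Lemma in_box_center (p : C2) r : 0 < r -> in_box p r p.
Proof.
  intros Hr; split; (refine (Rle_lt_trans _ 0 _ (Req_le _ _ _) Hr); rewrite <- Cmod_0; f_equal; apply Cplus_opp_r).
Qed.

Lemma in_box_trans (p q x : C2) r s t : r + s <= t -> in_box p r q -> in_box q s x -> in_box p t x.
Proof.
  destruct p as [p1 p2], q as [q1 q2], x as [x1 x2]. intros Hrs [H1 H2] [H3 H4]; simpl in *.
  split; simpl.
  - replace (x1 - p1)%C with ((x1 - q1) + (q1 - p1))%C by ring.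
    eapply Rle_lt_trans; [apply Cmod_triangle|]. lra.
  - replace (x2 - p2)%C with ((x2 - q2) + (q2 - p2))%C by ring.
    eapply Rle_lt_trans; [apply Cmod_triangle|]. lra.
Qed.

Lemma in_box_open (p q : C2) r : in_box p r q -> exists s, 0 < s /\ forall x, in_box q s x -> in_box p r x.
Proof.
  intros [H1 H2]. set (a := Rmax (Cmod (fst q - fst p)) (Cmod (snd q - snd p))).
  assert (Ha : a < r) by now apply Rmax_lub_lt.
  assert (A1 := Rmax_l (Cmod (fst q - fst p)) (Cmod (snd q - snd p))).
  assert (A2 := Rmax_r (Cmod (fst q - fst p)) (Cmod (snd q - snd p))). fold a in A1, A2.
  exists ((r - a) / 2). split; [lra|]. intros x Hx.
  apply (in_box_trans p q x ((a + r) / 2) ((r - a) / 2)); [lra | split; lra | exact Hx].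
Qed.

Lemma in_box_le (p q : C2) r s : r <= s -> in_box p r q -> in_box p s q.
Proof. intros H [H1 H2]; split; lra. Qed.

Lemma cdiff2_box (F : C2 -> C) (p : C2) : cdiff2 F p ->
  forall e, 0 < e -> exists r, 0 < r /\ forall q, in_box p r q -> Cmod (F q - F p) < e.
Proof.
  intros H e He. destruct (cdiff2_cont F p H e He) as [d [Hd H1]].
  exists d; split; [exact Hd|]. destruct p as [p1 p2]. intros [q1 q2] [Hq1 Hq2]. simpl in *.
  assert (X : forall a b : C, (a + (b - a))%C = b) by (intros; ring).
  specialize (H1 _ _ Hq1 Hq2). rewrite (X p1 q1), (X p2 q2) in H1. exact H1.
Qed.

Lemma cdiff2_nonzero_near (F : C2 -> C) (p : C2) : cdiff2 F p -> F p <> RtoC 0 ->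
  exists r, 0 < r /\ forall q, in_box p r q -> F q <> RtoC 0.
Proof.
  intros H Hn. apply Cmod_gt_0 in Hn. destruct (cdiff2_box F p H _ Hn) as [r [Hr H1]].
  exists r; split; [exact Hr|]. intros q Hq E. specialize (H1 q Hq).
  rewrite E in H1. replace (RtoC 0 - F p)%C with (- F p)%C in H1 by ring. rewrite Cmod_opp in H1. lra.
Qed.

(** Connectedness of [[0, 1]], for a property that on a neighbourhood of each
    point holds everywhere or nowhere. *)
Lemma segment_connected (S : R -> Prop) :
  S 0 ->
  (forall t, 0 <= t <= 1 -> exists d, 0 < d /\ forall t1 t2, 0 <= t1 <= 1 -> 0 <= t2 <= 1 ->
     Rabs (t1 - t) < d -> Rabs (t2 - t) < d -> S t1 -> S t2) ->
  S 1.
Proof.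
  intros H0 H.
  destruct (completeness (fun t => 0 <= t <= 1 /\ forall x, 0 <= x <= t -> S x)) as [T [HU HL]].
  - exists 1. intros x [Hx _]; lra.
  - exists 0. split; [lra|]. intros x Hx. replace x with 0 by lra. exact H0.
  - assert (HT0 : 0 <= T).
    { apply HU. split; [lra|]. intros x Hx. replace x with 0 by lra. exact H0. }
    assert (HT1 : T <= 1) by (apply HL; intros x [Hx _]; lra).
    destruct (H T ltac:(lra)) as [d [Hd H1]].
    assert (Ht : exists t, T - d < t /\ t <= T /\ 0 <= t <= 1 /\ forall x, 0 <= x <= t -> S x).
    { apply NNPP. intros Hno.
      assert (T <= T - d); [|lra]. apply HL. intros x [Hx Hs]. apply Rnot_lt_le. intros Hlt.
      apply Hno. exists x. split; [exact Hlt|]. split; [apply HU; now split|]. now split. }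
    destruct Ht as [t [Ht1 [Ht2 [Ht3 Ht4]]]].
    assert (Hnear : forall x, 0 <= x <= 1 -> Rabs (x - T) < d -> S x).
    { intros x Hx Hxd. apply (H1 t x Ht3 Hx); [apply Rabs_def1; lra | exact Hxd | apply Ht4; lra]. }
    assert (HS : forall x, 0 <= x <= Rmin 1 (T + d / 2) -> S x).
    { intros x Hx. assert (R1 := Rmin_l 1 (T + d / 2)). assert (R2 := Rmin_r 1 (T + d / 2)).
      destruct (Rle_lt_dec x t) as [L|L]; [apply Ht4; lra|].
      apply Hnear; [lra|]. apply Rabs_def1; lra. }
    assert (HM : Rmin 1 (T + d / 2) <= T).
    { apply HU. split; [|exact HS]. split; [apply Rmin_glb; lra | apply Rmin_l]. }
    apply HS. unfold Rmin in *. destruct (Rle_dec 1 (T + d / 2)); lra.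
Qed.

(** The representative of a meromorphic function takes arbitrary values on its
    polar set, so an identity can only be asked for where it is holomorphic. *)
Definition agree_near (L H K : C2 -> C) (q : C2) : Prop :=
  locally q (fun x => holomorphic_at L x -> (L x * H x)%C = K x).

(** Near [p] write [L = g / h].  Since [h] vanishes on no open set, [L * H = K]
    near one point of the box forces [g * H = K * h] on an open set, hence on
    the box, hence [L * H = K] on a dense subset, and then wherever [L] is
    continuous. *)
Lemma agree_near_propagates (L H K : C2 -> C) (c : R) (p : C2) :
  meromorphic L ->
  (forall q : C2, c < Re (snd q) -> cdiff2 H q) ->
  (forall q : C2, c < Re (snd q) -> cdiff2 K q) ->
  c < Re (snd p) ->
  exists r, 0 < r /\ forall q q', in_box p r q -> in_box p r q' ->
    agree_near L H K q -> agree_near L H K q'.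
Proof.
  intros HL HH HK Hp.
  destruct (HL p) as [g [h [Hg [Hh [Hnz Hq]]]]].
  apply holomorphic_at_box in Hg, Hh. apply locally_box in Hq.
  destruct Hg as [r1 [Hr1 Hg]], Hh as [r2 [Hr2 Hh]], Hq as [r3 [Hr3 Hq]].
  set (R0 := Rmin (Rmin r1 r2) (Rmin r3 (Re (snd p) - c))).
  assert (HR0 : 0 < R0) by (unfold R0; repeat apply Rmin_glb_lt; lra).
  assert (L1 := Rmin_l (Rmin r1 r2) (Rmin r3 (Re (snd p) - c))). fold R0 in L1.
  assert (L2 := Rmin_r (Rmin r1 r2) (Rmin r3 (Re (snd p) - c))). fold R0 in L2.
  assert (L3 := Rmin_l r1 r2). assert (L4 := Rmin_r r1 r2).
  assert (L5 := Rmin_l r3 (Re (snd p) - c)). assert (L6 := Rmin_r r3 (Re (snd p) - c)).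
  assert (Bg : forall x, in_box p R0 x -> cdiff2 g x) by (intros x Hx; apply Hg, (in_box_le p x R0); [lra | exact Hx]).
  assert (Bh : forall x, in_box p R0 x -> cdiff2 h x) by (intros x Hx; apply Hh, (in_box_le p x R0); [lra | exact Hx]).
  assert (Bq : forall x, in_box p R0 x -> h x <> RtoC 0 -> L x = (g x / h x)%C)
    by (intros x Hx; apply Hq, (in_box_le p x R0); [lra | exact Hx]).
  assert (Bc : forall x, in_box p R0 x -> c < Re (snd x)).
  { intros x [_ Hx]. assert (T := Re_near _ _ _ Hx). lra. }
  clear Hg Hh Hq.
  assert (Bsub : forall x, in_box p (R0 / 3) x -> in_box p R0 x) by (intros x; apply in_box_le; lra).
  exists (R0 / 3). split; [lra|].
  (* h has a nonzero value arbitrarily near each point of the smaller box *)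
  assert (Dense : forall x, in_box p (R0 / 3) x -> forall s, 0 < s ->
     exists y, in_box x s y /\ in_box p (R0 / 3) y /\ h y <> RtoC 0).
  { intros x Hx s Hs. apply NNPP. intros Hno. apply Hnz. apply locally_box.
    exists (R0 / 3). split; [lra|]. intros y Hy. apply (identity_on_box h p x y R0); try assumption.
    destruct (in_box_open p x (R0 / 3) Hx) as [s' [Hs' Hin]].
    apply locally_box. exists (Rmin s s'). split; [now apply Rmin_glb_lt|].
    intros z Hz. apply NNPP. intros Hz0. apply Hno. exists z. repeat split; try exact Hz0.
    - apply (in_box_le x z _ _ (Rmin_l s s') Hz).
    - apply (in_box_le x z _ _ (Rmin_l s s') Hz).
    - apply Hin, (in_box_le x z _ _ (Rmin_r s s') Hz).
    - apply Hin, (in_box_le x z _ _ (Rmin_r s s') Hz). }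
  intros q q' Hq Hq' Hag.
  (* the cleared identity holds near some point, so on the whole box *)
  assert (Clear : forall x, in_box p (R0 / 3) x -> (g x * H x - K x * h x)%C = RtoC 0).
  { apply locally_box in Hag. destruct Hag as [s [Hs Hag]].
    destruct (Dense q Hq s Hs) as [y [Hy1 [Hy2 Hy3]]].
    destruct (cdiff2_nonzero_near h y (Bh y (Bsub y Hy2)) Hy3) as [s1 [Hs1 Hn1]].
    destruct (in_box_open p y (R0 / 3) Hy2) as [s2 [Hs2 Hin2]].
    destruct (in_box_open q y s Hy1) as [s3 [Hs3 Hin3]].
    set (s4 := Rmin s1 (Rmin s2 s3)).
    assert (M1 := Rmin_l s1 (Rmin s2 s3)). assert (M2 := Rmin_r s1 (Rmin s2 s3)). fold s4 in M1, M2.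
    assert (M3 := Rmin_l s2 s3). assert (M4 := Rmin_r s2 s3).
    assert (Hs4 : 0 < s4) by (repeat apply Rmin_glb_lt; assumption).
    assert (In1 : forall z, in_box y s4 z -> h z <> RtoC 0) by (intros z Hz; apply Hn1, (in_box_le y z s4); [lra | exact Hz]).
    assert (In2 : forall z, in_box y s4 z -> in_box p R0 z) by (intros z Hz; apply Bsub, Hin2, (in_box_le y z s4); [lra | exact Hz]).
    assert (In3 : forall z, in_box y s4 z -> in_box q s z) by (intros z Hz; apply Hin3, (in_box_le y z s4); [lra | exact Hz]).
    intros x Hx.
    apply (identity_on_box (fun x => g x * H x - K x * h x)%C p y x R0); try assumption.
    - intros z Hz. apply cdiff2_minus; apply cdiff2_mult; auto.
    - apply locally_box. exists s4. split; [exact Hs4|]. intros z Hz.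
      assert (HLz : holomorphic_at L z).
      { apply holomorphic_at_box. destruct (in_box_open y z s4 Hz) as [s5 [Hs5 Hin5]].
        exists s5; split; [exact Hs5|]. intros w Hw.
        apply cdiff2_eq_near with (fun w => g w * / h w)%C.
        - apply locally_box. destruct (in_box_open z w s5 Hw) as [s6 [Hs6 Hin6]].
          exists s6; split; [exact Hs6|]. intros v Hv. symmetry. apply Bq; auto.
        - apply cdiff2_mult; [auto|]. apply cdiff2_inv; auto. }
      specialize (Hag z (In3 z Hz) HLz). rewrite (Bq z (In2 z Hz) (In1 z Hz)) in Hag.
      rewrite <- Hag. field. auto. }
  apply locally_box. destruct (in_box_open p q' (R0 / 3) Hq') as [s [Hs Hin]].
  exists s; split; [exact Hs|]. intros x Hx HLx.
  (* a discrepancy at x would persist at nearby points where h is nonzero *)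
  apply NNPP. intros Hne.
  apply holomorphic_at_box in HLx. destruct HLx as [s1 [Hs1 HLx]].
  specialize (HLx x (in_box_center x s1 Hs1)).
  assert (Hxp := Hin x Hx).
  assert (Hd : cdiff2 (fun y => L y * H y - K y)%C x).
  { apply cdiff2_minus; [apply cdiff2_mult; auto | auto]. }
  destruct (cdiff2_nonzero_near _ x Hd) as [s2 [Hs2 Hn]].
  { intros E. apply Hne. now apply Ceq_minus. }
  destruct (Dense x Hxp s2 Hs2) as [y [Hy1 [Hy2 Hy3]]].
  apply (Hn y Hy1). rewrite (Bq y (Bsub y Hy2) Hy3).
  transitivity ((g y * H y - K y * h y) / h y)%C; [field; exact Hy3|].
  rewrite Clear by exact Hy2. field. exact Hy3.
Qed.

(** The half-space is convex, so the segment from [p0] to [p] stays inside. *)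
Theorem meromorphic_identity (L H K : C2 -> C) (c : R) (p0 p : C2) :
  meromorphic L ->
  (forall q : C2, c < Re (snd q) -> cdiff2 H q) ->
  (forall q : C2, c < Re (snd q) -> cdiff2 K q) ->
  c < Re (snd p0) -> c < Re (snd p) ->
  locally p0 (fun q => (L q * H q)%C = K q) ->
  agree_near L H K p.
Proof.
  intros HL HH HK Hp0 Hp Hl.
  destruct p0 as [a1 a2], p as [b1 b2]. simpl in Hp0, Hp.
  set (gamma := fun t : R => ((a1 + RtoC t * (b1 - a1))%C, (a2 + RtoC t * (b2 - a2))%C) : C2).
  assert (X1 : forall a b : C, (a + RtoC 1 * (b - a))%C = b) by (intros; ring).
  assert (X0 : forall a b : C, (a + RtoC 0 * (b - a))%C = a) by (intros; ring).
  assert (E1 : gamma 1 = (b1, b2)) by (unfold gamma; now rewrite (X1 a1 b1), (X1 a2 b2)).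
  assert (E0 : gamma 0 = (a1, a2)) by (unfold gamma; now rewrite (X0 a1 b1), (X0 a2 b2)).
  rewrite <- E1.
  apply (segment_connected (fun t => agree_near L H K (gamma t))).
  - rewrite E0. unfold agree_near. revert Hl. apply filter_imp. intros x Hx _. exact Hx.
  - intros t Ht.
    assert (Hc : c < Re (snd (gamma t))).
    { assert (Q : forall u v, c < u -> c < v -> c < u + (t * (v + - u) - 0 * (Im b2 - Im a2)))
        by (intros u v H1 H2; destruct (Rle_lt_dec u v); nra).
      exact (Q (Re a2) (Re b2) Hp0 Hp). }
    destruct (agree_near_propagates L H K c (gamma t) HL HH HK Hc) as [r [Hr Hprop]].
    set (M := Cmod (b1 - a1) + Cmod (b2 - a2) + 1).
    assert (M1 := Cmod_ge_0 (b1 - a1)). assert (M2 := Cmod_ge_0 (b2 - a2)).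
    assert (HM : 0 < M) by (unfold M; lra).
    exists (r / M). split; [now apply Rdiv_lt_0_compat|].
    assert (G : forall x, Rabs (x - t) < r / M -> in_box (gamma t) r (gamma x)).
    { intros x Hx. apply (Rmult_lt_compat_r M) in Hx; [|exact HM].
      replace (r / M * M) with r in Hx by (field; lra).
      assert (Q := Rabs_pos (x - t)).
      assert (X : forall a b : C, Cmod (b - a) <= M -> Cmod (a + RtoC x * (b - a) - (a + RtoC t * (b - a))) < r).
      { intros a b Hab. replace (a + RtoC x * (b - a) - (a + RtoC t * (b - a)))%C with (RtoC (x - t) * (b - a))%C
          by (apply C_ext; simpl; ring).
        rewrite Cmod_mult, Cmod_R. eapply Rle_lt_trans; [|exact Hx]. now apply Rmult_le_compat_l. }
      split; apply X; unfold M; lra. }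
    intros t1 t2 _ _ H1 H2. apply Hprop; now apply G.
Qed.

(** * Complex series *)

Lemma sum_n_Re_Im (u : nat -> C) n :
  sum_n u n = (sum_n (fun k => Re (u k)) n, sum_n (fun k => Im (u k)) n).
Proof.
  induction n as [|n IH].
  - rewrite !sum_O. now destruct (u O).
  - rewrite !sum_Sn, IH. reflexivity.
Qed.

Lemma is_series_Re_Im (u : nat -> C) (l : C) :
  is_series u l <-> is_series (fun n => Re (u n)) (Re l) /\ is_series (fun n => Im (u n)) (Im l).
Proof.
  split.
  - intros H; split; intros P [e HP].
    + specialize (H (fun z => ball l e z) (locally_ball _ e)).
      destruct H as [M HM]. exists M. intros n Hn. apply HP.
      specialize (HM n Hn). rewrite sum_n_Re_Im in HM. exact (proj1 HM).
    + specialize (H (fun z => ball l e z) (locally_ball _ e)).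
      destruct H as [M HM]. exists M. intros n Hn. apply HP.
      specialize (HM n Hn). rewrite sum_n_Re_Im in HM. exact (proj2 HM).
  - intros [H1 H2] P [e HP].
    destruct (H1 (fun z => ball (Re l) e z) (locally_ball _ e)) as [M1 HM1].
    destruct (H2 (fun z => ball (Im l) e z) (locally_ball _ e)) as [M2 HM2].
    exists (max M1 M2). intros n Hn. apply HP. rewrite sum_n_Re_Im.
    split; [apply HM1; lia | apply HM2; lia].
Qed.

Lemma CSeries_unique (u : nat -> C) (l : C) : is_series u l -> CSeries u = l.
Proof.
  intros H. apply is_series_Re_Im in H. destruct H as [H1 H2]. unfold CSeries.
  rewrite (is_series_unique _ _ H1), (is_series_unique _ _ H2). now destruct l.
Qed.

Lemma Cmod_sum_n_le (u : nat -> C) (M : nat -> R) n :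
  (forall k, Cmod (u k) <= M k) -> Cmod (sum_n u n) <= sum_n M n.
Proof.
  intros H. induction n as [|n IH].
  - rewrite !sum_O. apply H.
  - rewrite !sum_Sn. eapply Rle_trans; [apply Cmod_triangle|]. now apply Rplus_le_compat.
Qed.

Lemma is_series_eps (u : nat -> C) (l : C) : is_series u l ->
  forall e, 0 < e -> exists n0, forall n, (n0 <= n)%nat -> Cmod (sum_n u n - l) < e.
Proof.
  intros H e He. assert (He2 : 0 < e / 2) by lra.
  destruct (H (fun z => ball l (mkposreal _ He2) z) (locally_ball _ _)) as [n0 Hn].
  exists n0. intros n Hn0. specialize (Hn n Hn0). apply Cmod_ball_C in Hn.
  eapply Rlt_le_trans; [exact Hn|]. simpl. lra.
Qed.

Lemma sum_n_le_Series (M : nat -> R) n : (forall k, 0 <= M k) -> ex_series M -> sum_n M n <= Series M.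
Proof.
  intros Hp Hs. rewrite sum_n_Reals. apply sum_incr; [|exact Hp].
  apply is_lim_seq_Reals. assert (H := Series_correct _ Hs).
  apply is_lim_seq_ext with (2 := H). intros k. apply sum_n_Reals.
Qed.

Lemma Cseries_dominated (u : nat -> C) (M : nat -> R) :
  (forall k, Cmod (u k) <= M k) -> ex_series M ->
  is_series u (CSeries u) /\ Cmod (CSeries u) <= Series M.
Proof.
  intros H HM.
  assert (Hs : is_series u (CSeries u)).
  { apply is_series_Re_Im; split.
    - apply (Series_correct (fun n => Re (u n))). apply (ex_series_le (K := R_AbsRing) (V := R_CompleteNormedModule) _ M); [|exact HM].
      intros n. eapply Rle_trans; [apply re_le_Cmod | apply H].
    - apply (Series_correct (fun n => Im (u n))). apply (ex_series_le (K := R_AbsRing) (V := R_CompleteNormedModule) _ M); [|exact HM].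
      intros n. eapply Rle_trans; [apply im_le_Cmod | apply H]. }
  split; [exact Hs|].
  apply Rle_plus_epsilon. intros e He.
  destruct (is_series_eps u _ Hs e He) as [n0 Hn]. specialize (Hn n0 (Nat.le_refl _)).
  assert (X : forall a b : C, b = (a - (a - b))%C) by (intros; ring).
  rewrite (X (sum_n u n0) (CSeries u)).
  eapply Rle_trans; [apply Cmod_triangle_minus|]. apply Rplus_le_compat; [|lra].
  eapply Rle_trans; [now apply Cmod_sum_n_le|]. apply sum_n_le_Series; [|exact HM].
  intros k. eapply Rle_trans; [apply Cmod_ge_0 | apply H].
Qed.

Lemma is_series_Cmult (u : nat -> C) (l c : C) : is_series u l -> is_series (fun n => c * u n)%C (c * l)%C.
Proof. intros H. exact (is_series_scal c u l H). Qed.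

Lemma is_series_Cplus (u v : nat -> C) (l m : C) :
  is_series u l -> is_series v m -> is_series (fun n => u n + v n)%C (l + m)%C.
Proof. intros H H'. exact (is_series_plus u v l m H H'). Qed.

Lemma is_series_bounded (u : nat -> C) (l : C) : is_series u l -> exists M, 0 <= M /\ forall n, Cmod (u n) <= M.
Proof.
  intros H. apply is_series_Re_Im in H. destruct H as [H1 H2].
  assert (B : forall v : nat -> R, ex_series v -> exists M, forall n, Rabs (v n) <= M).
  { intros v Hv. apply ex_series_lim_0 in Hv. apply is_lim_seq_Reals in Hv.
    destruct (maj_by_pos v) as [M [_ HM]]; [now exists 0 | now exists M]. }
  destruct (B _ (ex_intro _ _ H1)) as [M1 HM1]. destruct (B _ (ex_intro _ _ H2)) as [M2 HM2].
  exists (M1 + M2). split.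
  - specialize (HM1 O). specialize (HM2 O). assert (Q1 := Rabs_pos (Re (u O))). assert (Q2 := Rabs_pos (Im (u O))). lra.
  - intros n. eapply Rle_trans; [apply Cmod_le_Re_Im|]. now apply Rplus_le_compat.
Qed.

(** * Fourier expansions at the cusps *)

Lemma Cmod_expansion_term (w n : nat) (b : C) (tau : C) :
  Cmod (b * Cexp (RtoC (2 * PI * INR n / INR w) * Ci * tau)) =
  Cmod b * exp (- (2 * PI / INR w) * Im tau * INR n).
Proof.
  rewrite Cmod_mult, Cmod_Cexp. do 2 f_equal.
  simpl. unfold Re, Im, Rdiv. simpl. ring.
Qed.

(** Convergence at height [y0 / 2] bounds the coefficients; for [y >= y0] the
    bound is a geometric sequence with ratio below 1. *)
Lemma expansion_majorant (w : nat) (b : nat -> C) (F : C -> C) (y0 : R) :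
  0 < y0 -> cuspidal_expansion w b F ->
  exists M, 0 <= M /\ forall y n,
    Cmod (b (S n)) * exp (- (2 * PI / INR w) * y * INR (S n))
      <= M * exp (- (2 * PI / INR w) * (y - y0 / 2)) ^ S n.
Proof.
  intros Hy HF. set (al := 2 * PI / INR w).
  destruct (is_series_bounded _ _ (HF (0, y0 / 2) ltac:(unfold upper_half_plane; simpl; lra))) as [M [HM0 HM]].
  exists M. split; [exact HM0|]. intros y n.
  specialize (HM n). rewrite Cmod_expansion_term in HM. fold al in HM. simpl (Im _) in HM.
  set (r := exp (- al * (y - y0 / 2))).
  replace (exp (- al * y * INR (S n))) with (exp (- al * (y0 / 2) * INR (S n)) * r ^ S n).
  - rewrite <- Rmult_assoc. apply Rmult_le_compat_r; [apply pow_le, Rlt_le, exp_pos | exact HM].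
  - unfold r. rewrite <- Rpower_pow by apply exp_pos. unfold Rpower. rewrite ln_exp, <- exp_plus. f_equal. field.
Qed.

Lemma cuspidal_expansion_bound (w : nat) (b : nat -> C) (F : C -> C) (y0 : R) :
  (1 <= w)%nat -> 0 < y0 -> cuspidal_expansion w b F ->
  exists M, 0 <= M /\ forall tau, y0 <= Im tau -> Cmod (F tau) <= M * exp (- (2 * PI / INR w) * Im tau).
Proof.
  intros Hw Hy HF. assert (HPI := PI_RGT_0).
  destruct (expansion_majorant w b F y0 Hy HF) as [M [HM0 HM]].
  assert (Hw0 : 0 < INR w) by (apply lt_0_INR; lia).
  set (al := 2 * PI / INR w) in *. assert (Hal : 0 < al) by (apply Rdiv_lt_0_compat; lra).
  set (r0 := exp (- al * (y0 / 2))).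
  assert (Hr0 : 0 < r0 < 1).
  { split; [apply exp_pos|]. rewrite <- exp_0. apply exp_increasing. nra. }
  exists (M * / r0 * / (1 - r0)). split.
  { apply Rmult_le_pos; [apply Rmult_le_pos; [lra|]|]; apply Rlt_le, Rinv_0_lt_compat; lra. }
  intros tau Htau.
  set (r := exp (- al * (Im tau - y0 / 2))).
  assert (Hr : 0 < r <= r0).
  { split; [apply exp_pos|]. apply exp_mono. nra. }
  assert (HT : forall n, Cmod (b (S n) * Cexp (RtoC (2 * PI * INR (S n) / INR w) * Ci * tau)) <= M * r * r ^ n).
  { intros n. rewrite Cmod_expansion_term. fold al. rewrite (Rmult_assoc M). exact (HM (Im tau) n). }
  assert (Hgeo : is_series (fun n => M * r * r ^ n) (M * r * / (1 - r))).
  { apply (is_series_scal (M * r) (fun n => r ^ n) (/ (1 - r))). apply is_series_geom. rewrite Rabs_pos_eq; lra. }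
  destruct (Cseries_dominated _ _ HT (ex_intro _ _ Hgeo)) as [Hs Hle].
  rewrite (CSeries_unique _ _ (HF tau ltac:(unfold upper_half_plane; lra))) in Hle.
  rewrite (is_series_unique _ _ Hgeo) in Hle.
  eapply Rle_trans; [exact Hle|].
  replace (exp (- al * Im tau)) with (r * r0) by (unfold r, r0; rewrite <- exp_plus; f_equal; field).
  replace (M * / r0 * / (1 - r0) * (r * r0)) with (M * r * / (1 - r0)) by (field; lra).
  apply Rmult_le_compat_l; [apply Rmult_le_pos; lra|]. apply Rinv_le_contravar; lra.
Qed.

(** * Modular transformations *)

Definition auto_factor (g : SL2Z) (tau : C) : C := (ZtoC (mc g) * tau + ZtoC (md g))%C.

Definition moebius (g : SL2Z) (tau : C) : C :=
  ((ZtoC (ma g) * tau + ZtoC (mb g)) / auto_factor g tau)%C.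

Definition sl_mul (g h : SL2Z) : SL2Z.
Proof.
  refine (mkSL2Z (ma g * ma h + mb g * mc h) (ma g * mb h + mb g * md h)
                 (mc g * ma h + md g * mc h) (mc g * mb h + md g * md h) _).
  assert (Hg := SL2Z_det g). assert (Hh := SL2Z_det h).
  transitivity ((ma g * md g - mb g * mc g) * (ma h * md h - mb h * mc h))%Z; [ring|].
  now rewrite Hg, Hh.
Defined.

Definition sl_inv (g : SL2Z) : SL2Z.
Proof.
  refine (mkSL2Z (md g) (- mb g) (- mc g) (ma g) _).
  rewrite <- (SL2Z_det g). ring.
Defined.

Definition sl_T (n : Z) : SL2Z.
Proof. refine (mkSL2Z 1 n 0 1 _). ring. Defined.

Definition sl_S : SL2Z.
Proof. refine (mkSL2Z 0 (-1) 1 0 _). ring. Defined.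

Lemma auto_factor_Re_Im (g : SL2Z) (tau : C) :
  Re (auto_factor g tau) = IZR (mc g) * Re tau + IZR (md g) /\
  Im (auto_factor g tau) = IZR (mc g) * Im tau.
Proof. split; unfold auto_factor, ZtoC, Re, Im; simpl; ring. Qed.

Lemma auto_factor_ge (g : SL2Z) (tau : C) (m : R) :
  m <= 1 -> m <= Im tau -> 0 < Im tau -> m <= Cmod (auto_factor g tau).
Proof.
  intros Hm1 Hm2 Ht. destruct (auto_factor_Re_Im g tau) as [E1 E2].
  assert (HZ : forall z : Z, z <> 0%Z -> 1 <= Rabs (IZR z)).
  { intros z Hz. rewrite <- abs_IZR. apply IZR_le. lia. }
  destruct (Z.eq_dec (mc g) 0) as [H0|H0].
  - assert (Hd : md g <> 0%Z) by (assert (D := SL2Z_det g); intros E; rewrite H0, E in D; lia).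
    eapply Rle_trans; [|apply re_le_Cmod]. rewrite E1, H0, Rmult_0_l, Rplus_0_l.
    specialize (HZ _ Hd). lra.
  - eapply Rle_trans; [|apply im_le_Cmod]. rewrite E2, Rabs_mult, (Rabs_pos_eq (Im tau)) by lra.
    specialize (HZ _ H0). nra.
Qed.

Lemma auto_factor_pos (g : SL2Z) (tau : C) : upper_half_plane tau -> 0 < Cmod (auto_factor g tau).
Proof.
  intros H. unfold upper_half_plane in H.
  apply Rlt_le_trans with (Rmin 1 (Im tau)); [apply Rmin_glb_lt; lra|].
  apply auto_factor_ge; [apply Rmin_l | apply Rmin_r | exact H].
Qed.

Lemma auto_factor_neq_0 (g : SL2Z) (tau : C) : upper_half_plane tau -> auto_factor g tau <> RtoC 0.
Proof. intros H. apply Cmod_gt_0. now apply auto_factor_pos. Qed.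

Lemma Im_div (z w : C) : w <> RtoC 0 -> Im (z / w) = (Im z * Re w - Re z * Im w) / Cmod w ^ 2.
Proof.
  intros Hw. apply Cmod_gt_0 in Hw.
  assert (Q : 0 < Cmod w ^ 2) by (apply pow_lt; exact Hw).
  rewrite Cmod2_alt in *. unfold Cdiv, Cinv, Im, Re in *. simpl in *. field. 
  lra.
Qed.

Lemma Im_moebius (g : SL2Z) (tau : C) : upper_half_plane tau ->
  Im (moebius g tau) = Im tau / Cmod (auto_factor g tau) ^ 2.
Proof.
  intros H. unfold moebius. rewrite Im_div by now apply auto_factor_neq_0.
  f_equal. destruct (auto_factor_Re_Im g tau) as [-> ->].
  assert (D : IZR (ma g) * IZR (md g) - IZR (mb g) * IZR (mc g) = 1).
  { rewrite <- !mult_IZR, <- minus_IZR, SL2Z_det. reflexivity. }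
  transitivity (Im tau * (IZR (ma g) * IZR (md g) - IZR (mb g) * IZR (mc g))); [|rewrite D; ring].
  unfold ZtoC, Re, Im; simpl; ring.
Qed.

Lemma moebius_upper (g : SL2Z) (tau : C) : upper_half_plane tau -> upper_half_plane (moebius g tau).
Proof.
  intros H. unfold upper_half_plane. rewrite Im_moebius by exact H.
  apply Rdiv_lt_0_compat; [exact H|]. apply pow_lt. now apply auto_factor_pos.
Qed.

Lemma ZtoC_plus (x y : Z) : ZtoC (x + y) = (ZtoC x + ZtoC y)%C.
Proof. unfold ZtoC. now rewrite plus_IZR, RtoC_plus. Qed.

Lemma ZtoC_mult (x y : Z) : ZtoC (x * y) = (ZtoC x * ZtoC y)%C.
Proof. unfold ZtoC. now rewrite mult_IZR, RtoC_mult. Qed.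

Lemma auto_factor_mul (g h : SL2Z) (tau : C) : upper_half_plane tau ->
  auto_factor (sl_mul g h) tau = (auto_factor g (moebius h tau) * auto_factor h tau)%C.
Proof.
  intros H. assert (Hn := auto_factor_neq_0 h tau H). unfold moebius.
  unfold auto_factor at 1 2. simpl. rewrite !ZtoC_plus, !ZtoC_mult.
  transitivity (ZtoC (mc g) * (ZtoC (ma h) * tau + ZtoC (mb h)) + ZtoC (md g) * auto_factor h tau)%C.
  - unfold auto_factor; ring.
  - field. exact Hn.
Qed.

Lemma moebius_mul (g h : SL2Z) (tau : C) : upper_half_plane tau ->
  moebius (sl_mul g h) tau = moebius g (moebius h tau).
Proof.
  intros H. assert (Hn := auto_factor_neq_0 h tau H).
  assert (Hn2 := auto_factor_neq_0 g _ (moebius_upper h tau H)).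
  unfold moebius at 1 2. rewrite auto_factor_mul by exact H.
  replace (ZtoC (ma (sl_mul g h)) * tau + ZtoC (mb (sl_mul g h)))%C with
    ((ZtoC (ma g) * moebius h tau + ZtoC (mb g)) * auto_factor h tau)%C.
  - field. split; assumption.
  - simpl. rewrite !ZtoC_plus, !ZtoC_mult.
    transitivity (ZtoC (ma g) * (ZtoC (ma h) * tau + ZtoC (mb h)) + ZtoC (mb g) * auto_factor h tau)%C.
    + unfold moebius. field. exact Hn.
    + unfold auto_factor; ring.
Qed.

Lemma slash_eq (k : nat) (g : SL2Z) (f : C -> C) (tau : C) :
  slash k g f tau = (f (moebius g tau) / auto_factor g tau ^ k)%C.
Proof. reflexivity. Qed.

Lemma slash_mul (k : nat) (g h : SL2Z) (f : C -> C) (tau : C) : upper_half_plane tau ->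
  slash k (sl_mul g h) f tau = slash k h (slash k g f) tau.
Proof.
  intros H. rewrite !slash_eq, moebius_mul, auto_factor_mul by exact H.
  rewrite Cpow_mult_l. field. 
  split; apply Cpow_nz; apply auto_factor_neq_0; first [exact H | apply moebius_upper; exact H].
Qed.

Lemma slash_ext (k : nat) (g h : SL2Z) (f : C -> C) (tau : C) :
  ma g = ma h -> mb g = mb h -> mc g = mc h -> md g = md h ->
  slash k g f tau = slash k h f tau.
Proof. intros H1 H2 H3 H4. unfold slash. now rewrite H1, H2, H3, H4. Qed.

(** The lower left entry of [g g'^-1] is [c d' - d c'], which [N] divides when the
    bottom rows are congruent. *)
Lemma slash_same_class (N k : nat) (f : C -> C) (g g' : SL2Z) (tau : C) :
  (forall h, Gamma0 N h -> forall tau, upper_half_plane tau -> slash k h f tau = f tau) ->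
  (1 <= N)%nat -> upper_half_plane tau ->
  (mc g mod Z.of_nat N = mc g' mod Z.of_nat N)%Z -> (md g mod Z.of_nat N = md g' mod Z.of_nat N)%Z ->
  slash k g f tau = slash k g' f tau.
Proof.
  intros Hf HN Ht Hc Hd.
  assert (D := SL2Z_det g').
  rewrite (slash_ext k g (sl_mul (sl_mul g (sl_inv g')) g')).
  - rewrite slash_mul by exact Ht. rewrite !(slash_eq k g').
    rewrite Hf; [reflexivity | | now apply moebius_upper].
    unfold Gamma0. simpl. apply Z.mod_divide; [lia|].
    replace (mc g * md g' + md g * - mc g')%Z with (mc g * md g' - md g * mc g')%Z by ring.
    rewrite Zminus_mod, (Zmult_mod (mc g)), (Zmult_mod (md g)), Hc, Hd, <- !Zmult_mod, <- Zminus_mod.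
    rewrite (Z.mul_comm (md g')), Z.sub_diag. reflexivity.
  - simpl. transitivity (ma g * (ma g' * md g' - mb g' * mc g'))%Z; [rewrite D|]; ring.
  - simpl. transitivity (mb g * (ma g' * md g' - mb g' * mc g'))%Z; [rewrite D|]; ring.
  - simpl. transitivity (mc g * (ma g' * md g' - mb g' * mc g'))%Z; [rewrite D|]; ring.
  - simpl. transitivity (md g * (ma g' * md g' - mb g' * mc g'))%Z; [rewrite D|]; ring.
Qed.

Lemma uniform_bound (P : nat -> R -> Prop) :
  (forall i x y, x <= y -> P i x -> P i y) -> (forall i, exists x, P i x) ->
  forall n, exists x, 0 <= x /\ forall i, (i < n)%nat -> P i x.
Proof.
  intros Hm He n. induction n as [|n [x [Hx IH]]].
  - exists 0. split; [lra | lia].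
  - destruct (He n) as [y Hy]. exists (Rmax x y).
    assert (L1 := Rmax_l x y). assert (L2 := Rmax_r x y).
    split; [lra|]. intros i Hi. destruct (Nat.eq_dec i n) as [->|Hne].
    + now apply Hm with y.
    + apply Hm with x; [exact L1 | apply IH; lia].
Qed.

(** Each [f|g] is bounded high in the half-plane by its expansion, and there are
    at most [N^2] classes of bottom rows. *)
Lemma slash_uniform_bound (N k : nat) (f : C -> C) : (1 <= N)%nat -> cusp_form N k f ->
  exists M, 0 <= M /\ forall g tau, / 2 <= Im tau -> Cmod (slash k g f tau) <= M.
Proof.
  intros HN [_ [Hinv Hexp]].
  assert (HNz : (0 < Z.of_nat N)%Z) by lia.
  set (P i j x := forall g, (mc g mod Z.of_nat N = Z.of_nat i)%Z -> (md g mod Z.of_nat N = Z.of_nat j)%Z ->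
     forall tau, / 2 <= Im tau -> Cmod (slash k g f tau) <= x).
  assert (H1 : forall i j, exists x, P i j x).
  { intros i j.
    destruct (classic (exists g0, (mc g0 mod Z.of_nat N = Z.of_nat i)%Z /\ (md g0 mod Z.of_nat N = Z.of_nat j)%Z)) as [[g0 [E1 E2]]|Hno].
    - destruct (Hexp g0) as [b Hb].
      destruct (cuspidal_expansion_bound N b _ (/ 2) HN ltac:(lra) Hb) as [M [HM0 HM]].
      exists M. intros g E3 E4 tau Htau.
      rewrite (slash_same_class N k f g g0 tau Hinv HN); [| unfold upper_half_plane; lra | congruence | congruence].
      eapply Rle_trans; [now apply HM|]. rewrite <- (Rmult_1_r M) at 2.
      apply Rmult_le_compat_l; [exact HM0|]. rewrite <- exp_0. apply exp_mono.
      assert (0 < 2 * PI / INR N) by (apply Rdiv_lt_0_compat; [assert (Q := PI_RGT_0); lra | apply lt_0_INR; lia]).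
      nra.
    - exists 0. intros g E1 E2. elim Hno. now exists g. }
  destruct (uniform_bound (fun i x => forall j, (j < N)%nat -> P i j x)) with (n := N) as [M [HM0 HM]].
  - intros i x y Hxy HP j Hj g E1 E2 tau Ht. eapply Rle_trans; [|exact Hxy]. now apply (HP j Hj).
  - intros i. destruct (uniform_bound (P i)) with (n := N) as [x [_ Hx]].
    + intros j x y Hxy HP g E1 E2 tau Ht. eapply Rle_trans; [|exact Hxy]. now apply HP.
    + apply H1.
    + now exists x.
  - exists M. split; [exact HM0|]. intros g tau Ht.
    assert (B1 := Z.mod_pos_bound (mc g) (Z.of_nat N) HNz). assert (B2 := Z.mod_pos_bound (md g) (Z.of_nat N) HNz).
    apply (HM (Z.to_nat (mc g mod Z.of_nat N)) ltac:(lia) (Z.to_nat (md g mod Z.of_nat N)) ltac:(lia)); [| |exact Ht].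
    + rewrite Z2Nat.id; lia.
    + rewrite Z2Nat.id; lia.
Qed.

(** Reduction theory: a point of the orbit of [tau] of nearly maximal height,
    moved to the strip [|Re| <= 1/2] by a translation, cannot lie far inside
    the unit circle, since inversion would raise it. *)
Lemma orbit_high_point (tau : C) : upper_half_plane tau -> exists g, / 2 <= Im (moebius g tau).
Proof.
  intros Ht. unfold upper_half_plane in Ht.
  set (m := Rmin 1 (Im tau)). assert (Hm : 0 < m) by (apply Rmin_glb_lt; lra).
  assert (Hup : forall g, Im (moebius g tau) <= Im tau / m ^ 2).
  { intros g. rewrite Im_moebius by exact Ht. apply Rmult_le_compat_l; [lra|].
    apply Rinv_le_contravar; [now apply pow_lt|]. apply pow_incr. split; [lra|].
    apply auto_factor_ge; [apply Rmin_l | apply Rmin_r | exact Ht]. }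
  destruct (completeness (fun y => exists g, y = Im (moebius g tau))) as [Y [HU HL]].
  - exists (Im tau / m ^ 2). intros y [g ->]. apply Hup.
  - exists (Im (moebius sl_S tau)). now exists sl_S.
  - assert (HY : 0 < Y).
    { apply Rlt_le_trans with (Im (moebius sl_S tau)); [now apply moebius_upper|]. apply HU. now exists sl_S. }
    assert (Hg : exists g, 9 / 10 * Y < Im (moebius g tau)).
    { apply NNPP. intros Hno. assert (Y <= 9 / 10 * Y); [|lra]. apply HL. intros y [g ->].
      apply Rnot_lt_le. intros Hlt. apply Hno. now exists g. }
    destruct Hg as [g Hg].
    set (t1 := moebius g tau) in *. assert (Ht1 : upper_half_plane t1) by now apply moebius_upper.
    set (n := (- Int_part (Re t1 + / 2))%Z).
    set (t2 := moebius (sl_T n) t1).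
    assert (E2 : t2 = (t1 + ZtoC n)%C).
    { unfold t2, moebius, auto_factor. simpl. unfold ZtoC. field. }
    assert (I2 : Im t2 = Im t1) by (rewrite E2; unfold ZtoC, Im; simpl; ring).
    assert (R2 : - / 2 <= Re t2 <= / 2).
    { rewrite E2. unfold n, ZtoC. rewrite opp_IZR. destruct (base_Int_part (Re t1 + / 2)) as [B1 B2].
      set (K := IZR (Int_part (Re t1 + / 2))) in *. change (Re (t1 + RtoC (- K))) with (Re t1 + - K). lra. }
    assert (Ht2 : upper_half_plane t2) by (unfold upper_half_plane; rewrite I2; exact Ht1).
    assert (HS : Im (moebius sl_S t2) <= Y).
    { apply HU. exists (sl_mul sl_S (sl_mul (sl_T n) g)). rewrite !moebius_mul; try assumption. reflexivity. }
    rewrite Im_moebius in HS by exact Ht2.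
    replace (auto_factor sl_S t2) with t2 in HS by (unfold auto_factor, ZtoC; simpl; ring).
    rewrite Cmod2_alt in HS. unfold upper_half_plane in Ht2.
    exists (sl_mul (sl_T n) g). rewrite moebius_mul by exact Ht. fold t1. fold t2.
    set (y := Im t2) in *. set (x := Re t2) in *.
    assert (Hxy : 0 < x ^ 2 + y ^ 2) by nra.
    apply (Rmult_le_compat_r (x ^ 2 + y ^ 2)) in HS; [|lra].
    unfold Rdiv in HS. rewrite Rmult_assoc, Rinv_l, Rmult_1_r in HS by lra.
    apply Rnot_lt_le. intros Hlow. rewrite <- I2 in Hg. fold y in Hg.
    assert (x ^ 2 <= / 4) by nra. assert (y ^ 2 <= / 4) by nra. nra.
Qed.

(** The value at [tau] is that of [f|g^-1] at a high point [g tau] of the orbit,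
    divided by [(c tau + d)^k], and [|c tau + d| >= Im tau]. *)
Theorem cusp_form_polynomial_bound (N k : nat) (f : C -> C) : (1 <= N)%nat -> cusp_form N k f ->
  exists M, 0 <= M /\ forall tau, 0 < Im tau <= 1 -> Cmod (f tau) <= M / Im tau ^ k.
Proof.
  intros HN Hf. destruct (slash_uniform_bound N k f HN Hf) as [M [HM0 HM]].
  exists M. split; [exact HM0|]. intros tau [Ht Ht1].
  destruct (orbit_high_point tau Ht) as [g Hg].
  assert (E : f tau = (slash k (sl_inv g) f (moebius g tau) / auto_factor g tau ^ k)%C).
  { rewrite <- (slash_eq k g (slash k (sl_inv g) f)), <- slash_mul by exact Ht.
    rewrite (slash_ext k (sl_mul (sl_inv g) g) (sl_T 0)).
    - rewrite slash_eq. unfold moebius, auto_factor. simpl. unfold ZtoC.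
      replace (RtoC 0 * tau + RtoC 1)%C with (RtoC 1) by ring. rewrite Cpow_1_l.
      replace ((RtoC 1 * tau + RtoC 0) / RtoC 1)%C with tau by field.
      field.
    - simpl. rewrite <- (SL2Z_det g). ring.
    - simpl. ring.
    - simpl. ring.
    - simpl. rewrite <- (SL2Z_det g). ring. }
  assert (Hj := auto_factor_pos g tau Ht).
  rewrite E, Cmod_div, Cmod_pow by (apply Cpow_nz; now apply auto_factor_neq_0).
  apply Rmult_le_compat.
  - apply Cmod_ge_0.
  - apply Rlt_le, Rinv_0_lt_compat, pow_lt, Hj.
  - now apply HM.
  - apply Rinv_le_contravar; [now apply pow_lt|]. apply pow_incr. split; [lra|].
    apply auto_factor_ge; lra.
Qed.

(** * Coefficients and decay of a cusp form *)

Lemma ex_derive_C_cont (f : C -> C) (z : C) : ex_derive f z ->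
  forall e, 0 < e -> exists d, 0 < d /\ forall w, Cmod (w - z) < d -> Cmod (f w - f z) < e.
Proof.
  intros H e He. apply ex_derive_continuous in H.
  assert (He2 : 0 < e / 2) by lra.
  destruct (H (fun w => ball (f z) (mkposreal _ He2) w) (locally_ball _ _)) as [d Hd].
  exists d; split; [apply cond_pos|]. intros w Hw. specialize (Hd w Hw).
  apply Cmod_ball_C in Hd. eapply Rlt_le_trans; [exact Hd|]. simpl; lra.
Qed.

(** The character [x -> e^{2 pi i m x}]. *)
Definition fchar (m x : R) : C := Cexp (RtoC x * (Ci * RtoC (2 * PI * m))).

Lemma fchar_cis_derive m x : cis_derive (fchar m) x (Ci * RtoC (2 * PI * m) * fchar m x)%C.
Proof. apply (cis_derive_Cexp (fun x => RtoC x * (Ci * RtoC (2 * PI * m)))%C), cis_derive_lin. Qed.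

Lemma fchar_cont m x : continuous (fchar m) x.
Proof. eapply cis_derive_cont, fchar_cis_derive. Qed.

Lemma Cmod_fchar m x : Cmod (fchar m x) = 1.
Proof.
  unfold fchar. rewrite Cmod_Cexp. rewrite <- exp_0. f_equal. rewrite re_scal_l. simpl. ring.
Qed.

Lemma fchar_plus m m' x : fchar (m + m') x = (fchar m x * fchar m' x)%C.
Proof. unfold fchar. rewrite <- Cexp_plus. f_equal. apply C_ext; simpl; ring. Qed.

Lemma fchar_nat_1 n : fchar (INR n) 1 = RtoC 1.
Proof.
  induction n as [|n IH].
  - unfold fchar. rewrite <- Cexp_0. f_equal. apply C_ext; simpl; ring.
  - rewrite S_INR, fchar_plus, IH. unfold fchar.
    replace (RtoC 1 * (Ci * RtoC (2 * PI * 1)))%C with (Ci * RtoC (0 + 2 * PI))%C by (apply C_ext; simpl; ring).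
    rewrite Cexp_2PI, Cexp_Ci, cos_0, sin_0. apply C_ext; simpl; ring.
Qed.

Lemma fchar_opp_nat_1 n : fchar (- INR n) 1 = RtoC 1.
Proof.
  assert (E : fchar (INR n + - INR n) 1 = RtoC 1).
  { rewrite Rplus_opp_r. exact (fchar_nat_1 0). }
  rewrite fchar_plus, fchar_nat_1, Cmult_1_l in E. exact E.
Qed.

Lemma cint_fchar (k n : nat) : cint (fchar (INR k - INR n)) 0 1 = if Nat.eq_dec k n then RtoC 1 else RtoC 0.
Proof.
  assert (HPI := PI_RGT_0).
  destruct (Nat.eq_dec k n) as [->|Hne].
  - rewrite Rminus_diag.
    rewrite (cint_ext _ (fun x => 1 + RtoC x * 0)%C).
    + rewrite cint_affine by lra. apply C_ext; simpl; field.
    + lra.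
    + intros x _. unfold fchar. rewrite Rmult_0_r, !Cmult_0_r, Cexp_0. ring.
  - set (m := INR k - INR n). assert (Hm : m <> 0) by (unfold m; intros E; apply Hne, INR_eq; lra).
    set (c := (Ci * RtoC (2 * PI * m))%C).
    assert (Hc : c <> RtoC 0).
    { unfold c. apply Cmult_neq_0; [apply Ci_nz|]. intros E. apply RtoC_inj in E.
      apply Rmult_integral in E. destruct E; [lra | contradiction]. }
    assert (E := cint_derive (fchar m) (fun x => c * fchar m x)%C 0 1 ltac:(lra)
       (fun x _ => fchar_cis_derive m x)).
    rewrite cint_Cmult in E; [|lra | intros x _; apply fchar_cont].
    assert (F1 : fchar m 1 = RtoC 1).
    { unfold m, Rminus. rewrite fchar_plus, fchar_nat_1, fchar_opp_nat_1. ring. }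
    assert (F0 : fchar m 0 = RtoC 1) by (unfold fchar; rewrite Cmult_0_l; apply Cexp_0).
    rewrite F1, F0 in E.
    assert (E' : (c * cint (fchar m) 0 1)%C = RtoC 0).
    { rewrite E; [ring|]. intros x _. apply continuous_Cmult; [apply continuous_const | apply fchar_cont]. }
    apply Cmult_integral in E'. now destruct E'.
Qed.

Lemma sum_n_fchar_cont (u : nat -> C) K x :
  continuous (fun x => sum_n (fun k => u k * fchar (INR (S k)) x)%C K) x.
Proof.
  induction K as [|K IH].
  - apply (continuous_ext (fun t => u O * fchar (INR 1) t)%C); [intros t; now rewrite sum_O|].
    apply continuous_Cmult; [apply continuous_const | apply fchar_cont].
  - apply (continuous_ext (fun t => plus (sum_n (fun k => u k * fchar (INR (S k)) t)%C K)
      (u (S K) * fchar (INR (S (S K))) t)%C)); [intros t; now rewrite sum_Sn|].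
    apply (@continuous_plus R_UniformSpace R_AbsRing C_R_NormedModule); [exact IH|].
    apply continuous_Cmult; [apply continuous_const | apply fchar_cont].
Qed.

Lemma cint_fourier_sum (u : nat -> C) (n K : nat) :
  cint (fun x => sum_n (fun k => u k * fchar (INR (S k)) x) K * fchar (- INR (S n)) x)%C 0 1 =
  if le_lt_dec n K then u n else RtoC 0.
Proof.
  assert (T : forall k, cint (fun x => u k * fchar (INR (S k)) x * fchar (- INR (S n)) x)%C 0 1
     = if Nat.eq_dec k n then u n else RtoC 0).
  { intros k. rewrite (cint_ext _ (fun x => u k * fchar (INR (S k) - INR (S n)) x)%C).
    - rewrite cint_Cmult, cint_fchar; [| lra | intros x _; apply fchar_cont].
      destruct (Nat.eq_dec k n) as [->|Hne]; destruct (Nat.eq_dec _ _); try lia; ring.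
    - lra.
    - intros x _. unfold Rminus. rewrite fchar_plus. ring. }
  induction K as [|K IH].
  - rewrite (cint_ext _ (fun x => u O * fchar (INR 1) x * fchar (- INR (S n)) x)%C); [|lra | intros x _; now rewrite sum_O].
    rewrite T. destruct (Nat.eq_dec 0 n), (le_lt_dec n 0); try reflexivity; lia.
  - rewrite (cint_ext _ (fun x => sum_n (fun k => u k * fchar (INR (S k)) x) K * fchar (- INR (S n)) x
        + u (S K) * fchar (INR (S (S K))) x * fchar (- INR (S n)) x)%C).
    + rewrite cint_plus, IH, T.
      * destruct (le_lt_dec n K), (Nat.eq_dec (S K) n), (le_lt_dec n (S K)); try lia; ring.
      * lra.
      * intros x _. apply continuous_Cmult; [apply sum_n_fchar_cont | apply fchar_cont].
      * intros x _. apply continuous_Cmult; [|apply fchar_cont].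
        apply continuous_Cmult; [apply continuous_const | apply fchar_cont].
    + lra.
    + intros x _. rewrite sum_Sn. change plus with Cplus. ring.
Qed.

(** The bound depends on the majorant only, so convergence is uniform in any
    parameter. *)
Lemma dominated_tail (u : nat -> C) (M : nat -> R) (K : nat) :
  (forall k, Cmod (u k) <= M k) -> ex_series M ->
  Cmod (CSeries u - sum_n u K) <= Series M - sum_n M K.
Proof.
  intros H HM. destruct (Cseries_dominated u M H HM) as [Hs _].
  assert (Hp : forall k, 0 <= M k) by (intros k; eapply Rle_trans; [apply Cmod_ge_0 | apply H]).
  apply Rle_plus_epsilon. intros e He.
  destruct (is_series_eps u _ Hs e He) as [n0 Hn].
  assert (T : forall j, Cmod (sum_n u (K + j) - sum_n u K) <= sum_n M (K + j) - sum_n M K).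
  { induction j as [|j IH].
    - rewrite Nat.add_0_r. replace (sum_n u K - sum_n u K)%C with (RtoC 0) by (apply C_ext; simpl; ring).
      rewrite Cmod_0. lra.
    - rewrite Nat.add_succ_r, !sum_Sn. change (@plus C_AbelianMonoid) with Cplus.
      change (@plus R_AbelianMonoid) with Rplus.
      set (s := sum_n u (K + j)) in *. set (s' := sum_n u K) in *. set (w := u (S (K + j))).
      assert (X : forall a b c : C, (a + c - b)%C = ((a - b) + c)%C) by (intros; ring).
      rewrite X. eapply Rle_trans; [apply Cmod_triangle|]. specialize (H (S (K + j))). fold w in H.
      change plus with Rplus. lra. }
  specialize (T n0). specialize (Hn (K + n0)%nat ltac:(lia)).
  assert (Q := sum_n_le_Series M (K + n0) Hp HM).
  assert (X : forall a b c : C, (a - b)%C = ((c - b) - (c - a))%C) by (intros; ring).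
  rewrite (X _ _ (sum_n u (K + n0))).
  eapply Rle_trans; [apply Cmod_triangle_minus|]. lra.
Qed.

(** Cauchy's estimate: the integral of [f(x + i y) e^{-2 pi i (n+1) x}] over a
    period is [a (n+1) e^{-2 pi (n+1) y}]; integrating partial sums, with a
    uniformly small remainder, avoids exchanging integral and series. *)
Lemma fourier_coefficient_bound (a : nat -> C) (f : C -> C) (y B : R) :
  0 < y -> cuspidal_expansion 1 a f ->
  (forall x, continuous (fun t => f (t, y)) x) ->
  (forall x, Cmod (f (x, y)) <= B) ->
  forall n, Cmod (a (S n)) * exp (- (2 * PI * y) * INR (S n)) <= B.
Proof.
  intros Hy Ha Hc HB n. assert (HPI := PI_RGT_0).
  set (u := fun k => (a (S k) * RtoC (exp (- (2 * PI * y) * INR (S k))))%C).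
  assert (Eterm : forall x k, (a (S k) * Cexp (RtoC (2 * PI * INR (S k) / INR 1) * Ci * (x, y)))%C
     = (u k * fchar (INR (S k)) x)%C).
  { intros x k. unfold u, fchar. set (q := INR (S k)). rewrite <- Cexp_RtoC.
    transitivity (a (S k) * (Cexp (RtoC (- (2 * PI * y) * q)) * Cexp (RtoC x * (Ci * RtoC (2 * PI * q)))))%C; [|ring].
    rewrite <- Cexp_plus. do 2 f_equal. change (INR 1) with 1. rewrite Rdiv_1_r. apply C_ext; simpl; ring. }
  destruct (expansion_majorant 1 a f y Hy Ha) as [M [HM0 HM]].
  set (r := exp (- (2 * PI / INR 1) * (y - y / 2))) in *.
  assert (Hr : 0 < r < 1).
  { split; [apply exp_pos|]. rewrite <- exp_0. apply exp_increasing. change (INR 1) with 1. nra. }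
  set (m := fun k => M * r ^ S k).
  assert (Hm : forall k, Cmod (u k) <= m k).
  { intros k. unfold u, m. rewrite Cmod_mult, Cmod_R, Rabs_pos_eq by apply Rlt_le, exp_pos.
    eapply Rle_trans; [|apply (HM y k)]. right. do 2 f_equal. change (INR 1) with 1. field. }
  assert (Hms : ex_series m).
  { apply ex_series_ext with (fun k => (M * r) * r ^ k); [intros k; unfold m; simpl; ring|].
    exists ((M * r) * / (1 - r)). apply (is_series_scal (M * r) (fun k => r ^ k)).
    apply is_series_geom. rewrite Rabs_pos_eq; lra. }
  assert (Ef : forall x, f (x, y) = CSeries (fun k => u k * fchar (INR (S k)) x)%C).
  { intros x. symmetry. apply CSeries_unique.
    apply is_series_ext with (2 := Ha (x, y) Hy). intros k. apply Eterm. }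
  assert (Hux : forall x k, Cmod (u k * fchar (INR (S k)) x) <= m k).
  { intros x k. rewrite Cmod_mult, Cmod_fchar, Rmult_1_r. apply Hm. }
  replace (Cmod (a (S n)) * exp (- (2 * PI * y) * INR (S n))) with (Cmod (u n)).
  2: { unfold u. rewrite Cmod_mult, Cmod_R, Rabs_pos_eq by apply Rlt_le, exp_pos. reflexivity. }
  apply Rle_plus_epsilon. intros e He.
  assert (HK : exists K, (n <= K)%nat /\ Series m - sum_n m K < e).
  { destruct (Series_correct _ Hms (fun z => ball (Series m) (mkposreal e He) z) (locally_ball _ _)) as [K0 HK0].
    exists (max n K0). split; [lia|]. specialize (HK0 (max n K0) ltac:(lia)).
    change (Rabs (sum_n m (max n K0) - Series m) < e) in HK0. apply Rabs_def2 in HK0. lra. }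
  destruct HK as [K [HnK HK]].
  set (ps := fun x => sum_n (fun k => u k * fchar (INR (S k)) x)%C K).
  assert (Cps : forall x, continuous ps x) by (intros x; apply sum_n_fchar_cont).
  set (ch := fchar (- INR (S n))).
  assert (I1 := cint_fourier_sum u n K). destruct (le_lt_dec n K) as [_|L]; [|lia].
  fold ch in I1.
  assert (I2 : Cmod (cint (fun x => f (x, y) * ch x)%C 0 1) <= B * (1 - 0)).
  { apply cint_bound; [lra | |].
    - intros x _. apply continuous_Cmult; [apply Hc | apply fchar_cont].
    - intros x _. unfold ch. rewrite Cmod_mult, Cmod_fchar, Rmult_1_r. apply HB. }
  assert (I3 : Cmod (cint (fun x => (f (x, y) - ps x) * ch x)%C 0 1) <= e * (1 - 0)).
  { apply cint_bound; [lra | |].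
    - intros x _. apply continuous_Cmult; [|apply fchar_cont].
      apply (@continuous_minus R_UniformSpace R_AbsRing C_R_NormedModule); [apply Hc | apply Cps].
    - intros x _. unfold ch. rewrite Cmod_mult, Cmod_fchar, Rmult_1_r, Ef.
      eapply Rle_trans; [apply dominated_tail; [apply Hux | exact Hms]|]. lra. }
  assert (I4 : cint (fun x => (f (x, y) - ps x) * ch x)%C 0 1 = (cint (fun x => f (x, y) * ch x)%C 0 1 - u n)%C).
  { rewrite <- I1, <- cint_minus.
    - apply cint_ext; [lra|]. intros x _. unfold ps. ring.
    - lra.
    - intros x _. apply continuous_Cmult; [apply Hc | apply fchar_cont].
    - intros x _. apply continuous_Cmult; [apply Cps | apply fchar_cont]. }
  rewrite I4 in I3.
  set (c := cint (fun x => f (x, y) * ch x)%C 0 1) in *.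
  replace (u n) with (c - (c - u n))%C by ring.
  eapply Rle_trans; [apply Cmod_triangle_minus|]. lra.
Qed.

(** Hecke's argument: Cauchy's estimate at height [y = 1 / n]. *)
Theorem cusp_form_coefficient_bound (N k : nat) (f : C -> C) (a : nat -> C) :
  (1 <= N)%nat -> cusp_form N k f -> cuspidal_expansion 1 a f ->
  exists M, 0 <= M /\ forall n, Cmod (a (S n)) <= M * INR (S n) ^ k.
Proof.
  intros HN Hf Ha. assert (HPI := PI_RGT_0).
  destruct (cusp_form_polynomial_bound N k f HN Hf) as [M [HM0 HM]].
  exists (M * exp (2 * PI)). split; [apply Rmult_le_pos; [lra | apply Rlt_le, exp_pos]|].
  intros n. assert (Hn : 1 <= INR (S n)) by (rewrite S_INR; assert (H := pos_INR n); lra).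
  set (y := / INR (S n)).
  assert (Hy : 0 < y) by (apply Rinv_0_lt_compat; lra).
  assert (Hy1 : y <= 1) by (unfold y; rewrite <- Rinv_1; apply Rinv_le_contravar; lra).
  assert (H := fourier_coefficient_bound a f y (M / y ^ k) Hy Ha).
  assert (Hc : forall x, continuous (fun t => f (t, y)) x).
  { intros x. apply continuous_eps. intros e He.
    destruct (ex_derive_C_cont f (x, y) (proj1 Hf (x, y) Hy) e He) as [d [Hd Hd1]].
    exists d; split; [exact Hd|]. intros t Ht. apply Hd1.
    refine (Rle_lt_trans _ (Rabs (t - x)) _ (Req_le _ _ _) Ht).
    rewrite <- Cmod_R. apply f_equal, C_ext; simpl; ring. }
  assert (Hb := H Hc (fun x => HM (x, y) (conj Hy Hy1)) n). clear H Hc.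
  replace (- (2 * PI * y) * INR (S n)) with (- (2 * PI)) in Hb by (unfold y; field; lra).
  replace (M / y ^ k) with (M * INR (S n) ^ k) in Hb.
  2: { unfold y. rewrite pow_inv. field. apply pow_nonzero. lra. }
  apply (Rmult_le_compat_r (exp (2 * PI))) in Hb; [|apply Rlt_le, exp_pos].
  rewrite Rmult_assoc, <- exp_plus in Hb. replace (- (2 * PI) + 2 * PI) with 0 in Hb by ring.
  rewrite exp_0, Rmult_1_r in Hb. lra.
Qed.

Lemma pow_le_exp (m : nat) : exists D, 0 < D /\ forall x, 0 <= x -> x ^ m <= D * exp x.
Proof.
  destruct m as [|m].
  - exists 1. split; [lra|]. intros x Hx. simpl. rewrite Rmult_1_l, <- exp_0. now apply exp_mono.
  - assert (Hm : 0 < INR (S m)) by (apply lt_0_INR; lia).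
    exists (INR (S m) ^ S m). split; [now apply pow_lt|]. intros x Hx.
    assert (H : x <= INR (S m) * exp (x / INR (S m))).
    { assert (E := exp_ineq1_le (x / INR (S m))).
      apply (Rmult_le_compat_l (INR (S m))) in E; [|lra].
      replace (INR (S m) * (1 + x / INR (S m))) with (INR (S m) + x) in E by (field; lra). lra. }
    apply Rle_trans with ((INR (S m) * exp (x / INR (S m))) ^ S m); [apply pow_incr; lra|].
    rewrite Rpow_mult_distr. apply Rmult_le_compat_l; [apply pow_le; lra|].
    rewrite <- Rpower_pow by apply exp_pos. unfold Rpower. rewrite ln_exp. right. f_equal. field. lra.
Qed.

(** At the cusp 0, [f(i y) = (i / y)^k (f|S)(i / y)] decays like
    [e^{-c / y}], which beats every power of [y]. *)
Theorem cusp_form_rapid_decay (N k : nat) (f : C -> C) (a : nat -> C) (j : nat) :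
  (1 <= N)%nat -> cusp_form N k f -> cuspidal_expansion 1 a f ->
  exists M, 0 <= M /\ forall t, 0 < t -> Cmod (f (0, t / (2 * PI))) <= M * t ^ j * exp (- t).
Proof.
  intros HN Hf Ha. assert (HPI := PI_RGT_0).
  assert (HN0 : 0 < INR N) by (apply lt_0_INR; lia).
  destruct (cuspidal_expansion_bound 1 a f 1 ltac:(lia) ltac:(lra) Ha) as [M2 [HM20 HM2]].
  destruct (proj2 (proj2 Hf) sl_S) as [b Hb].
  destruct (cuspidal_expansion_bound N b _ 1 HN ltac:(lra) Hb) as [M1 [HM10 HM1]].
  set (be := 2 * PI / INR N * (2 * PI)). assert (Hbe : 0 < be).
  { apply Rmult_lt_0_compat; [apply Rdiv_lt_0_compat|]; lra. }
  destruct (pow_le_exp (k + j)) as [D [HD HDx]].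
  set (K1 := M1 * (2 * PI) ^ k * (D / be ^ (k + j)) * exp (2 * PI)).
  assert (HK1 : 0 <= K1).
  { unfold K1. repeat apply Rmult_le_pos; try lra; try (apply pow_le; lra); try (apply Rlt_le, exp_pos).
    apply Rlt_le, Rinv_0_lt_compat, pow_lt, Hbe. }
  assert (PD : forall x z n, (x / z) ^ n = x ^ n / z ^ n).
  { intros x z n. unfold Rdiv. now rewrite Rpow_mult_distr, pow_inv. }
  exists (K1 + M2). split; [lra|]. intros t Ht.
  assert (Hpt : 0 < t ^ j) by now apply pow_lt.
  assert (Het := exp_pos (- t)).
  destruct (Rle_lt_dec t (2 * PI)) as [L|L].
  - apply Rle_trans with (K1 * t ^ j * exp (- t)).
    2: { apply Rmult_le_compat_r; [lra|]. apply Rmult_le_compat_r; lra. }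
    set (s := (0, 2 * PI / t) : C).
    assert (Hs : 1 <= Im s).
    { simpl. apply Rmult_le_reg_r with t; [exact Ht|]. unfold Rdiv. rewrite Rmult_assoc, Rinv_l; lra. }
    assert (Hsn : s <> RtoC 0) by (intros E; rewrite E in Hs; simpl in Hs; lra).
    assert (E : f (0, t / (2 * PI)) = (slash k sl_S f s * s ^ k)%C).
    { rewrite slash_eq. unfold moebius. replace (auto_factor sl_S s) with s by (unfold auto_factor, ZtoC; simpl; ring).
      unfold ZtoC. simpl (ma _). simpl (mb _).
      replace ((RtoC 0 * s + RtoC (-1)) / s)%C with ((0, t / (2 * PI)) : C).
      - field. now apply Cpow_nz.
      - apply C_ext; unfold s; simpl; field; split; lra. }
    rewrite E, Cmod_mult, Cmod_pow.
    assert (Hms : Cmod s = 2 * PI / t).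
    { replace s with (Ci * RtoC (2 * PI / t))%C by (apply C_ext; simpl; ring).
      rewrite Cmod_mult, Cmod_Ci, Cmod_R, Rabs_pos_eq, Rmult_1_l; [reflexivity|]. apply Rlt_le, Rdiv_lt_0_compat; lra. }
    rewrite Hms. specialize (HM1 s Hs). simpl (Im s) in HM1.
    replace (- (2 * PI / INR N) * (2 * PI / t)) with (- (be / t)) in HM1 by (unfold be; field; split; lra).
    assert (Hx : 0 <= be / t) by (apply Rlt_le, Rdiv_lt_0_compat; lra).
    specialize (HDx _ Hx).
    assert (H1 : exp (- (be / t)) <= D / be ^ (k + j) * t ^ (k + j)).
    { rewrite exp_Ropp. apply Rmult_le_reg_r with (exp (be / t)); [apply exp_pos|].
      rewrite Rinv_l by (apply Rgt_not_eq, exp_pos).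
      replace (D / be ^ (k + j) * t ^ (k + j) * exp (be / t)) with ((D * exp (be / t)) * / ((be / t) ^ (k + j))).
      - apply Rmult_le_reg_r with ((be / t) ^ (k + j)); [apply pow_lt, Rdiv_lt_0_compat; lra|].
        rewrite Rmult_assoc, Rinv_l; [lra|]. apply pow_nonzero. apply Rgt_not_eq, Rdiv_lt_0_compat; lra.
      - rewrite PD. field. split; apply pow_nonzero; lra. }
    assert (H2 : 1 <= exp (2 * PI) * exp (- t)).
    { rewrite <- exp_plus, <- exp_0. apply exp_mono. lra. }
    apply Rle_trans with (M1 * (D / be ^ (k + j) * t ^ (k + j)) * (2 * PI / t) ^ k).
    { apply Rmult_le_compat_r; [apply pow_le, Rlt_le, Rdiv_lt_0_compat; lra|].
      eapply Rle_trans; [exact HM1|]. now apply Rmult_le_compat_l. }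
    replace (M1 * (D / be ^ (k + j) * t ^ (k + j)) * (2 * PI / t) ^ k) with
      (M1 * (2 * PI) ^ k * (D / be ^ (k + j)) * t ^ j * 1).
    2: { rewrite (PD (2 * PI)), (pow_add t). field. split; apply pow_nonzero; lra. }
    unfold K1.
    replace (M1 * (2 * PI) ^ k * (D / be ^ (k + j)) * exp (2 * PI) * t ^ j * exp (- t)) with
      (M1 * (2 * PI) ^ k * (D / be ^ (k + j)) * t ^ j * (exp (2 * PI) * exp (- t))) by ring.
    apply Rmult_le_compat_l; [|exact H2].
    repeat apply Rmult_le_pos; try lra; try (apply pow_le; lra).
    apply Rlt_le, Rinv_0_lt_compat, pow_lt, Hbe.
  - assert (H1 : 1 <= Im (0, t / (2 * PI))).
    { simpl. apply Rmult_le_reg_r with (2 * PI); [lra|]. unfold Rdiv. rewrite Rmult_assoc, Rinv_l; lra. }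
    specialize (HM2 _ H1). simpl (Im _) in HM2.
    replace (- (2 * PI / INR 1) * (t / (2 * PI))) with (- t) in HM2 by (simpl; field; lra).
    eapply Rle_trans; [exact HM2|]. apply Rmult_le_compat_r; [lra|].
    assert (1 <= t ^ j).
    { rewrite <- (pow1 j). apply pow_incr. assert (Q := PI2_1). lra. }
    nra.
Qed.

(** * Mellin integrals on the unit interval *)

(** With [u = e^{-t}], this is [ln t]. *)
Definition logt (u : R) : R := ln (- ln u).

Lemma neg_ln_pos (u : R) : 0 < u < 1 -> 0 < - ln u.
Proof. intros H. assert (ln u < ln 1) by (apply ln_increasing; lra). rewrite ln_1 in *. lra. Qed.

Lemma exp_logt (u : R) : 0 < u < 1 -> exp (logt u) = - ln u.
Proof. intros H. apply exp_ln. now apply neg_ln_pos. Qed.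

Lemma is_derive_logt (u : R) : 0 < u < 1 -> is_derive logt u (/ (u * ln u)).
Proof.
  intros H. assert (Hl := neg_ln_pos u H). unfold logt. auto_derive.
  - split; [lra | split; [lra | easy]].
  - field. split; lra.
Qed.

(** Extension by 0 outside the open unit interval; the integrands below have a
    limit 0 at both ends. *)
Definition cut (f : R -> C) (u : R) : C :=
  if Rlt_dec 0 u then if Rlt_dec u 1 then f u else RtoC 0 else RtoC 0.

Definition int01 (f : R -> C) : C := cint (cut f) 0 1.

(** The bound is [M * min (t, 1/t)], which tends to 0 at both ends. *)
Definition admissible (f : R -> C) : Prop :=
  (forall u, 0 < u < 1 -> continuous f u) /\
  exists M, forall u, 0 < u < 1 -> Cmod (f u) <= M * exp (- Rabs (logt u)).

Lemma cut_in (f : R -> C) u : 0 < u < 1 -> cut f u = f u.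
Proof. intros H. unfold cut. destruct (Rlt_dec 0 u), (Rlt_dec u 1); try lra; reflexivity. Qed.

Lemma cut_out (f : R -> C) u : u <= 0 \/ 1 <= u -> cut f u = RtoC 0.
Proof. intros H. unfold cut. destruct (Rlt_dec 0 u), (Rlt_dec u 1); try lra; reflexivity. Qed.

Lemma exp_neg_abs_logt_0 (e : R) : 0 < e ->
  exists d, 0 < d /\ forall u, 0 < u < 1 -> (u < d \/ 1 - d < u) -> exp (- Rabs (logt u)) < e.
Proof.
  intros He.
  assert (H1 : exp (- e) < 1) by (rewrite <- exp_0; apply exp_increasing; lra).
  exists (Rmin (exp (- / e)) (1 - exp (- e))). split; [apply Rmin_glb_lt; [apply exp_pos | lra]|].
  intros u Hu H. assert (Ht := neg_ln_pos u Hu).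
  assert (L1 := Rmin_l (exp (- / e)) (1 - exp (- e))). assert (L2 := Rmin_r (exp (- / e)) (1 - exp (- e))).
  destruct H as [H|H].
  - assert (Hlu : ln u < - / e) by (rewrite <- (ln_exp (- / e)); apply ln_increasing; lra).
    apply Rle_lt_trans with (exp (- logt u)).
    + apply exp_mono. assert (Q := Rle_abs (logt u)). lra.
    + rewrite exp_Ropp, exp_logt by exact Hu. rewrite <- (Rinv_inv e).
      apply Rinv_lt_contravar; [|lra]. apply Rmult_lt_0_compat; [now apply Rinv_0_lt_compat | exact Ht].
  - assert (Hlu : - e < ln u) by (rewrite <- (ln_exp (- e)); apply ln_increasing; [apply exp_pos | lra]).
    apply Rle_lt_trans with (exp (logt u)).
    + apply exp_mono. assert (Q := Rle_abs (- logt u)). rewrite Rabs_Ropp in Q. lra.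
    + rewrite exp_logt by exact Hu. lra.
Qed.

Lemma cut_cont (f : R -> C) : admissible f -> forall u, continuous (cut f) u.
Proof.
  intros [Hc [M HM]] u. apply continuous_eps. intros e He.
  destruct (classic (0 < u < 1)) as [Hu|Hu].
  - destruct (proj1 (continuous_eps f u) (Hc u Hu) e He) as [d [Hd Hf]].
    exists (Rmin d (Rmin u (1 - u))). split; [repeat apply Rmin_glb_lt; lra|]. intros y Hy.
    assert (L1 := Rmin_l d (Rmin u (1 - u))). assert (L2 := Rmin_r d (Rmin u (1 - u))).
    assert (L3 := Rmin_l u (1 - u)). assert (L4 := Rmin_r u (1 - u)).
    assert (Q := Rabs_def2 _ _ Hy). rewrite !cut_in by lra. apply Hf. lra.
  - assert (Ho : u <= 0 \/ 1 <= u).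
    { destruct (Rle_lt_dec u 0); [now left|]. destruct (Rle_lt_dec 1 u); [now right|]. elim Hu; lra. }
    assert (HMp : 0 < Rabs M + 1) by (assert (Q := Rabs_pos M); lra).
    destruct (exp_neg_abs_logt_0 (e / (Rabs M + 1)) ltac:(now apply Rdiv_lt_0_compat)) as [d [Hd Hs]].
    exists d. split; [exact Hd|]. intros y Hy. apply Rabs_def2 in Hy. rewrite (cut_out f u) by exact Ho.
    replace (cut f y - RtoC 0)%C with (cut f y) by ring.
    destruct (classic (0 < y < 1)) as [Yi|Yo].
    + rewrite cut_in by exact Yi. eapply Rle_lt_trans; [apply HM, Yi|].
      apply Rle_lt_trans with (Rabs M * exp (- Rabs (logt y))).
      { apply Rmult_le_compat_r; [apply Rlt_le, exp_pos | apply Rle_abs]. }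
      assert (Hs' := Hs y Yi ltac:(destruct Ho; lra)).
      apply (Rmult_lt_compat_l (Rabs M + 1)) in Hs'; [|exact HMp].
      replace ((Rabs M + 1) * (e / (Rabs M + 1))) with e in Hs' by (field; lra).
      assert (Q := exp_pos (- Rabs (logt y))). lra.
    + rewrite cut_out; [rewrite Cmod_0; exact He|].
      destruct (Rle_lt_dec y 0); [now left|]. destruct (Rle_lt_dec 1 y); [now right|]. elim Yo; lra.
Qed.

Lemma int01_ext (f g : R -> C) : (forall u, 0 < u < 1 -> f u = g u) -> int01 f = int01 g.
Proof. intros H. apply cint_ext; [lra|]. intros u Hu. rewrite !cut_in by exact Hu. now apply H. Qed.

Lemma admissible_plus (f g : R -> C) : admissible f -> admissible g -> admissible (fun u => f u + g u)%C.
Proof.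
  intros [Hf [M HM]] [Hg [M' HM']]. split.
  - intros u Hu. apply (@continuous_plus R_UniformSpace R_AbsRing C_R_NormedModule); auto.
  - exists (M + M'). intros u Hu. eapply Rle_trans; [apply Cmod_triangle|].
    specialize (HM u Hu). specialize (HM' u Hu). lra.
Qed.

Lemma admissible_Cmult (f : R -> C) (c : C) : admissible f -> admissible (fun u => c * f u)%C.
Proof.
  intros [Hf [M HM]]. split.
  - intros u Hu. apply continuous_Cmult; [apply continuous_const | auto].
  - exists (Cmod c * M). intros u Hu. rewrite Cmod_mult, Rmult_assoc.
    apply Rmult_le_compat_l; [apply Cmod_ge_0 | auto].
Qed.

Lemma admissible_ext (f g : R -> C) : (forall u, f u = g u) -> admissible f -> admissible g.
Proof.
  intros E [Hf [M HM]]. split.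
  - intros u Hu. now apply (continuous_ext f); [|apply Hf].
  - exists M. intros u Hu. rewrite <- E. auto.
Qed.

Lemma admissible_minus (f g : R -> C) : admissible f -> admissible g -> admissible (fun u => f u - g u)%C.
Proof.
  intros Hf Hg. apply admissible_ext with (fun u => f u + - (1) * g u)%C; [intros u; ring|].
  apply admissible_plus; [exact Hf | now apply admissible_Cmult].
Qed.

Lemma int01_plus (f g : R -> C) : admissible f -> admissible g ->
  int01 (fun u => f u + g u)%C = (int01 f + int01 g)%C.
Proof.
  intros Hf Hg. unfold int01. rewrite <- cint_plus; [| lra | intros u _; now apply cut_cont | intros u _; now apply cut_cont].
  apply cint_ext; [lra|]. intros u Hu. now rewrite !cut_in.
Qed.

Lemma int01_minus (f g : R -> C) : admissible f -> admissible g ->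
  int01 (fun u => f u - g u)%C = (int01 f - int01 g)%C.
Proof.
  intros Hf Hg. unfold int01. rewrite <- cint_minus; [| lra | intros u _; now apply cut_cont | intros u _; now apply cut_cont].
  apply cint_ext; [lra|]. intros u Hu. now rewrite !cut_in.
Qed.

Lemma int01_Cmult (f : R -> C) (c : C) : admissible f -> int01 (fun u => c * f u)%C = (c * int01 f)%C.
Proof.
  intros Hf. unfold int01. rewrite <- cint_Cmult; [| lra | intros u _; now apply cut_cont].
  apply cint_ext; [lra|]. intros u Hu. now rewrite !cut_in.
Qed.

Lemma int01_bound (f : R -> C) (B : R) : admissible f -> (forall u, 0 < u < 1 -> Cmod (f u) <= B) ->
  Cmod (int01 f) <= B.
Proof.
  intros Hf HB. assert (HB0 : 0 <= B) by (eapply Rle_trans; [apply Cmod_ge_0 | apply (HB (/ 2)); lra]).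
  replace B with (B * (1 - 0)) by ring. apply cint_bound; [lra | intros u _; now apply cut_cont|].
  intros u Hu. destruct (Rlt_dec 0 u); [destruct (Rlt_dec u 1)|].
  - rewrite cut_in by lra. apply HB; lra.
  - rewrite cut_out by lra. rewrite Cmod_0. exact HB0.
  - rewrite cut_out by lra. rewrite Cmod_0. exact HB0.
Qed.

(** The fundamental theorem of calculus is applied on [[e, 1 - e]], where no
    question of differentiability at the end points arises. *)
Lemma int01_derive (F f : R -> C) : admissible F -> admissible f ->
  (forall u, 0 < u < 1 -> cis_derive F u (f u)) -> int01 f = RtoC 0.
Proof.
  intros HF Hf Hd. assert (CF := cut_cont F HF). assert (Cf := cut_cont f Hf).
  destruct Hf as [Hfc [M HM]].
  assert (HMa : forall u, Cmod (cut f u) <= Rabs M).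
  { intros u. destruct (Rlt_dec 0 u); [destruct (Rlt_dec u 1)|].
    - rewrite cut_in by lra. eapply Rle_trans; [apply HM; lra|].
      apply Rle_trans with (Rabs M * exp (- Rabs (logt u))).
      + apply Rmult_le_compat_r; [apply Rlt_le, exp_pos | apply Rle_abs].
      + rewrite <- (Rmult_1_r (Rabs M)) at 2. apply Rmult_le_compat_l; [apply Rabs_pos|].
        rewrite <- exp_0. apply exp_mono. assert (Q := Rabs_pos (logt u)). lra.
    - rewrite cut_out by lra. rewrite Cmod_0. apply Rabs_pos.
    - rewrite cut_out by lra. rewrite Cmod_0. apply Rabs_pos. }
  apply Cmod_eq_0, Rle_antisym; [|apply Cmod_ge_0]. rewrite <- (Rplus_0_l 0). apply Rle_plus_epsilon. intros e He.
  rewrite Rplus_0_l.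
  destruct (proj1 (continuous_eps _ 0) (CF 0) (e / 4) ltac:(lra)) as [d1 [Hd1 H1]].
  destruct (proj1 (continuous_eps _ 1) (CF 1) (e / 4) ltac:(lra)) as [d2 [Hd2 H2]].
  assert (HMp := Rabs_pos M).
  set (x := Rmin (Rmin (d1 / 2) (d2 / 2)) (Rmin (/ 4) (e / (4 * (Rabs M + 1))))).
  assert (Hx : 0 < x).
  { unfold x. repeat apply Rmin_glb_lt; try lra. apply Rdiv_lt_0_compat; lra. }
  assert (L1 := Rmin_l (Rmin (d1 / 2) (d2 / 2)) (Rmin (/ 4) (e / (4 * (Rabs M + 1))))).
  assert (L2 := Rmin_r (Rmin (d1 / 2) (d2 / 2)) (Rmin (/ 4) (e / (4 * (Rabs M + 1))))). fold x in L1, L2.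
  assert (L3 := Rmin_l (d1 / 2) (d2 / 2)). assert (L4 := Rmin_r (d1 / 2) (d2 / 2)).
  assert (L5 := Rmin_l (/ 4) (e / (4 * (Rabs M + 1)))). assert (L6 := Rmin_r (/ 4) (e / (4 * (Rabs M + 1)))).
  assert (Hxe : x * Rabs M <= e / 4).
  { apply Rle_trans with (e / (4 * (Rabs M + 1)) * (Rabs M + 1)); [|right; field; lra].
    apply Rmult_le_compat; lra. }
  unfold int01.
  rewrite (cint_Chasles (cut f) 0 x 1), (cint_Chasles (cut f) x (1 - x) 1); try lra;
    try (intros u _; apply Cf).
  assert (I1 := cint_bound (cut f) 0 x (Rabs M) ltac:(lra) ltac:(intros u _; apply Cf) ltac:(intros u _; apply HMa)).
  assert (I3 := cint_bound (cut f) (1 - x) 1 (Rabs M) ltac:(lra) ltac:(intros u _; apply Cf) ltac:(intros u _; apply HMa)).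
  assert (I2 : cint (cut f) x (1 - x) = (F (1 - x)%R - F x)%C).
  { rewrite <- (cint_derive F f x (1 - x)); [| lra | intros u Hu; apply Hd; lra | intros u Hu; apply Hfc; lra].
    apply cint_ext; [lra|]. intros u Hu. apply cut_in. lra. }
  rewrite I2.
  specialize (H1 x ltac:(rewrite Rminus_0_r, Rabs_pos_eq; lra)).
  specialize (H2 (1 - x) ltac:(apply Rabs_def1; lra)).
  rewrite cut_in, cut_out in H1 by lra. rewrite cut_in, cut_out in H2 by lra.
  replace (F x - RtoC 0)%C with (F x) in H1 by ring. replace (F (1 - x)%R - RtoC 0)%C with (F (1 - x)) in H2 by ring.
  eapply Rle_trans; [apply Cmod_triangle|].
  eapply Rle_trans; [apply Rplus_le_compat_l, Cmod_triangle|].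
  assert (T := Cmod_triangle_minus (F (1 - x)) (F x)). lra.
Qed.

Lemma int01_power_subst (f : R -> C) (b : nat) : (1 <= b)%nat -> admissible f ->
  int01 f = cint (fun v => RtoC (INR b * v ^ pred b) * cut f (v ^ b))%C 0 1.
Proof.
  intros Hb Hf.
  assert (H := @RInt_comp C_R_CompleteNormedModule (cut f) (fun v => v ^ b) (fun v => INR b * v ^ pred b) 0 1).
  cbv beta in H. rewrite pow1, pow_i in H by lia. unfold int01, cint at 1. rewrite <- H.
  - apply (@RInt_ext C_R_CompleteNormedModule). intros x _. apply scal_R_Cmult.
  - intros x _. now apply cut_cont.
  - intros x _. split.
    + auto_derive; [easy | ring].
    + apply (ex_derive_continuous (fun v => INR b * v ^ pred b)). auto_derive. easy.
Qed.

(** * Exponential bounds *)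

(** [t^A e^(-kt) <= D k^(-A)], from the maximum of [x^A e^(-x)]. *)
Lemma exp_logt_decay (A : R) : 0 <= A ->
  exists D, 0 < D /\ forall k u, 1 <= k -> 0 < u < 1 -> exp (A * logt u) * exp (k * ln u) <= D * exp (- (A * ln k)).
Proof.
  intros HA. exists (exp (A * ln (A + 1))). split; [apply exp_pos|].
  intros k u Hk Hu. assert (Ht := neg_ln_pos u Hu). rewrite <- !exp_plus. apply exp_mono.
  unfold logt. set (t := - ln u) in *. replace (ln u) with (- t) by (unfold t; ring).
  assert (Hx : 0 < k * t) by nra.
  assert (E : ln (k * t) = ln k + ln t) by (apply ln_mult; lra).
  assert (E2 : ln (k * t / (A + 1)) = ln (k * t) - ln (A + 1)) by (apply ln_div; lra).
  assert (Hp : 0 < k * t / (A + 1)) by (apply Rdiv_lt_0_compat; lra).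
  assert (Q := exp_ineq1_le (ln (k * t / (A + 1)))). rewrite exp_ln in Q by exact Hp.
  assert (Q2 : A * (k * t / (A + 1)) <= k * t).
  { apply Rmult_le_reg_r with (A + 1); [lra|].
    replace (A * (k * t / (A + 1)) * (A + 1)) with (A * (k * t)) by (field; lra). nra. }
  assert (Q3 : A * ln (k * t / (A + 1)) <= A * (k * t / (A + 1))) by (apply Rmult_le_compat_l; lra).
  rewrite E2, E in Q3. nra.
Qed.

Lemma exp_abs_le (b x : R) : 0 <= b -> exp (b * Rabs x) <= exp (b * x) + exp (- (b * x)).
Proof.
  intros Hb. assert (P1 := exp_pos (b * x)). assert (P2 := exp_pos (- (b * x))).
  unfold Rabs. destruct (Rcase_abs x); [replace (b * - x) with (- (b * x)) by ring|]; lra.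
Qed.

(** The integrand of an Euler integral, with room for a power of
    [max (t, 1/t)]. *)
Lemma exp_logt_abs_decay (A b : R) : 0 <= b -> b <= A ->
  exists D, 0 < D /\ forall k u, 1 <= k -> 0 < u < 1 ->
    exp (A * logt u) * exp (k * ln u) * exp (b * Rabs (logt u)) <= D * exp (- ((A - b) * ln k)).
Proof.
  intros Hb HA.
  destruct (exp_logt_decay (A + b) ltac:(lra)) as [D1 [HD1 H1]].
  destruct (exp_logt_decay (A - b) ltac:(lra)) as [D2 [HD2 H2]].
  exists (D1 + D2). split; [lra|]. intros k u Hk Hu.
  specialize (H1 k u Hk Hu). specialize (H2 k u Hk Hu).
  assert (Hlk : 0 <= ln k) by (rewrite <- ln_1; destruct Hk as [Hk| <-]; [apply Rlt_le, ln_increasing; lra | lra]).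
  assert (M : exp (- ((A + b) * ln k)) <= exp (- ((A - b) * ln k))) by (apply exp_mono; nra).
  assert (P0 := exp_pos (k * ln u)). assert (P1 := exp_pos (A * logt u)).
  eapply Rle_trans; [apply Rmult_le_compat_l; [apply Rlt_le, Rmult_lt_0_compat; lra | apply exp_abs_le; exact Hb]|].
  replace (exp (A * logt u) * exp (k * ln u) * (exp (b * logt u) + exp (- (b * logt u)))) with
    (exp ((A + b) * logt u) * exp (k * ln u) + exp ((A - b) * logt u) * exp (k * ln u)).
  - nra.
  - replace ((A + b) * logt u) with (A * logt u + b * logt u) by ring.
    replace ((A - b) * logt u) with (A * logt u + - (b * logt u)) by ring. rewrite !exp_plus. ring.
Qed.

(** * Holomorphy of integrals of exponentials *)

Lemma cis_derive_Cexp_logt (c d : C) u : 0 < u < 1 ->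
  cis_derive (fun u => Cexp (c + d * RtoC (logt u)))%C u
    (d * RtoC (/ (u * ln u)) * Cexp (c + d * RtoC (logt u)))%C.
Proof.
  intros Hu. eapply cis_derive_val.
  - apply (cis_derive_Cexp (fun u => c + d * RtoC (logt u))%C).
    apply cis_derive_plus; [apply cis_derive_const|].
    apply cis_derive_mult; [apply cis_derive_const|]. apply cis_derive_RtoC, is_derive_logt, Hu.
  - cbv beta. ring.
Qed.

Lemma continuous_Cexp_logt (c d : C) u : 0 < u < 1 -> continuous (fun u => Cexp (c + d * RtoC (logt u)))%C u.
Proof. intros Hu. eapply cis_derive_cont. now apply cis_derive_Cexp_logt. Qed.

Lemma continuous_RtoC_logt u : 0 < u < 1 -> continuous (fun u => RtoC (logt u)) u.
Proof. intros Hu. eapply cis_derive_cont, cis_derive_RtoC, is_derive_logt, Hu. Qed.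

(** A weighted [e^(-L s1) t^s2]: with [L = ln m] the first factor is [m^(-s1)], and
    both factors are differentiated in the same way. *)
Definition laplace_kernel (L : R) (w : R -> C) (s : C2) (u : R) : C :=
  (Cexp (fst s * RtoC (- L) + snd s * RtoC (logt u)) * w u)%C.

Definition laplace (L : R) (w : R -> C) (s : C2) : C := int01 (laplace_kernel L w s).

Definition laplace_d1 (L : R) (w : R -> C) (s : C2) : C := (RtoC (- L) * laplace L w s)%C.
Definition laplace_d2 (L : R) (w : R -> C) (s : C2) : C :=
  int01 (fun u => RtoC (logt u) * laplace_kernel L w s u)%C.

(** The margin [e^(4X)], with [X = L + |ln t|], exceeds what differentiation
    costs: [e^X] for an increment of length 1, [X^2 <= 4 e^X] for the second
    order term, and [e^X] for the decay at the ends of the interval. *)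
Definition laplace_bound (L : R) (w : R -> C) (s : C2) (Q : R) : Prop :=
  0 <= L /\ (forall u, 0 < u < 1 -> continuous w u) /\
  forall u, 0 < u < 1 -> Cmod (laplace_kernel L w s u) * exp (4 * (L + Rabs (logt u))) <= Q.

Lemma sq_le_exp (x : R) : 0 <= x -> x ^ 2 <= 4 * exp x.
Proof.
  intros Hx. assert (E : exp x = exp (x / 2) * exp (x / 2)) by (rewrite <- exp_plus; f_equal; field).
  assert (Q := exp_ineq1_le (x / 2)). rewrite E. nra.
Qed.

(** Differentiation under the integral sign with an explicit remainder, whose
    dependence on [Q] alone allows summation over a family of integrals. *)
Lemma laplace_expand (L : R) (w : R -> C) (s : C2) (Q : R) : laplace_bound L w s Q ->
  Cmod (laplace L w s) <= Q /\ Cmod (laplace_d1 L w s) <= Q /\ Cmod (laplace_d2 L w s) <= Q /\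
  forall h1 h2, Cmod h1 + Cmod h2 <= 1 ->
    Cmod (laplace L w ((fst s + h1)%C, (snd s + h2)%C) - laplace L w s
          - (laplace_d1 L w s * h1 + laplace_d2 L w s * h2)) <= 4 * Q * (Cmod h1 + Cmod h2) ^ 2.
Proof.
  intros [HL [Hw HQ]]. destruct s as [s1 s2]. cbn [fst snd] in *.
  set (E0 := laplace_kernel L w (s1, s2)) in *.
  set (X := fun u => L + Rabs (logt u)).
  assert (HX : forall u, 0 <= X u) by (intros u; unfold X; assert (Q0 := Rabs_pos (logt u)); lra).
  assert (CE : forall s u, 0 < u < 1 -> continuous (laplace_kernel L w s) u).
  { intros s u Hu. apply (continuous_Cmult (fun u => Cexp (fst s * RtoC (- L) + snd s * RtoC (logt u)))%C);
     [now apply continuous_Cexp_logt | now apply Hw]. }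
  assert (HE : forall u, 0 < u < 1 -> Cmod (E0 u) <= Q * exp (- 4 * X u)).
  { intros u Hu. specialize (HQ u Hu). fold (X u) in HQ.
    apply (Rmult_le_compat_r (exp (- 4 * X u))) in HQ; [|apply Rlt_le, exp_pos].
    rewrite Rmult_assoc, <- exp_plus in HQ. replace (4 * X u + - 4 * X u) with 0 in HQ by ring.
    rewrite exp_0, Rmult_1_r in HQ. exact HQ. }
  assert (HQ0 : 0 <= Q).
  { eapply Rle_trans; [|apply (HQ (/ 2)); lra]. apply Rmult_le_pos; [apply Cmod_ge_0 | apply Rlt_le, exp_pos]. }
  assert (Hexp : forall u y, y <= 3 * X u -> exp (- 4 * X u) * exp y <= exp (- Rabs (logt u))).
  { intros u y Hy. rewrite <- exp_plus. apply exp_mono. unfold X in *. lra. }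
  assert (Hexp1 : forall u y, y <= 4 * X u -> exp (- 4 * X u) * exp y <= 1).
  { intros u y Hy. rewrite <- exp_plus, <- exp_0. apply exp_mono. lra. }
  assert (Hgrow : forall (f : R -> C) c (y : R -> R), 0 <= c ->
     (forall u, 0 < u < 1 -> Cmod (f u) <= c * (Cmod (E0 u) * exp (y u))) ->
     (forall u, y u <= 3 * X u) ->
     forall u, 0 < u < 1 -> Cmod (f u) <= c * Q * exp (- Rabs (logt u))).
  { intros f c y Hc Hf Hy u Hu. eapply Rle_trans; [now apply Hf|]. rewrite Rmult_assoc.
    apply Rmult_le_compat_l; [exact Hc|].
    apply Rle_trans with (Q * exp (- 4 * X u) * exp (y u)).
    - apply Rmult_le_compat_r; [apply Rlt_le, exp_pos | now apply HE].
    - rewrite Rmult_assoc. apply Rmult_le_compat_l; [exact HQ0|]. now apply Hexp. }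
  assert (Hle1 : forall (f : R -> C) c, 0 <= c -> (forall u, 0 < u < 1 -> Cmod (f u) <= c * exp (- Rabs (logt u))) ->
     forall u, 0 < u < 1 -> Cmod (f u) <= c).
  { intros f c Hc Hf u Hu. eapply Rle_trans; [now apply Hf|]. rewrite <- (Rmult_1_r c) at 2.
    apply Rmult_le_compat_l; [exact Hc|]. rewrite <- exp_0. apply exp_mono. assert (Q0 := Rabs_pos (logt u)). lra. }
  set (F2 := fun u => (RtoC (logt u) * E0 u)%C).
  assert (B0 : forall u, 0 < u < 1 -> Cmod (E0 u) <= 1 * Q * exp (- Rabs (logt u))).
  { apply (Hgrow E0 1 (fun _ => 0)); [lra | |].
    - intros u Hu. rewrite exp_0. lra.
    - intros u. specialize (HX u). lra. }
  assert (B2 : forall u, 0 < u < 1 -> Cmod (F2 u) <= 1 * Q * exp (- Rabs (logt u))).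
  { apply (Hgrow F2 1 X); [lra | |].
    - intros u Hu. unfold F2. rewrite Cmod_mult, Cmod_R. rewrite (Rmult_comm (Rabs _)), Rmult_1_l.
      apply Rmult_le_compat_l; [apply Cmod_ge_0|]. assert (Q1 := exp_ineq1_le (X u)). unfold X in *. lra.
    - intros u. specialize (HX u). lra. }
  assert (B1 : forall u, 0 < u < 1 -> Cmod (RtoC (- L) * E0 u) <= 1 * Q * exp (- Rabs (logt u))).
  { apply (Hgrow (fun u => RtoC (- L) * E0 u)%C 1 X); [lra | |].
    - intros u Hu. rewrite Cmod_mult, Cmod_R, Rabs_Ropp, (Rabs_pos_eq L) by exact HL. rewrite (Rmult_comm L), Rmult_1_l.
      apply Rmult_le_compat_l; [apply Cmod_ge_0|]. assert (Q1 := exp_ineq1_le (X u)). unfold X in *.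
      assert (Q0 := Rabs_pos (logt u)). lra.
    - intros u. specialize (HX u). lra. }
  assert (A0 : admissible E0) by (split; [intros u Hu; now apply CE | exists (1 * Q); exact B0]).
  assert (A2 : admissible F2).
  { split; [|exists (1 * Q); exact B2]. intros u Hu. apply continuous_Cmult; [now apply continuous_RtoC_logt | now apply CE]. }
  assert (A1 : admissible (fun u => RtoC (- L) * E0 u)%C) by now apply admissible_Cmult.
  assert (E1 : laplace_d1 L w (s1, s2) = int01 (fun u => RtoC (- L) * E0 u)%C).
  { unfold laplace_d1, laplace. fold E0. now rewrite int01_Cmult. }
  split; [|split; [|split]].
  - apply int01_bound; [exact A0|]. apply Hle1; [exact HQ0|]. intros u Hu. rewrite <- (Rmult_1_l Q). now apply B0.
  - rewrite E1. apply int01_bound; [exact A1|]. apply Hle1; [exact HQ0|]. intros u Hu. rewrite <- (Rmult_1_l Q). now apply B1.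
  - apply int01_bound; [exact A2|]. apply Hle1; [exact HQ0|]. intros u Hu. rewrite <- (Rmult_1_l Q). now apply B2.
  - intros h1 h2 Hh. set (sg := Cmod h1 + Cmod h2) in *.
    assert (P1 := Cmod_ge_0 h1). assert (P2 := Cmod_ge_0 h2).
    assert (Hsg : 0 <= sg) by (unfold sg; lra).
    set (de := fun u => (h1 * RtoC (- L) + h2 * RtoC (logt u))%C).
    assert (Hde : forall u, Cmod (de u) <= sg * X u).
    { intros u. unfold de. eapply Rle_trans; [apply Cmod_triangle|].
      rewrite !Cmod_mult, !Cmod_R, Rabs_Ropp, (Rabs_pos_eq L) by exact HL.
      assert (Q0 := Rabs_pos (logt u)). unfold sg, X. nra. }
    assert (Hde1 : forall u, Cmod (de u) <= X u).
    { intros u. eapply Rle_trans; [apply Hde|]. specialize (HX u). nra. }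
    set (Eh := laplace_kernel L w ((s1 + h1)%C, (s2 + h2)%C)).
    assert (EEh : forall u, Eh u = (E0 u * Cexp (de u))%C).
    { intros u. unfold Eh, E0, laplace_kernel, de. cbn [fst snd].
      transitivity (Cexp (s1 * RtoC (- L) + s2 * RtoC (logt u)) * Cexp (h1 * RtoC (- L) + h2 * RtoC (logt u)) * w u)%C; [|ring].
      rewrite <- Cexp_plus. do 2 f_equal. ring. }
    assert (Ah : admissible Eh).
    { split; [intros u Hu; now apply CE|]. exists (1 * Q). apply (Hgrow Eh 1 X); [lra | |].
      - intros u Hu. rewrite EEh, Cmod_mult, Cmod_Cexp, Rmult_1_l.
        apply Rmult_le_compat_l; [apply Cmod_ge_0|]. apply exp_mono.
        eapply Rle_trans; [apply Rle_abs|]. eapply Rle_trans; [apply re_le_Cmod | apply Hde1].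
      - intros u. specialize (HX u). lra. }
    assert (EQ : (laplace L w ((s1 + h1)%C, (s2 + h2)%C) - laplace L w (s1, s2)
          - (laplace_d1 L w (s1, s2) * h1 + laplace_d2 L w (s1, s2) * h2))%C
       = int01 (fun u => (Eh u - E0 u) - (h1 * (RtoC (- L) * E0 u) + h2 * F2 u))%C).
    { rewrite int01_minus; [rewrite int01_minus, int01_plus, !int01_Cmult; try assumption| |];
        try (apply admissible_Cmult; assumption).
      - unfold laplace_d1, laplace_d2, laplace. fold E0. fold F2. fold Eh. ring.
      - now apply admissible_minus.
      - apply admissible_plus; now apply admissible_Cmult. }
    rewrite EQ. apply int01_bound.
    + apply admissible_minus; [now apply admissible_minus|]. apply admissible_plus; now apply admissible_Cmult.
    + intros u Hu.
      replace ((Eh u - E0 u) - (h1 * (RtoC (- L) * E0 u) + h2 * F2 u))%C with (E0 u * (Cexp (de u) - 1 - de u))%C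
        by (rewrite EEh; unfold F2, de; ring).
      rewrite Cmod_mult.
      assert (T : Cmod (Cexp (de u) - 1 - de u) <= 4 * sg ^ 2 * exp (2 * X u)).
      { eapply Rle_trans; [apply Cexp_taylor_le|].
        assert (D1 := Cmod_ge_0 (de u)). specialize (Hde u). specialize (Hde1 u). specialize (HX u).
        assert (S1 : Cmod (de u) ^ 2 <= sg ^ 2 * X u ^ 2) by (rewrite <- Rpow_mult_distr; now apply pow_incr).
        assert (S2 := sq_le_exp (X u) HX).
        assert (S3 : exp (Cmod (de u)) <= exp (X u)) by now apply exp_mono.
        apply Rle_trans with ((sg ^ 2 * (4 * exp (X u))) * exp (X u)).
        - apply Rmult_le_compat; [apply pow2_ge_0 | apply Rlt_le, exp_pos | | exact S3].
          eapply Rle_trans; [exact S1|]. apply Rmult_le_compat_l; [apply pow2_ge_0 | exact S2].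
        - right. replace (2 * X u) with (X u + X u) by ring. rewrite exp_plus. ring. }
      apply Rle_trans with (Q * exp (- 4 * X u) * (4 * sg ^ 2 * exp (2 * X u))).
      * apply Rmult_le_compat; [apply Cmod_ge_0 | apply Cmod_ge_0 | now apply HE | exact T].
      * replace (Q * exp (- 4 * X u) * (4 * sg ^ 2 * exp (2 * X u))) with
          (4 * Q * sg ^ 2 * (exp (- 4 * X u) * exp (2 * X u))) by ring.
        rewrite <- (Rmult_1_r (4 * Q * sg ^ 2)) at 2. apply Rmult_le_compat_l.
        -- apply Rmult_le_pos; [lra | apply pow2_ge_0].
        -- apply Hexp1. specialize (HX u). lra.
Qed.

Lemma cdiff2_of_quadratic (F : C2 -> C) (s : C2) (A B : C) (K : R) :
  0 <= K ->
  (forall h1 h2, Cmod h1 + Cmod h2 <= 1 ->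
     Cmod (F ((fst s + h1)%C, (snd s + h2)%C) - F s - (A * h1 + B * h2)) <= K * (Cmod h1 + Cmod h2) ^ 2) ->
  cdiff2 F s.
Proof.
  intros HK H. exists A, B. intros e He.
  exists (Rmin (/ 2) (e / (2 * (K + 1)))). split.
  { apply Rmin_glb_lt; [lra|]. apply Rdiv_lt_0_compat; lra. }
  intros h1 h2 H1 H2.
  assert (L1 := Rmin_l (/ 2) (e / (2 * (K + 1)))). assert (L2 := Rmin_r (/ 2) (e / (2 * (K + 1)))).
  assert (P1 := Cmod_ge_0 h1). assert (P2 := Cmod_ge_0 h2).
  eapply Rle_trans; [apply H; lra|].
  set (sg := Cmod h1 + Cmod h2). replace (K * sg ^ 2) with (K * sg * sg) by ring.
  apply Rmult_le_compat_r; [unfold sg; lra|].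
  assert (Hs : sg <= e / (K + 1)).
  { replace (e / (K + 1)) with (e / (2 * (K + 1)) + e / (2 * (K + 1))) by (field; lra). unfold sg; lra. }
  apply Rle_trans with ((K + 1) * (e / (K + 1))); [|right; field; lra].
  assert (0 <= sg) by (unfold sg; lra). apply Rmult_le_compat; lra.
Qed.

Lemma laplace_bound_Q_pos L w s Q : laplace_bound L w s Q -> 0 <= Q.
Proof. intros H. destruct (laplace_expand L w s Q H) as [H1 _]. eapply Rle_trans; [apply Cmod_ge_0 | exact H1]. Qed.

Lemma cdiff2_laplace (L : R) (w : R -> C) (s : C2) (Q : R) : laplace_bound L w s Q -> cdiff2 (laplace L w) s.
Proof.
  intros H. destruct (laplace_expand L w s Q H) as [_ [_ [_ Hx]]].
  apply cdiff2_of_quadratic with (2 := Hx). assert (H0 := laplace_bound_Q_pos _ _ _ _ H). lra.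
Qed.

Theorem cdiff2_laplace_series (L : nat -> R) (w : nat -> R -> C) (Q : nat -> R) (s : C2) :
  (forall m, laplace_bound (L m) (w m) s (Q m)) -> ex_series Q ->
  cdiff2 (fun s => CSeries (fun m => laplace (L m) (w m) s)) s.
Proof.
  intros H HQ.
  assert (HQ0 : forall m, 0 <= Q m) by (intros m; apply (laplace_bound_Q_pos _ _ _ _ (H m))).
  assert (HX := fun m => laplace_expand (L m) (w m) s (Q m) (H m)).
  set (J := fun m => laplace (L m) (w m)) in *.
  set (A := fun m => laplace_d1 (L m) (w m) s) in *. set (B := fun m => laplace_d2 (L m) (w m) s) in *.
  assert (HS0 : 0 <= Series Q).
  { eapply Rle_trans; [|apply (sum_n_le_Series Q 0 HQ0 HQ)]. rewrite sum_O. apply HQ0. }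
  destruct (Cseries_dominated (fun m => J m s) Q (fun m => proj1 (HX m)) HQ) as [SJ _].
  destruct (Cseries_dominated A Q (fun m => proj1 (proj2 (HX m))) HQ) as [SA _].
  destruct (Cseries_dominated B Q (fun m => proj1 (proj2 (proj2 (HX m)))) HQ) as [SB _].
  apply cdiff2_of_quadratic with (A := CSeries A) (B := CSeries B) (K := 4 * Series Q); [lra|].
  intros h1 h2 Hh. set (sg := Cmod h1 + Cmod h2) in *.
  set (s' := ((fst s + h1)%C, (snd s + h2)%C) : C2).
  set (rem := fun m => (J m s' - J m s - (A m * h1 + B m * h2))%C).
  assert (HR : forall m, Cmod (rem m) <= 4 * sg ^ 2 * Q m).
  { intros m. destruct (HX m) as [_ [_ [_ Hm]]]. specialize (Hm h1 h2 Hh). fold sg in Hm.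
    eapply Rle_trans; [exact Hm|]. right; ring. }
  assert (HQ2 : is_series (fun m => 4 * sg ^ 2 * Q m) (4 * sg ^ 2 * Series Q)).
  { apply (is_series_scal (4 * sg ^ 2) Q). now apply Series_correct. }
  destruct (Cseries_dominated rem _ HR (ex_intro _ _ HQ2)) as [SR HRle].
  rewrite (is_series_unique _ _ HQ2) in HRle.
  assert (SJ' : is_series (fun m => J m s') (CSeries rem + (CSeries (fun m => J m s) + (h1 * CSeries A + h2 * CSeries B)))%C).
  { apply is_series_ext with (fun m => rem m + (J m s + (h1 * A m + h2 * B m)))%C.
    - intros m. unfold rem.
      assert (X : forall a b c d e f : C, (a - b - (c * e + d * f) + (b + (e * c + f * d)))%C = a) by (intros; ring). apply X.
    - apply is_series_Cplus; [exact SR|]. apply is_series_Cplus; [exact SJ|].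
      apply is_series_Cplus; now apply is_series_Cmult. }
  change (Cmod (CSeries (fun m => J m s') - CSeries (fun m => J m s) - (CSeries A * h1 + CSeries B * h2)) <= 4 * Series Q * sg ^ 2).
  rewrite (CSeries_unique _ _ SJ').
  replace (CSeries rem + (CSeries (fun m => J m s) + (h1 * CSeries A + h2 * CSeries B)) - CSeries (fun m => J m s)
     - (CSeries A * h1 + CSeries B * h2))%C with (CSeries rem) by ring.
  eapply Rle_trans; [exact HRle|]. right; ring.
Qed.

(** * Euler integrals *)

(** [t^d] for [u = e^{-t}]. *)
Definition tpow (d : C) (u : R) : C := Cexp (d * RtoC (logt u)).

Lemma tpow_plus (c d : C) u : tpow (c + d) u = (tpow c u * tpow d u)%C.
Proof. unfold tpow. rewrite <- Cexp_plus. f_equal. ring. Qed.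

Lemma Cmod_tpow (d : C) u : Cmod (tpow d u) = exp (Re d * logt u).
Proof. unfold tpow. now rewrite Cmod_Cexp, re_scal_r. Qed.

Lemma tpow_1 u : 0 < u < 1 -> tpow 1 u = RtoC (- ln u).
Proof. intros Hu. unfold tpow. rewrite Cmult_1_l, Cexp_RtoC. now rewrite exp_logt. Qed.

Lemma tpow_derive (d : C) u : 0 < u < 1 ->
  cis_derive (tpow d) u (d * RtoC (/ (u * ln u)) * tpow d u)%C.
Proof.
  intros Hu. apply cis_derive_ext with (fun u => Cexp (RtoC 0 + d * RtoC (logt u)))%C.
  - intros v. unfold tpow. f_equal. ring.
  - eapply cis_derive_val; [now apply cis_derive_Cexp_logt|]. unfold tpow. do 2 f_equal. ring.
Qed.

Lemma pow_exp_ln (k : nat) u : 0 < u -> u ^ k = exp (INR k * ln u).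
Proof. intros Hu. rewrite <- Rpower_pow by exact Hu. reflexivity. Qed.

Lemma ln_INR_ge_0 (k : nat) : (1 <= k)%nat -> 0 <= ln (INR k).
Proof.
  intros Hk. apply le_INR in Hk. change (INR 1) with 1 in Hk. rewrite <- ln_1.
  destruct Hk as [Hk | <-]; [apply Rlt_le, ln_increasing; lra | lra].
Qed.

Lemma cont_pow (k : nat) u : continuous (fun u => RtoC (u ^ k)) u.
Proof.
  eapply cis_derive_cont, (cis_derive_RtoC (fun u => u ^ k) u (INR k * u ^ pred k)).
  auto_derive; [easy | ring].
Qed.

Definition euler_integrand (k : nat) (s : C) (u : R) : C := (tpow (s - 1) u * RtoC (u ^ k))%C.

(** [int_0^oo t^(s-1) e^(-(k+1)t) dt], that is, [(k+1)^(-s) Gamma(s)]. *)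
Definition euler_int (k : nat) (s : C) : C := int01 (euler_integrand k s).

Lemma Cmod_euler_integrand k s u : 0 < u -> Cmod (euler_integrand k s u) = exp ((Re s - 1) * logt u) * exp (INR k * ln u).
Proof.
  intros Hu. unfold euler_integrand. rewrite Cmod_mult, Cmod_tpow, Cmod_R, Rabs_pos_eq by (apply pow_le; lra).
  now rewrite pow_exp_ln.
Qed.

Lemma admissible_euler k s : (1 <= k)%nat -> 2 <= Re s -> admissible (euler_integrand k s).
Proof.
  intros Hk Hs. split.
  - intros u Hu. apply continuous_Cmult; [|apply cont_pow].
    eapply cis_derive_cont. now apply tpow_derive.
  - destruct (exp_logt_abs_decay (Re s - 1) 1 ltac:(lra) ltac:(lra)) as [D [HD H]].
    exists D. intros u Hu. rewrite Cmod_euler_integrand by lra.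
    specialize (H (INR k) u ltac:(apply (le_INR 1); exact Hk) Hu). rewrite (Rmult_1_l (Rabs _)) in H.
    assert (Hl := ln_INR_ge_0 k Hk).
    assert (E : exp (- ((Re s - 1 - 1) * ln (INR k))) <= 1)
      by (apply Rle_trans with (exp 0); [apply exp_mono; nra | rewrite exp_0; lra]).
    apply Rmult_le_reg_r with (exp (Rabs (logt u))); [apply exp_pos|].
    replace (D * exp (- Rabs (logt u)) * exp (Rabs (logt u))) with (D * 1).
    2: { rewrite Rmult_assoc, <- exp_plus. replace (- Rabs (logt u) + Rabs (logt u)) with 0 by ring. now rewrite exp_0. }
    eapply Rle_trans; [exact H|]. apply Rmult_le_compat_l; lra.
Qed.

(** The substitution [u = v^b], smooth on the whole segment, unlike its inverse;
    so two exponents are compared through a common multiple of them. *)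
Lemma euler_int_power (k b : nat) (s : C) : (1 <= k)%nat -> (1 <= b)%nat -> 2 <= Re s ->
  euler_int k s = (Cexp (s * RtoC (ln (INR b))) * euler_int (b * S k - 1) s)%C.
Proof.
  intros Hk Hb Hs. unfold euler_int.
  assert (Hb0 : 0 < INR b) by (apply lt_0_INR; lia).
  rewrite (int01_power_subst _ b Hb) by now apply admissible_euler.
  rewrite <- int01_Cmult by (apply admissible_euler; [nia | exact Hs]).
  unfold int01. apply cint_ext; [lra|]. intros v Hv.
  assert (Hvb : 0 < v ^ b < 1).
  { split; [apply pow_lt; lra|]. apply pow_lt_1_compat; [lra | lia]. }
  rewrite !cut_in by assumption. unfold euler_integrand.
  assert (Hl := neg_ln_pos v Hv).
  assert (El : logt (v ^ b) = ln (INR b) + logt v).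
  { unfold logt. rewrite ln_pow by lra. rewrite <- ln_mult by lra. f_equal. ring. }
  assert (Et : tpow (s - 1) (v ^ b) = (Cexp ((s - 1) * RtoC (ln (INR b))) * tpow (s - 1) v)%C).
  { unfold tpow. rewrite El, RtoC_plus, <- Cexp_plus. f_equal. ring. }
  rewrite Et.
  replace (Cexp (s * RtoC (ln (INR b)))) with (Cexp ((s - 1) * RtoC (ln (INR b))) * RtoC (INR b))%C.
  2: { rewrite <- (exp_ln (INR b)) at 2 by exact Hb0. rewrite <- Cexp_RtoC, <- Cexp_plus. f_equal. ring. }
  replace (v ^ (b * S k - 1)) with (v ^ pred b * (v ^ b) ^ k).
  2: { rewrite <- pow_mult, <- pow_add. f_equal. nia. }
  rewrite !RtoC_mult. ring.
Qed.

Lemma euler_int_scaling (k : nat) (s : C) : (1 <= k)%nat -> 2 <= Re s ->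
  (euler_int k s * nat_cpow (S k) s)%C = (nat_cpow 2 s * euler_int 1 s)%C.
Proof.
  intros Hk Hs. unfold nat_cpow.
  rewrite (euler_int_power k 2 s Hk ltac:(lia) Hs), (euler_int_power 1 (S k) s ltac:(lia) ltac:(lia) Hs).
  replace (S k * 2 - 1)%nat with (2 * S k - 1)%nat by lia. ring.
Qed.

(** [Gamma (s + 1) = s Gamma s], by parts: the difference of the two sides
    integrates the derivative of [t^s e^(-2t)]. *)
Lemma euler_int_succ (s : C) : 2 <= Re s -> (2 * euler_int 1 (s + 1))%C = (s * euler_int 1 s)%C.
Proof.
  intros Hs.
  assert (Hs1 : 2 <= Re (s + 1)) by (rewrite re_plus, re_RtoC; lra).
  set (f := fun u => (2 * euler_integrand 1 (s + 1) u - s * euler_integrand 1 s u)%C).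
  assert (A1 := admissible_euler 1 (s + 1) ltac:(lia) Hs1). assert (A2 := admissible_euler 1 s ltac:(lia) Hs).
  assert (Af : admissible f) by (apply admissible_minus; now apply admissible_Cmult).
  assert (H : int01 f = RtoC 0).
  { apply int01_derive with (euler_integrand 2 (s + 1)).
    - apply admissible_euler; [lia | exact Hs1].
    - exact Af.
    - intros u Hu. assert (Hl := neg_ln_pos u Hu).
      eapply cis_derive_val.
      + apply (cis_derive_mult (tpow (s + 1 - 1)) (fun u => RtoC (u ^ 2))); [now apply tpow_derive|].
        apply (cis_derive_RtoC (fun u => u ^ 2) u (2 * u)). auto_derive; [easy | ring].
      + unfold f, euler_integrand.
        replace (s + 1 - 1)%C with ((s - 1) + 1)%C by ring. rewrite tpow_plus, tpow_1 by exact Hu.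
        replace (RtoC (u ^ 2)) with (RtoC u * RtoC u)%C by (rewrite <- RtoC_mult; f_equal; ring).
        rewrite pow_1, RtoC_mult, RtoC_opp, RtoC_inv, RtoC_mult by nra.
        assert (RtoC u <> RtoC 0) by (intros E; apply RtoC_inj in E; lra).
        assert (RtoC (ln u) <> RtoC 0) by (intros E; apply RtoC_inj in E; lra).
        field. split; assumption. }
  unfold f in H. rewrite int01_minus, !int01_Cmult in H; try assumption; try (now apply admissible_Cmult).
  fold (euler_int 1 (s + 1)) in H. fold (euler_int 1 s) in H.
  now apply Ceq_minus.
Qed.

(** The rising factorial [s (s + 1) ... (s + p - 1)]. *)
Fixpoint rising (s : C) (p : nat) : C :=
  match p with O => RtoC 1 | S q => (rising s q * (s + RtoC (INR q)))%C end.

Lemma euler_int_shift (s : C) (p : nat) : 2 <= Re s ->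
  (RtoC 2 ^ p * euler_int 1 (s + RtoC (INR p)))%C = (rising s p * euler_int 1 s)%C.
Proof.
  intros Hs. induction p as [|p IH].
  - simpl. replace (s + 0)%C with s by ring. ring.
  - rewrite S_INR, RtoC_plus, Cplus_assoc.
    assert (Hsp : 2 <= Re (s + RtoC (INR p))) by (rewrite re_plus, re_RtoC; assert (Q := pos_INR p); lra).
    rewrite Cpow_S. transitivity (RtoC 2 ^ p * (2 * euler_int 1 (s + RtoC (INR p) + 1)))%C; [ring|].
    rewrite (euler_int_succ _ Hsp). simpl.
    transitivity ((s + RtoC (INR p)) * (RtoC 2 ^ p * euler_int 1 (s + RtoC (INR p))))%C; [ring|].
    rewrite IH. ring.
Qed.

Lemma rising_zero (l p : nat) : (l < p)%nat -> rising (RtoC (- INR l)) p = RtoC 0.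
Proof.
  induction p as [|p IH]; intros H; [lia|]. simpl.
  destruct (Nat.eq_dec l p) as [->|Hne].
  - rewrite RtoC_opp. ring.
  - rewrite IH by lia. ring.
Qed.

Lemma euler_int_real_neq_0 (x : R) : 2 <= x -> euler_int 1 (RtoC x) <> RtoC 0.
Proof.
  intros Hx E.
  assert (A := admissible_euler 1 (RtoC x) ltac:(lia) Hx).
  assert (H := cont_on_is_RInt (cut (euler_integrand 1 (RtoC x))) 0 1 ltac:(lra) ltac:(intros u _; now apply cut_cont)).
  apply is_RInt_Re_Im in H. destruct H as [H _].
  change (cint (cut (euler_integrand 1 (RtoC x))) 0 1) with (euler_int 1 (RtoC x)) in H. rewrite E in H.
  assert (P : 0 < RInt (fun u => Re (cut (euler_integrand 1 (RtoC x)) u)) 0 1).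
  { apply RInt_gt_0; [lra | |].
    - intros u Hu. rewrite cut_in by exact Hu. unfold euler_integrand, tpow.
      replace ((RtoC x - 1) * RtoC (logt u))%C with (RtoC ((x - 1) * logt u)) by (apply C_ext; simpl; ring).
      rewrite Cexp_RtoC, re_scal_l, re_RtoC. apply Rmult_lt_0_compat; [apply exp_pos | simpl; lra].
    - intros u Hu. now apply continuous_Re, cut_cont. }
  rewrite (is_RInt_unique _ _ _ _ H) in P. simpl in P. lra.
Qed.

(** * Term by term integration *)

(** Comparison with a telescoping series. *)
Lemma ex_series_inv_sq : ex_series (fun n => / INR (S n) ^ 2).
Proof.
  assert (T : is_series (fun n => / (INR (S n) * INR (S (S n)))) 1).
  { assert (Hsum : forall n, sum_n (fun n => / (INR (S n) * INR (S (S n)))) n = 1 - / INR (S (S n))).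
    { induction n as [|n IH].
      - rewrite sum_O. simpl. field.
      - assert (X : forall x, 0 <= x -> 1 - / (x + 1 + 1) + / ((x + 1 + 1) * (x + 1 + 1 + 1)) = 1 - / (x + 1 + 1 + 1))
          by (intros x Hx; field; lra).
        rewrite sum_Sn, IH, !S_INR. exact (X _ (pos_INR n)). }
    unfold is_series. apply filterlim_ext with (fun n => 1 - / INR (S (S n))); [intros n; now rewrite Hsum|].
    assert (L : is_lim_seq (fun n => 1 - / INR (S (S n))) (1 - 0)).
    { apply is_lim_seq_minus'; [apply is_lim_seq_const|].
      apply is_lim_seq_ext with (fun n => / INR (n + 2)); [intros n; now replace (n + 2)%nat with (S (S n)) by lia|].
      apply (is_lim_seq_incr_n (fun n => / INR n) 2 0).
      assert (L := is_lim_seq_inv INR p_infty is_lim_seq_INR ltac:(discriminate)). exact L. }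
    rewrite Rminus_0_r in L. exact L. }
  apply (ex_series_le (K := R_AbsRing) (V := R_CompleteNormedModule) _ (fun n => 2 * / (INR (S n) * INR (S (S n))))).
  - intros n. change (norm (/ INR (S n) ^ 2)) with (Rabs (/ INR (S n) ^ 2)).
    assert (Q := pos_INR n). rewrite !S_INR.
    rewrite Rabs_pos_eq.
    + apply Rmult_le_reg_r with ((INR n + 1) ^ 2 * (INR n + 1 + 1)); [apply Rmult_lt_0_compat; [apply pow_lt|]; lra|].
      replace (/ (INR n + 1) ^ 2 * ((INR n + 1) ^ 2 * (INR n + 1 + 1))) with (INR n + 1 + 1) by (field; lra).
      replace (2 * / ((INR n + 1) * (INR n + 1 + 1)) * ((INR n + 1) ^ 2 * (INR n + 1 + 1))) with (2 * (INR n + 1)) by (field; lra).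
      lra.
    + apply Rlt_le, Rinv_0_lt_compat, pow_lt. lra.
  - exists (2 * 1). exact (is_series_scal 2 _ _ T).
Qed.

Lemma is_series_int01 (F : R -> C) (term : nat -> R -> C) (M : nat -> R) :
  admissible F -> (forall n, admissible (term n)) ->
  (forall n u, 0 < u < 1 -> Cmod (term n u) <= M n) -> ex_series M ->
  (forall u, 0 < u < 1 -> is_series (fun n => term n u) (F u)) ->
  is_series (fun n => int01 (term n)) (int01 F).
Proof.
  intros HF Ht HM HMs Hs.
  assert (P : forall K, admissible (fun u => sum_n (fun n => term n u) K) /\
     int01 (fun u => sum_n (fun n => term n u) K) = sum_n (fun n => int01 (term n)) K).
  { induction K as [|K [IH1 IH2]].
    - split; [apply admissible_ext with (term O); [intros u; now rewrite sum_O | apply Ht]|].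
      rewrite sum_O. apply int01_ext. intros u _. now rewrite sum_O.
    - split.
      + apply admissible_ext with (fun u => sum_n (fun n => term n u) K + term (S K) u)%C.
        * intros u. now rewrite sum_Sn.
        * apply admissible_plus; [exact IH1 | apply Ht].
      + rewrite sum_Sn, <- IH2. transitivity (int01 (fun u => sum_n (fun n => term n u) K + term (S K) u)%C).
        * apply int01_ext. intros u _. now rewrite sum_Sn.
        * now apply int01_plus. }
  intros Pr [e HP].
  destruct (Series_correct _ HMs (fun z => ball (Series M) e z) (locally_ball _ _)) as [K0 HK0].
  exists K0. intros K HK. apply HP, ball_C_Cmod.
  specialize (HK0 K HK). change (Rabs (sum_n M K - Series M) < e) in HK0. apply Rabs_def2 in HK0.
  destruct (P K) as [A1 A2].
  assert (EQ : (sum_n (fun n => int01 (term n)) K - int01 F)%C = int01 (fun u => sum_n (fun n => term n u) K - F u)%C)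
    by (rewrite <- A2; symmetry; now apply int01_minus).
  refine (Rle_lt_trans _ _ _ (Req_le _ _ (f_equal Cmod EQ)) _).
  eapply Rle_lt_trans; [apply int01_bound with (B := Series M - sum_n M K)|lra].
  - now apply admissible_minus.
  - intros u Hu. rewrite Cmod_minus_sym, <- (CSeries_unique _ _ (Hs u Hu)).
    apply (dominated_tail (fun n => term n u)); [intros n; now apply HM | exact HMs].
Qed.

(** * The double series *)

(** [f(i t / 2 pi)] for [u = e^{-t}]. *)
Definition vertical (f : C -> C) (u : R) : C := f (0, - ln u / (2 * PI)).

Definition polylog_weight (f : C -> C) (m : nat) (u : R) : C :=
  (tpow (- (1)) u * RtoC (u ^ m) * vertical f u)%C.

(** [sum_m (m+1)^(-s1) int_0^oo t^(s2-1) e^(-(m+1)t) f(i t / 2 pi) dt]. *)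
Definition mellin_series (f : C -> C) (s : C2) : C :=
  CSeries (fun m => laplace (ln (INR (S m))) (polylog_weight f m) s).

Lemma vertical_cont (f : C -> C) (u : R) :
  (forall tau, upper_half_plane tau -> ex_derive f tau) -> 0 < u < 1 -> continuous (vertical f) u.
Proof.
  intros Hf Hu. assert (HPI := PI_RGT_0). assert (Hl := neg_ln_pos u Hu).
  set (y := fun v => - ln v / (2 * PI)).
  assert (Hy : 0 < y u) by (apply Rdiv_lt_0_compat; lra).
  apply continuous_eps. intros e He.
  destruct (ex_derive_C_cont f (0, y u) (Hf (0, y u) Hy) e He) as [d [Hd H]].
  assert (Cy : continuous (fun v => RtoC (y v)) u).
  { eapply cis_derive_cont, (cis_derive_RtoC y u (- (/ u) / (2 * PI))). unfold y. auto_derive.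
    - lra.
    - field. lra. }
  destruct (proj1 (continuous_eps _ u) Cy d Hd) as [d' [Hd' H']].
  exists d'. split; [exact Hd'|]. intros v Hv. apply H.
  refine (Rle_lt_trans _ _ _ (Req_le _ _ _) (H' v Hv)).
  transitivity (Cmod (Ci * (RtoC (y v) - RtoC (y u)))).
  - apply f_equal, C_ext; unfold y; simpl; ring.
  - rewrite Cmod_mult, Cmod_Ci. apply Rmult_1_l.
Qed.

Lemma vertical_decay (N k : nat) (f : C -> C) (a : nat -> C) (j : nat) :
  (1 <= N)%nat -> cusp_form N k f -> cuspidal_expansion 1 a f ->
  exists M, 0 <= M /\ forall u, 0 < u < 1 -> Cmod (vertical f u) <= M * exp (INR j * logt u) * u.
Proof.
  intros HN Hf Ha. destruct (cusp_form_rapid_decay N k f a j HN Hf Ha) as [M [HM0 HM]].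
  exists M. split; [exact HM0|]. intros u Hu. assert (Hl := neg_ln_pos u Hu).
  specialize (HM _ Hl). rewrite Ropp_involutive, exp_ln in HM by lra.
  rewrite (pow_exp_ln j (- ln u) Hl) in HM. exact HM.
Qed.

Lemma vertical_series (f : C -> C) (a : nat -> C) (u : R) : cuspidal_expansion 1 a f -> 0 < u < 1 ->
  is_series (fun n => a (S n) * RtoC (u ^ S n))%C (vertical f u).
Proof.
  intros Ha Hu. assert (HPI := PI_RGT_0). assert (Hl := neg_ln_pos u Hu).
  assert (Hy : upper_half_plane (0, - ln u / (2 * PI))) by (apply Rdiv_lt_0_compat; lra).
  apply is_series_ext with (2 := Ha _ Hy). intros n. apply f_equal.
  rewrite pow_exp_ln, <- Cexp_RtoC by lra. f_equal. set (q := INR (S n)).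
  apply C_ext; simpl; field; lra.
Qed.

Lemma laplace_kernel_weight (f : C -> C) (m : nat) (s1 s2 : C) (u : R) :
  laplace_kernel (ln (INR (S m))) (polylog_weight f m) (s1, s2) u =
  (/ nat_cpow (S m) s1 * (tpow (s2 - 1) u * RtoC (u ^ m) * vertical f u))%C.
Proof.
  unfold laplace_kernel, polylog_weight, nat_cpow. cbn [fst snd].
  replace (s2 - 1)%C with (s2 + - (1))%C by ring. rewrite tpow_plus.
  rewrite Cexp_plus, <- Cexp_opp. fold (tpow s2 u).
  replace (s1 * RtoC (- ln (INR (S m))))%C with (- (s1 * RtoC (ln (INR (S m)))))%C by (rewrite RtoC_opp; ring).
  ring.
Qed.

(** The decay of [f] at the cusp 0 makes the integrals of size
    [(m + 1)^(-2)], uniformly near each point of [C^2]. *)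
Lemma mellin_series_bound (N k : nat) (f : C -> C) (a : nat -> C) (s : C2) :
  (1 <= N)%nat -> cusp_form N k f -> cuspidal_expansion 1 a f ->
  exists D, forall m, laplace_bound (ln (INR (S m))) (polylog_weight f m) s (D * / INR (S m) ^ 2).
Proof.
  intros HN Hf Ha. destruct s as [s1 s2].
  destruct (INR_unbounded (Rabs (Re s1) + Rabs (Re s2 - 1) + 4)) as [b Hb].
  assert (P1 := Rabs_pos (Re s1)). assert (P2 := Rabs_pos (Re s2 - 1)).
  destruct (vertical_decay N k f a (2 * b + 2) HN Hf Ha) as [M [HM0 HM]].
  destruct (exp_logt_abs_decay (INR (2 * b + 2)) (INR b)) as [D [HD HDu]]; [lra | apply le_INR; lia |].
  exists (M * D). intros m. assert (Hm : 1 <= INR (S m)) by (apply (le_INR 1); lia).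
  set (L := ln (INR (S m))). assert (HL : 0 <= L) by (apply ln_INR_ge_0; lia).
  split; [exact HL|]. split.
  - intros u Hu. apply continuous_Cmult; [apply continuous_Cmult|].
    + eapply cis_derive_cont. now apply tpow_derive.
    + apply cont_pow.
    + apply vertical_cont; [apply Hf | exact Hu].
  - intros u Hu. unfold L. rewrite laplace_kernel_weight. fold L.
    rewrite !Cmod_mult, Cmod_tpow, Cmod_R, (Rabs_pos_eq (u ^ m)) by (apply pow_le; lra).
    unfold nat_cpow. rewrite <- Cexp_opp, Cmod_Cexp. fold L.
    replace (Re (- (s1 * RtoC L))) with (- (Re s1 * L)) by (rewrite re_opp, re_scal_r; reflexivity).
    replace (Re (s2 - 1)) with (Re s2 - 1) by (simpl; unfold Re; ring).
    set (T := logt u). set (X := L + Rabs T).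
    assert (HX : exp (- (Re s1 * L)) * exp ((Re s2 - 1) * T) * exp (4 * X) <= exp (INR b * L) * exp (INR b * Rabs T)).
    { rewrite <- !exp_plus. apply exp_mono.
      assert (Q1 : - (Re s1 * L) <= Rabs (Re s1) * L) by (assert (Q := Rle_abs (- Re s1)); rewrite Rabs_Ropp in Q; nra).
      assert (Q2 : (Re s2 - 1) * T <= Rabs (Re s2 - 1) * Rabs T) by (rewrite <- Rabs_mult; apply Rle_abs).
      assert (QT := Rabs_pos T). unfold X. nra. }
    specialize (HM u Hu). fold T in HM. specialize (HDu (INR (S m)) u Hm Hu). fold T L in HDu.
    assert (Hum : u ^ m * u = exp (INR (S m) * ln u)).
    { rewrite <- pow_exp_ln by lra. simpl. ring. }
    assert (Pu : 0 <= u ^ m) by (apply pow_le; lra).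
    assert (PX : 0 <= exp (INR b * L) * exp (INR b * Rabs T)) by (apply Rlt_le, Rmult_lt_0_compat; apply exp_pos).
    apply Rle_trans with ((exp (INR b * L) * exp (INR b * Rabs T)) * (u ^ m * (M * exp (INR (2 * b + 2) * T) * u))).
    { replace (exp (- (Re s1 * L)) * (exp ((Re s2 - 1) * T) * u ^ m * Cmod (vertical f u)) * exp (4 * X)) with
       ((exp (- (Re s1 * L)) * exp ((Re s2 - 1) * T) * exp (4 * X)) * (u ^ m * Cmod (vertical f u))) by ring.
      apply Rmult_le_compat; [| apply Rmult_le_pos; [exact Pu | apply Cmod_ge_0] | exact HX | now apply Rmult_le_compat_l].
      rewrite <- !exp_plus. apply Rlt_le, exp_pos. }
    replace ((exp (INR b * L) * exp (INR b * Rabs T)) * (u ^ m * (M * exp (INR (2 * b + 2) * T) * u))) with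
      (M * exp (INR b * L) * (exp (INR (2 * b + 2) * T) * (u ^ m * u) * exp (INR b * Rabs T))) by ring.
    rewrite Hum.
    apply Rle_trans with (M * exp (INR b * L) * (D * exp (- ((INR (2 * b + 2) - INR b) * L)))).
    { apply Rmult_le_compat_l; [|exact HDu]. apply Rmult_le_pos; [lra | apply Rlt_le, exp_pos]. }
    replace (/ INR (S m) ^ 2) with (exp (- (2 * L))).
    + right. replace (M * exp (INR b * L) * (D * exp (- ((INR (2 * b + 2) - INR b) * L)))) with
        (M * D * (exp (INR b * L) * exp (- ((INR (2 * b + 2) - INR b) * L)))) by ring.
      rewrite <- exp_plus. do 2 f_equal. rewrite plus_INR, mult_INR. simpl (INR 2). ring.
    + rewrite exp_Ropp. f_equal. replace (2 * L) with (L + L) by ring. rewrite exp_plus. unfold L. rewrite exp_ln by lra. ring.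
Qed.

Theorem mellin_series_holomorphic (N k : nat) (f : C -> C) (a : nat -> C) (s : C2) :
  (1 <= N)%nat -> cusp_form N k f -> cuspidal_expansion 1 a f -> cdiff2 (mellin_series f) s.
Proof.
  intros HN Hf Ha. destruct (mellin_series_bound N k f a s HN Hf Ha) as [D HD].
  apply (cdiff2_laplace_series (fun m => ln (INR (S m))) (polylog_weight f) _ s HD).
  destruct ex_series_inv_sq as [l Hl]. exists (D * l). exact (is_series_scal D _ _ Hl).
Qed.

Lemma nat_cpow_neq_0 k s : nat_cpow k s <> RtoC 0.
Proof. apply Cexp_neq_0. Qed.

Lemma Cmod_nat_cpow k s : Cmod (nat_cpow k s) = exp (Re s * ln (INR k)).
Proof. unfold nat_cpow. now rewrite Cmod_Cexp, re_scal_r. Qed.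

Lemma exp_ln_pow (n p : nat) : exp (INR p * ln (INR (S n))) = INR (S n) ^ p.
Proof. rewrite pow_exp_ln; [reflexivity | apply lt_0_INR; lia]. Qed.

Lemma ln_INR_le (j k : nat) : (1 <= j)%nat -> (j <= k)%nat -> ln (INR j) <= ln (INR k).
Proof. intros H1 H2. apply ln_le; [apply lt_0_INR; lia | now apply le_INR]. Qed.

(** The factor is [2^(s2) * (2^(-s2) Gamma(s2)) = Gamma(s2)]: in the region of
    absolute convergence, [Gamma(s2) (m + n)^(-s2)] is an Euler integral, and the
    sum over [n] may be taken under the integral sign. *)
Theorem mellin_series_eq (N k : nat) (f : C -> C) (a : nat -> C) (s1 s2 : C) :
  (1 <= N)%nat -> cusp_form N k f -> cuspidal_expansion 1 a f ->
  0 <= Re s1 -> INR k + 4 <= Re s2 ->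
  mellin_series f (s1, s2) = (nat_cpow 2 s2 * euler_int 1 s2 * L2_series a s1 s2)%C.
Proof.
  intros HN Hf Ha Hs1 Hs2. assert (Hk := pos_INR k).
  destruct (cusp_form_coefficient_bound N k f a HN Hf Ha) as [M [HM0 HM]].
  set (x := fun m n => (a (S n) / (nat_cpow (S m) s1 * nat_cpow (S m + S n) s2))%C).
  destruct ex_series_inv_sq as [Z HZ].
  (* absolute convergence of the double series *)
  assert (Hx : forall m n, Cmod (x m n) <= M * / INR (S m) ^ 2 * / INR (S n) ^ 2).
  { intros m n. unfold x. rewrite Cmod_div by (apply Cmult_neq_0; apply nat_cpow_neq_0).
    rewrite Cmod_mult, !Cmod_nat_cpow.
    assert (Lm : 0 <= ln (INR (S m))) by (apply ln_INR_ge_0; lia).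
    assert (Ln : 0 <= ln (INR (S n))) by (apply ln_INR_ge_0; lia).
    assert (Lmk := ln_INR_le (S m) (S m + S n) ltac:(lia) ltac:(lia)).
    assert (Lnk := ln_INR_le (S n) (S m + S n) ltac:(lia) ltac:(lia)).
    assert (Pm : 0 < INR (S m)) by (apply lt_0_INR; lia). assert (Pn : 0 < INR (S n)) by (apply lt_0_INR; lia).
    assert (Den : INR (S m) ^ 2 * INR (S n) ^ (k + 2) <= exp (Re s1 * ln (INR (S m))) * exp (Re s2 * ln (INR (S m + S n)))).
    { rewrite <- !exp_ln_pow, <- !exp_plus. apply exp_mono. rewrite plus_INR. change (INR 2) with 2. nra. }
    apply Rle_trans with (M * INR (S n) ^ k * / (INR (S m) ^ 2 * INR (S n) ^ (k + 2))).
    - apply Rmult_le_compat; [apply Cmod_ge_0 | | apply HM |].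
      + apply Rlt_le, Rinv_0_lt_compat, Rmult_lt_0_compat; apply exp_pos.
      + apply Rinv_le_contravar; [|exact Den]. apply Rmult_lt_0_compat; now apply pow_lt.
    - right. rewrite pow_add. field. repeat split; try apply pow_nonzero; lra. }
  assert (Hx1 : forall m, is_series (fun n => M * / INR (S m) ^ 2 * / INR (S n) ^ 2) (M * / INR (S m) ^ 2 * Z)).
  { intros m. exact (is_series_scal (M * / INR (S m) ^ 2) _ _ HZ). }
  assert (Hin : forall m, is_series (x m) (CSeries (x m)) /\ Cmod (CSeries (x m)) <= M * / INR (S m) ^ 2 * Z).
  { intros m. rewrite <- (is_series_unique _ _ (Hx1 m)). apply Cseries_dominated; [apply Hx | eexists; apply Hx1]. }
  assert (Hout : is_series (fun m => CSeries (x m)) (CSeries (fun m => CSeries (x m)))).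
  { apply (Cseries_dominated _ (fun m => M * / INR (S m) ^ 2 * Z)); [intros m; apply Hin|].
    exists (M * Z * Z). apply is_series_ext with (fun m => (M * Z) * / INR (S m) ^ 2).
    { intros m. assert (X : forall p q r : R, p * q * r = p * r * q) by (intros; ring). apply X. }
    exact (is_series_scal (M * Z) _ _ HZ). }
  change (L2_series a s1 s2) with (CSeries (fun m => CSeries (x m))).
  set (ga := (nat_cpow 2 s2 * euler_int 1 s2)%C).
  apply CSeries_unique.
  apply is_series_ext with (fun m => ga * CSeries (x m))%C; [|now apply is_series_Cmult].
  intros m.
  (* the m-th integral, term by term in n *)
  set (F := fun u => (tpow (s2 - 1) u * RtoC (u ^ m) * vertical f u)%C).
  set (term := fun n u => (a (S n) * euler_integrand (m + S n) s2 u)%C).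
  assert (AT : forall n, admissible (term n)).
  { intros n. apply admissible_Cmult, admissible_euler; [lia | lra]. }
  assert (Res : Re (s2 - 1) = Re s2 - 1) by (simpl; unfold Re; ring).
  assert (AF : admissible F).
  { split.
    - intros u Hu. apply continuous_Cmult; [apply continuous_Cmult|].
      + eapply cis_derive_cont. now apply tpow_derive.
      + apply cont_pow.
      + apply vertical_cont; [apply Hf | exact Hu].
    - destruct (vertical_decay N k f a 0 HN Hf Ha) as [M' [HM'0 HM']].
      destruct (admissible_euler (S m) s2 ltac:(lia) ltac:(lra)) as [_ [B HB]].
      exists (M' * B). intros u Hu. specialize (HM' u Hu). specialize (HB u Hu).
      rewrite Rmult_0_l, exp_0, Rmult_1_r in HM'. unfold euler_integrand in HB.
      assert (E : (tpow (s2 - 1) u * RtoC (u ^ S m))%C = (tpow (s2 - 1) u * RtoC (u ^ m) * RtoC u)%C).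
      { simpl (u ^ S m). rewrite RtoC_mult. ring. }
      rewrite E, (Cmod_mult _ (RtoC u)), (Cmod_R u), (Rabs_pos_eq u) in HB by lra.
      unfold F. rewrite (Cmod_mult _ (vertical f u)).
      set (P := Cmod (tpow (s2 - 1) u * RtoC (u ^ m))) in *. assert (HP : 0 <= P) by apply Cmod_ge_0.
      apply Rle_trans with (P * (M' * u)); [now apply Rmult_le_compat_l|]. nra. }
  assert (HI : is_series (fun n => int01 (term n)) (int01 F)).
  { destruct (exp_logt_decay (Re s2 - 1) ltac:(lra)) as [D [HD HDu]].
    apply is_series_int01 with (M := fun n => M * D * / INR (S n) ^ 2); try assumption.
    - intros n u Hu. unfold term. rewrite Cmod_mult, Cmod_euler_integrand by lra.
      assert (Hmn : 1 <= INR (m + S n)) by (apply (le_INR 1); lia).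
      specialize (HDu (INR (m + S n)) u Hmn Hu). specialize (HM n).
      assert (Ln : 0 <= ln (INR (S n))) by (apply ln_INR_ge_0; lia).
      assert (Lnk := ln_INR_le (S n) (m + S n) ltac:(lia) ltac:(lia)).
      assert (Pn : 0 < INR (S n)) by (apply lt_0_INR; lia).
      assert (E : exp (- ((Re s2 - 1) * ln (INR (m + S n)))) <= / INR (S n) ^ (k + 2)).
      { rewrite <- exp_ln_pow, <- exp_Ropp. apply exp_mono. rewrite (plus_INR k 2). change (INR 2) with 2. nra. }
      apply Rle_trans with (M * INR (S n) ^ k * (D * / INR (S n) ^ (k + 2))).
      + apply Rmult_le_compat; [apply Cmod_ge_0 | apply Rlt_le, Rmult_lt_0_compat; apply exp_pos | exact HM |].
        eapply Rle_trans; [exact HDu|]. apply Rmult_le_compat_l; lra.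
      + right. rewrite pow_add. field. repeat split; try apply pow_nonzero; lra.
    - exists (M * D * Z). exact (is_series_scal (M * D) _ _ HZ).
    - intros u Hu.
      assert (V := is_series_Cmult _ _ (tpow (s2 - 1) u * RtoC (u ^ m))%C (vertical_series f a u Ha Hu)).
      apply is_series_ext with (2 := V). intros n. unfold term, euler_integrand.
      rewrite pow_add, RtoC_mult. 
      assert (X : forall p q r t : C, (p * q * (r * t))%C = (r * (p * (q * t)))%C) by (intros; ring). apply X. }
  assert (HL : laplace (ln (INR (S m))) (polylog_weight f m) (s1, s2) = (/ nat_cpow (S m) s1 * int01 F)%C).
  { unfold laplace. rewrite <- int01_Cmult by exact AF. apply int01_ext. intros u _. apply laplace_kernel_weight. }
  rewrite HL.
  assert (S1 := is_series_Cmult _ _ (/ nat_cpow (S m) s1)%C HI).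
  assert (S2 := is_series_Cmult _ _ ga (proj1 (Hin m))).
  rewrite <- (CSeries_unique _ _ S1). symmetry. apply CSeries_unique.
  apply is_series_ext with (2 := S2).  intros n.
  assert (E : (ga * x m n)%C = (/ nat_cpow (S m) s1 * int01 (term n))%C); [|exact E].
  unfold x, term, ga. rewrite int01_Cmult by (apply admissible_euler; [lia | lra]).
  change (int01 (euler_integrand (m + S n) s2)) with (euler_int (m + S n) s2).
  assert (G := euler_int_scaling (m + S n) s2 ltac:(lia) ltac:(lra)). change (S (m + S n)) with (S m + S n)%nat in G.
  rewrite <- G. field. split; apply nat_cpow_neq_0.
Qed.

(** * The zero divisor *)

Lemma cdiff2_nat_cpow_snd (k : nat) (p : C2) : cdiff2 (fun q : C2 => nat_cpow k (snd q)) p.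
Proof.
  destruct p as [p1 p2]. set (c := RtoC (ln (INR k))). set (K := (Cmod c) ^ 2 * exp (Cmod c)).
  assert (Hc := Cmod_ge_0 c).
  apply cdiff2_of_quadratic with (A := RtoC 0) (B := (c * nat_cpow k p2)%C) (K := Cmod (nat_cpow k p2) * K).
  - apply Rmult_le_pos; [apply Cmod_ge_0|]. apply Rmult_le_pos; [apply pow2_ge_0 | apply Rlt_le, exp_pos].
  - intros h1 h2 Hh. cbn [fst snd]. assert (P1 := Cmod_ge_0 h1). assert (P2 := Cmod_ge_0 h2).
    assert (E : nat_cpow k (p2 + h2)%C = (nat_cpow k p2 * Cexp (h2 * c))%C).
    { unfold nat_cpow. fold c. rewrite <- Cexp_plus. f_equal. ring. }
    rewrite E.
    replace (nat_cpow k p2 * Cexp (h2 * c) - nat_cpow k p2 - (RtoC 0 * h1 + c * nat_cpow k p2 * h2))%C with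
      (nat_cpow k p2 * (Cexp (h2 * c) - 1 - h2 * c))%C by ring.
    rewrite Cmod_mult, Rmult_assoc. apply Rmult_le_compat_l; [apply Cmod_ge_0|].
    eapply Rle_trans; [apply Cexp_taylor_le|]. rewrite Cmod_mult, Rpow_mult_distr. unfold K.
    replace (Cmod c ^ 2 * exp (Cmod c) * (Cmod h1 + Cmod h2) ^ 2) with ((Cmod h1 + Cmod h2) ^ 2 * Cmod c ^ 2 * exp (Cmod c)) by ring.
    apply Rmult_le_compat.
    + apply Rmult_le_pos; apply pow2_ge_0.
    + apply Rlt_le, exp_pos.
    + apply Rmult_le_compat_r; [apply pow2_ge_0|]. apply pow_incr. lra.
    + apply exp_mono. nra.
Qed.

Lemma cdiff2_rising_snd (n : nat) (p : C2) : cdiff2 (fun q : C2 => rising (snd q) n) p.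
Proof.
  induction n as [|n IH].
  - exact (cdiff2_const (RtoC 1) p).
  - apply (cdiff2_mult (fun q : C2 => rising (snd q) n) (fun q : C2 => (snd q + RtoC (INR n))%C)); [exact IH|].
    apply cdiff2_ext with (2 := cdiff2_affine 0 1 (RtoC (INR n)) p). intros q.
    assert (X : forall a b c : C, (0 * a + 1 * b + c)%C = (b + c)%C) by (intros; ring). apply X.
Qed.

Lemma cdiff2_euler_int_snd (r : R) (p : C2) : 6 <= Re (snd p) + r ->
  cdiff2 (fun q : C2 => euler_int 1 (snd q + RtoC r)) p.
Proof.
  intros Hp. set (w := fun u => (tpow (RtoC r - 1) u * RtoC (u ^ 1))%C).
  apply cdiff2_ext with (laplace 0 w).
  - intros q. apply int01_ext. intros u Hu. unfold laplace_kernel, euler_integrand, w.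
    replace (snd q + RtoC r - 1)%C with (snd q + (RtoC r - 1))%C.
    + rewrite tpow_plus. unfold tpow at 2.
      replace (fst q * RtoC (- 0) + snd q * RtoC (logt u))%C with (snd q * RtoC (logt u))%C.
      * set (A := Cexp _). set (B := tpow _ _). ring.
      * rewrite Ropp_0. set (A := fst q). set (B := snd q). 
        assert (X : forall a b c : C, (b * c)%C = (a * RtoC 0 + b * c)%C) by (intros; ring). apply X.
    + assert (X : forall a b : C, (a + (b - 1))%C = (a + b - 1)%C) by (intros; ring). apply X.
  - destruct (exp_logt_abs_decay (Re (snd p) + r - 1) 4 ltac:(lra) ltac:(lra)) as [D [HD H]].
    apply cdiff2_laplace with D. split; [lra|]. split.
    + intros u Hu. apply continuous_Cmult; [|apply cont_pow]. eapply cis_derive_cont. now apply tpow_derive.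
    + intros u Hu. unfold laplace_kernel, w.
      rewrite !Cmod_mult, Cmod_Cexp, Cmod_tpow, Cmod_R, pow_1, (Rabs_pos_eq u) by lra.
      specialize (H 1 u ltac:(lra) Hu). rewrite ln_1, Rmult_0_r, Ropp_0, exp_0, Rmult_1_r, Rmult_1_l, exp_ln in H by lra.
      rewrite Rplus_0_l. eapply Rle_trans; [|exact H]. right.
      replace (exp ((Re (snd p) + r - 1) * logt u)) with
       (exp (Re (fst p * RtoC (- 0) + snd p * RtoC (logt u))) * exp (Re (RtoC r - 1) * logt u)); [ring|].
      rewrite <- exp_plus. f_equal. destruct p as [[x1 y1] [x2 y2]]. simpl. ring.
Qed.

Theorem corollary2p6 :
  forall (N kappa : nat) (f : C -> C) (a : nat -> C) (L2 : C2 -> C),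
    (1 <= N)%nat ->
    (0 < kappa)%nat -> Nat.Even kappa ->
    cusp_form N kappa f ->
    cuspidal_expansion 1 a f ->
    L2_continuation kappa a L2 ->
    forall l : nat,
      (exists s1 : C, ~ singular_locus L2 (s1, RtoC (- INR l))) /\
      (forall s1 : C, ~ singular_locus L2 (s1, RtoC (- INR l)) ->
         value_at L2 (s1, RtoC (- INR l)) (RtoC 0)).
Proof.
  intros N kappa f a L2 HN _ _ Hf Ha [Hmer Hser] l.
  cut (forall s1 : C, value_at L2 (s1, RtoC (- INR l)) (RtoC 0)).
  { intros H. split; [|intros s1 _; apply H].
    exists (RtoC 0). intros Hs. apply Hs. eexists. apply H. }
  (* with n = l + 7 the rising factorial vanishes at -l, and s2 + n has real part
     at least 6 in the half-space Re s2 > -l - 1 *)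
  intros s1. set (n := (l + 7)%nat).
  assert (Hn : INR n = INR l + 7) by (unfold n; rewrite plus_INR; simpl; ring).
  set (H := fun q : C2 => (nat_cpow 2 (snd q) * (RtoC 2 ^ n * euler_int 1 (snd q + RtoC (INR n))))%C).
  set (K := fun q : C2 => (rising (snd q) n * mellin_series f q)%C).
  set (c := - INR l - 1). set (p := (s1, RtoC (- INR l)) : C2).
  assert (HH : forall q : C2, c < Re (snd q) -> cdiff2 H q).
  { intros q Hq. apply cdiff2_mult; [apply cdiff2_nat_cpow_snd|].
    apply cdiff2_mult; [exact (cdiff2_const _ q)|]. apply cdiff2_euler_int_snd. unfold c in Hq. lra. }
  assert (HK : forall q : C2, c < Re (snd q) -> cdiff2 K q).
  { intros q _. apply cdiff2_mult; [apply cdiff2_rising_snd | now apply (mellin_series_holomorphic N kappa f a)]. }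
  assert (Hcp : c < Re (snd p)) by (simpl; unfold c; lra).
  assert (Hk := pos_INR kappa). assert (Hl := pos_INR l).
  set (p0 := (RtoC 2, RtoC (INR kappa + 6)) : C2).
  assert (Hcp0 : c < Re (snd p0)) by (simpl; unfold c; lra).
  assert (Hp0 : locally p0 (fun q => (L2 q * H q)%C = K q)).
  { apply locally_C2. exists 1. split; [lra|]. intros [x1 x2] H1 H2. cbn [fst snd] in H1, H2.
    assert (R1 : 1 < Re x1).
    { apply (Re_near x1 (RtoC 2)) in H1. rewrite re_RtoC in H1. lra. }
    assert (R2 : INR kappa + 5 < Re x2).
    { apply (Re_near x2 (RtoC (INR kappa + 6))) in H2. rewrite re_RtoC in H2. lra. }
    rewrite Hser by lra. unfold H, K. cbn [fst snd].
    assert (E := mellin_series_eq N kappa f a x1 x2 HN Hf Ha ltac:(lra) ltac:(lra)).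
    refine (eq_trans _ (f_equal (Cmult (rising x2 n)) (eq_sym E))).
    rewrite (euler_int_shift x2 n) by lra. ring. }
  assert (Hag := meromorphic_identity L2 H K c p0 p Hmer HH HK Hcp0 Hcp Hp0).
  assert (Hpn : H p <> RtoC 0).
  { unfold H. apply Cmult_neq_0; [apply nat_cpow_neq_0|]. apply Cmult_neq_0.
    - apply Cpow_nz. intros E. apply RtoC_inj in E. lra.
    - cbn [snd p]. rewrite <- RtoC_plus. apply euler_int_real_neq_0. lra. }
  assert (HpK : K p = RtoC 0).
  { unfold K. cbn [snd p]. rewrite rising_zero by (unfold n; lia). ring. }
  destruct (cdiff2_nonzero_near H p (HH p Hcp) Hpn) as [r [Hr Hnz]].
  assert (Hnear : exists r', 0 < r' /\ r' <= r /\ forall q, in_box p r' q -> c < Re (snd q)).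
  { exists (Rmin r (/ 2)). split; [apply Rmin_glb_lt; lra|]. split; [apply Rmin_l|].
    intros [q1 q2] [_ Hq]. cbn [fst snd p] in *. assert (M := Rmin_r r (/ 2)).
    apply (Re_near q2 (RtoC (- INR l))) in Hq. rewrite re_RtoC in Hq. unfold c. lra. }
  destruct Hnear as [r' [Hr' [Hrr Hc]]].
  exists (fun q => K q * / H q)%C. split; [|split].
  - apply holomorphic_at_box. exists r'. split; [exact Hr'|]. intros q Hq.
    apply cdiff2_mult; [now apply HK, Hc|]. apply cdiff2_inv; [now apply HH, Hc|].
    now apply Hnz, (in_box_le p q r' r).
  - rewrite HpK. ring.
  - unfold agree_near in Hag. apply locally_box in Hag. destruct Hag as [r2 [Hr2 Hag]].
    apply locally_box. exists (Rmin r r2). split; [now apply Rmin_glb_lt|]. intros q Hq HL.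
    assert (N0 := Hnz q (in_box_le p q _ _ (Rmin_l r r2) Hq)).
    rewrite <- (Hag q (in_box_le p q _ _ (Rmin_r r r2) Hq) HL). field. exact N0.
Qed.
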